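(* Let $\mathcal L=\mathcal H+\alpha\mathcal L_x+\gamma\mathcal L_v$ be the generator of the perturbed Langevin dynamics on $\mathbb R^d\times\mathbb R^d$ with potential $U$ and parameters $\alpha,\gamma\in[0,\infty)$. (i) If $\alpha=0$, then $\mathrm s(\mathcal L)\le2\gamma$. In particular, $\overline t_{\mathrm{rel}}\ge\frac{1-e^{-1}}{\gamma}$ and $t_{\mathrm{rel}}\ge\frac{1-e^{-1}}{2\gamma}$. (ii) In general, $$\mathrm s(\mathcal L)\ \le\ (\gamma^{-1}+\alpha)\,\widetilde m\qquad\text{with}\qquad\widetilde m=\inf_{\substack{f\in L_0^2(\nu)\setminus\{0\}\\ f\text{ affine}}}\frac{\|\mathcal L_xf\|}{\|f\|}.$$ In particular, $\overline t_{\mathrm{rel}}\ge\frac{2(1-e^{-1})}{\widetilde m(\gamma^{-1}+\alpha)}$ and $t_{\mathrm{rel}}\ge\frac{1-e^{-1}}{\widetilde m(\gamma^{-1}+\alpha)}$.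
   Context: $U\in C^2(\mathbb R^d)$ with $\lim_{|x|\to\infty}U(x)=\infty$ and $e^{-U}\in L^1(\mathbb R^d)$. $\nu(\mathrm dx)\propto e^{-U(x)}\mathrm dx$ is a probability measure, $\kappa=\mathcal N(0,I_d)$, $\mu=\nu\otimes\kappa$. It is assumed that for some $m\in(0,\infty)$, $\int f^2\mathrm d\nu\le\frac1m\int|\nabla f|^2\mathrm d\nu$ for all $f\in H^1(\nu)\cap L_0^2(\nu)$, where $L_0^2$ denotes mean-zero $L^2$ functions. The perturbed Langevin dynamics is the diffusion $\mathrm dX_t=V_t\,\mathrm dt-\alpha\nabla U(X_t)\,\mathrm dt+\sqrt{2\alpha}\,\mathrm dB_t$, $\mathrm dV_t=-\nabla U(X_t)\,\mathrm dt-\gamma V_t\,\mathrm dt+\sqrt{2\gamma}\,\mathrm dW_t$ with independent $d$-dimensional Brownian motions $B,W$; it is a Markov process with invariant measure $\mu$, transition semigroup $(P_t)$ on $L^2(\mu)$ and generator $\mathcal L=\mathcal H+\alpha\mathcal L_x+\gamma\mathcal L_v$, where $\mathcal H=v\cdot\nabla_x-\nabla U(x)\cdot\nabla_v$, $\mathcal L_x=-\nabla U(x)\cdot\nabla_x+\Delta_x$, $\mathcal L_v=-v\cdot\nabla_v+\Delta_v$. $\mathrm s(\mathcal L)=\inf\{\|\mathcal Lf\|/\|f\|:f\in\mathrm{Dom}(\mathcal L)\cap L_0^2(\mu),f\ne0\}$. With $\overline P_tf=\frac1t\int_0^tP_sf\,\mathrm ds$: $t_{\mathrm{rel}}=\inf\{t\ge0:\|P_t\|_{L_0^2(\mu)\to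 L_0^2(\mu)}\le1/e\}$ and $\overline t_{\mathrm{rel}}=\inf\{t\ge0:\|\overline P_s\|_{L_0^2(\mu)\to L_0^2(\mu)}\le1/e\ \forall s\ge t\}$. In the definition of $\widetilde m$ the norms are in $L^2(\nu)$ (with $\|\mathcal L_xf\|=\infty$ if $\mathcal L_xf\notin L^2(\nu)$). Convention $1/0=\infty$, $1/\infty=0$. *)

(* Defs.v *)
From HB Require Import structures.
From mathcomp Require Import all_boot all_order all_algebra.
From mathcomp Require Import all_classical all_reals all_analysis.

Set Implicit Arguments.
Unset Strict Implicit.
Unset Printing Implicit Defensive.

Import Order.TTheory GRing.Theory Num.Theory.
Import numFieldNormedType.Exports.

Local Open Scope classical_set_scope.
Local Open Scope ring_scope.

(* R^d is 'rV[R]_d.  It carries the sigma-algebra generated by the coordinate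
   maps, which is the Borel sigma-algebra.  Its library norm is the sup norm:
   Euclidean lengths are written with [dotv] and [enorm]. *)

Definition rV_display : measure_display.
Proof. exact: default_measure_display. Qed.

Section measurable_rV.
Variables (R : realType) (n : nat).

Let coord (i : 'I_n) (x : 'rV[R]_n) : R := x ord0 i.

Let rV_set0 : g_sigma_preimage coord set0.
Proof. exact: sigma_algebra0. Qed.

Let rV_setC A : g_sigma_preimage coord A -> g_sigma_preimage coord (~` A).
Proof. exact: sigma_algebraC. Qed.

Let rV_bigcup (F : _^nat) : (forall i, g_sigma_preimage coord (F i)) ->
  g_sigma_preimage coord (\bigcup_i (F i)).
Proof. exact: sigma_algebra_bigcup. Qed.

HB.instance Definition _ := @isMeasurable.Build rV_display 'rV[R]_n
  (g_sigma_preimage coord) rV_set0 rV_setC rV_bigcup.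

Lemma measurable_coord (i : 'I_n) :
  measurable_fun [set: 'rV[R]_n] (fun x : 'rV[R]_n => x ord0 i).
Proof.
move=> _ Y mY; rewrite setTI; apply: sub_sigma_algebra => /=.
rewrite -bigcup_seq/=; exists i => /=; first by rewrite mem_index_enum.
by exists Y => //; rewrite setTI.
Qed.

Lemma measurable_fun_rV d (T : measurableType d) (f : T -> 'rV[R]_n) :
  (forall i, measurable_fun [set: T] (fun t => f t ord0 i)) ->
  measurable_fun [set: T] f.
Proof.
move=> mf; have sub : g_sigma_preimage (fun i => coord i \o f) `<=` measurable.
  apply: smallest_sub; first exact: sigma_algebra_measurable.
  rewrite -bigcup_seq; apply: bigcup_sub => i _ A [B mB <-].
  exact: mf.
by move: sub; rewrite g_sigma_preimage_comp => sub _ A mA; apply: sub; exists A.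
Qed.

End measurable_rV.

Definition rV_cons (R : realType) (n : nat) (p : R * 'rV[R]_n) : 'rV[R]_n.+1 :=
  \row_i oapp (p.2 ord0) p.1 (unlift ord0 i).

Definition rV_uncons (R : realType) (n : nat) (x : 'rV[R]_n.+1)
  : R * 'rV[R]_n := (x ord0 ord0, \row_i x ord0 (lift ord0 i)).

Lemma rV_consK (R : realType) n : cancel (@rV_cons R n) (@rV_uncons R n).
Proof.
move=> [a x]; rewrite /rV_uncons /rV_cons mxE unlift_none /=; congr pair.
by apply/rowP => i; rewrite !mxE liftK.
Qed.

Lemma measurable_rV_cons (R : realType) n :
  measurable_fun [set: R * 'rV[R]_n] (@rV_cons R n).
Proof.
apply: measurable_fun_rV => i; rewrite /rV_cons.
case: (unliftP ord0 i) => [j|] ->.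
- under [X in measurable_fun _ X]funext do rewrite mxE liftK /=.
  exact: (measurableT_comp (measurable_coord j) measurable_snd).
- under [X in measurable_fun _ X]funext do rewrite mxE unlift_none /=.
  exact: measurable_fst.
Qed.

Lemma measurable_rV_uncons (R : realType) n :
  measurable_fun [set: 'rV[R]_n.+1] (@rV_uncons R n).
Proof.
apply/measurable_fun_pairP; split; first exact: measurable_coord.
apply: measurable_fun_rV => i.
under [X in measurable_fun _ X]funext do rewrite /= mxE.
exact: measurable_coord.
Qed.

Section leb_rV.
Variable R : realType.

Definition leb_rV0 : set 'rV[R]_0 -> \bar R := dirac (0 : 'rV[R]_0).
HB.instance Definition _ := Measure.on leb_rV0.
Lemma leb_rV0_sigma_finite : sigma_finite setT leb_rV0.
Proof.
exists (fun=> setT); first by rewrite bigcup_const.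
by move=> k; split => //; rewrite /leb_rV0 diracT ltry.
Qed.
HB.instance Definition _ :=
  Measure_isSigmaFinite.Build _ _ _ leb_rV0 leb_rV0_sigma_finite.

Section step.
Variables (n : nat) (m : {sigma_finite_measure set 'rV[R]_n -> \bar R}).

Definition leb_rVS : set 'rV[R]_n.+1 -> \bar R :=
  pushforward (@lebesgue_measure R \x m)%E (@rV_cons R n).

Let leb_rVS_0 : leb_rVS set0 = 0%E.
Proof. by rewrite /leb_rVS /pushforward preimage_set0 measure0. Qed.

Let leb_rVS_ge0 A : (0 <= leb_rVS A)%E.
Proof. by rewrite /leb_rVS /pushforward measure_ge0. Qed.

Let leb_rVS_sigma_additive : semi_sigma_additive leb_rVS.
Proof.
have mcons A : measurable A -> measurable (@rV_cons R n @^-1` A).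
  by move=> mA; rewrite -[X in measurable X]setTI; exact: measurable_rV_cons.
move=> F mF tF mUF; rewrite /leb_rVS /pushforward preimage_bigcup.
apply: measure_semi_sigma_additive.
- by move=> k; exact: mcons.
- apply/trivIsetP => /= i j _ _ ij; rewrite -preimage_setI.
  by move/trivIsetP : tF => /(_ _ _ _ _ ij) ->//; rewrite preimage_set0.
- by rewrite -preimage_bigcup; exact: mcons.
Qed.

HB.instance Definition _ := isMeasure.Build _ _ _
  leb_rVS leb_rVS_0 leb_rVS_ge0 leb_rVS_sigma_additive.

Lemma leb_rVS_sigma_finite : sigma_finite setT leb_rVS.
Proof.
have [F FT Ffin] : sigma_finite setT (@lebesgue_measure R \x m)%E.
  have /sigma_finiteP[F [TF ndF Foo]] := sigma_finiteT (@lebesgue_measure R).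
  have /sigma_finiteP[G [TG ndG Goo]] := sigma_finiteT m.
  exists (fun k => F k `*` G k).
    rewrite -setXTT TF TG predeqE => -[x y]; split.
      move=> [/= [i _ Fx] [j _ Gy]]; exists (maxn i j) => //; split.
      - by move: x Fx; exact/subsetPset/ndF/leq_maxl.
      - by move: y Gy; exact/subsetPset/ndG/leq_maxr.
    by move=> [k _ []/= ? ?]; split; exists k.
  move=> k; have [mF finF] := Foo k; have [mG finG] := Goo k.
  split; first exact: measurableX.
  by rewrite product_measure1E// lte_mul_pinfty// ge0_fin_numE.
exists (fun k => @rV_uncons R n @^-1` F k).
  by rewrite -preimage_bigcup -FT preimage_setT.
move=> k; have [mF finF] := Ffin k; split.
  by rewrite -[X in measurable X]setTI; exact: measurable_rV_uncons.
rewrite /leb_rVS /pushforward -comp_preimage.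
rewrite (_ : _ \o _ = idfun)//.
by apply/funext => p /=; rewrite rV_consK.
Qed.
HB.instance Definition _ :=
  Measure_isSigmaFinite.Build _ _ _ leb_rVS leb_rVS_sigma_finite.
End step.

(* Lebesgue measure on R^n: the n-fold product of the one on R. *)
Fixpoint leb (n : nat) : {sigma_finite_measure set 'rV[R]_n -> \bar R} :=
  if n is n'.+1 then leb_rVS (leb n') else leb_rV0.

End leb_rV.
Arguments leb {R} n.

Section calculus.
Variable R : realType.

Definition dotv (n : nat) (x y : 'rV[R]_n) : R := \sum_i x ord0 i * y ord0 i.

Definition enorm (n : nat) (x : 'rV[R]_n) : R := Num.sqrt (dotv x x).

(* In finite dimension this is the usual class C^k: all iterated directional
   derivatives of order at most k exist and are continuous. *)
Fixpoint Ck (V : normedModType R) (k : nat) (f : V -> R) : Prop :=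
  continuous f /\
  if k is k'.+1 then
    forall v : V, (forall x, derivable f x v) /\ Ck k' (fun x => 'D_v f x)
  else True.

Definition compact_support (V : normedModType R) (f : V -> R) : Prop :=
  compact (closure [set x | f x != 0]).

Definition partial (n : nat) (i : 'I_n) (f : 'rV[R]_n -> R) (x : 'rV[R]_n) : R :=
  'D_(delta_mx ord0 i) f x.

Definition grad (n : nat) (f : 'rV[R]_n -> R) (x : 'rV[R]_n) : 'rV[R]_n :=
  \row_i partial i f x.

Definition laplacian (n : nat) (f : 'rV[R]_n -> R) (x : 'rV[R]_n) : R :=
  \sum_i partial i (partial i f) x.

Definition affine_fun (n : nat) (f : 'rV[R]_n -> R) : Prop :=
  exists (a : 'rV[R]_n) (b : R), forall x, f x = dotv a x + b.

(* [g] is the weak (distributional) gradient of [f]. *)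
Definition weak_gradient (n : nat) (f : 'rV[R]_n -> R)
    (g : 'rV[R]_n -> 'rV[R]_n) : Prop :=
  forall (phi : 'rV[R]_n -> R) (i : 'I_n),
    (forall k, Ck k phi) -> compact_support phi ->
    \int[leb n]_x (f x * partial i phi x) = - \int[leb n]_x (g x ord0 i * phi x).

End calculus.

Section L2.
Variables (R : realType) (d : measure_display) (T : measurableType d).
Variable mu : {measure set T -> \bar R}.

Definition L2norm (f : T -> R) : \bar R := ('N[mu]_2%:E [EFin \o f])%E.

(* Representatives of mean-zero L^2 functions; used for finite [mu] only. *)
Definition L02 (f : T -> R) : Prop := f \in Lfun mu 2%:E /\ \int[mu]_x f x = 0.

Definition opnorm0 (A : (T -> R) -> T -> R) : \bar R :=
  ereal_sup [set r | exists f : T -> R,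
    [/\ L02 f, (L2norm f <= 1)%E & r = L2norm (A f)]].

(* [G] is the graph of the operator. *)
Definition singular_gap (G : (T -> R) -> (T -> R) -> Prop) : \bar R :=
  ereal_inf [set r | exists f g : T -> R,
    [/\ L02 f, L2norm f != 0%E, G f g & r = (L2norm g / L2norm f)%E]].

Variable P : R -> R.-pker T ~> T.

Definition transition_semigroup (t : R) (f : T -> R) (z : T) : R := \int[P t z]_y f y.

Definition chapman_kolmogorov : Prop :=
  forall s t : R, 0 <= s -> 0 <= t -> forall z A, measurable A ->
    P (s + t) z A = (\int[P s z]_y P t y A)%E.

Definition invariant_measure : Prop :=
  forall t : R, 0 <= t -> forall A, measurable A ->
    (\int[mu]_z P t z A)%E = mu A.

(* The graph of the L^2(mu) generator: [f] is in the domain, with image [g]. *)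
Definition L2_generator (f g : T -> R) : Prop :=
  [/\ f \in Lfun mu 2%:E, g \in Lfun mu 2%:E &
    L2norm (fun z => t^-1 * (transition_semigroup t f z - f z) - g z) @[t --> 0^'+]
      --> (0 : \bar R)%E].

(* At t = 0 this is 0 by convention, which does not affect [trel_bar]. *)
Definition averaged_semigroup (t : R) (f : T -> R) (z : T) : R :=
  t^-1 * \int[lebesgue_measure]_(s in `[0, t]) transition_semigroup s f z.

Definition trel : \bar R :=
  ereal_inf [set t%:E | t in [set t : R |
    0 <= t /\ (opnorm0 (transition_semigroup t) <= (expR (-1))%:E)%E]].

Definition trel_bar : \bar R :=
  ereal_inf [set t%:E | t in [set t : R | 0 <= t /\ forall s, t <= s ->
    (opnorm0 (averaged_semigroup s) <= (expR (-1))%:E)%E]].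

End L2.

Section langevin.
Variables (R : realType) (n : nat).
Local Notation X := 'rV[R]_n.
Local Notation S := ('rV[R]_n * 'rV[R]_n)%type.

Definition gibbs (U : X -> R) (nu : probability X R) : Prop :=
  forall A, measurable A -> nu A =
    ((\int[leb n]_(x in A) (expR (- U x))%:E) /
     (\int[leb n]_x (expR (- U x))%:E))%E.

(* N(0, I_n): the density is the product of the standard normal ones. *)
Definition std_gaussian (kappa : probability X R) : Prop :=
  forall A, measurable A -> kappa A =
    (\int[leb n]_(v in A) (\prod_i normal_pdf 0 1 (v ord0 i))%:E)%E.

(* Here f ranges over mean-zero functions of H^1(nu), the space of functions of
   L^2(nu) with a weak gradient, named g, in L^2(nu). *)
Definition poincare (nu : probability X R) (m : R) : Prop :=
  forall (f : X -> R) (g : X -> X), L02 nu f ->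
    (forall i, (fun x => g x ord0 i) \in Lfun nu 2%:E) -> weak_gradient f g ->
    \int[nu]_x (f x ^+ 2) <= m^-1 * \int[nu]_x (enorm (g x) ^+ 2).

Definition Lx (U f : X -> R) (x : X) : R :=
  - dotv (grad U x) (grad f x) + laplacian f x.

Definition Lv (f : X -> R) (v : X) : R := - dotv v (grad f v) + laplacian f v.

Definition hamiltonian_op (U : X -> R) (f : S -> R) (z : S) : R :=
  dotv z.2 (grad (fun x => f (x, z.2)) z.1)
  - dotv (grad U z.1) (grad (fun v => f (z.1, v)) z.2).

Definition langevin_op (U : X -> R) (alpha gamma : R) (f : S -> R) (z : S) : R :=
  hamiltonian_op U f z + alpha * Lx U (fun x => f (x, z.2)) z.1
  + gamma * Lv (fun v => f (z.1, v)) z.2.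

Definition mtilde (U : X -> R) (nu : probability X R) : \bar R :=
  ereal_inf [set r | exists f : X -> R,
    [/\ affine_fun f, L02 nu f, L2norm nu f != 0%E &
        r = (L2norm nu (Lx U f) / L2norm nu f)%E]].

(* Standard Brownian motion in R^k: the increments of all coordinates over
   successive time intervals are jointly independent centred Gaussians whose
   variances are the lengths of the intervals. *)
Definition brownian (d : measure_display) (O : measurableType d)
    (P : probability O R) (k : nat) (W : R -> O -> 'rV[R]_k) : Prop :=
  [/\ forall t, 0 <= t -> measurable_fun setT (W t),
      {ae P, forall w, W 0 w = 0},
      {ae P, forall w, {within `[0, +oo[, continuous (W ^~ w)}} &
      forall (N : nat) (t : nat -> R) (A : 'I_N -> 'I_k -> set R),
        0 <= t 0%N -> (forall j, t j < t j.+1) ->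
        (forall j i, measurable (A j i)) ->
        fine (P [set w | forall j i,
                   A j i (W (t j.+1) w ord0 i - W (t j) w ord0 i)]) =
        \prod_(j < N) \prod_(i < k)
          fine (normal_prob 0 (Num.sqrt (t j.+1 - t j)) (A j i))].

(* Coordinatewise time integral over [0, t]. *)
Definition time_integral (t : R) (F : R -> X) : X :=
  \row_i \int[lebesgue_measure]_(s in `[0, t]) F s ord0 i.

(* [Z z] solves, from z = (x, v), the equation
     dX = V dt - alpha grad U(X) dt + sqrt(2 alpha) dB,
     dV = - grad U(X) dt - gamma V dt + sqrt(2 gamma) dW.
   The noise is additive, so the equation is a pathwise integral equation. *)
Definition langevin_solution (U : X -> R) (alpha gamma : R)
    (d : measure_display) (O : measurableType d) (P : probability O R)
    (B W : R -> O -> X) (Z : S -> R -> O -> S) : Prop :=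
  forall z : S,
  [/\ forall t, 0 <= t -> measurable_fun setT (Z z t),
      {ae P, forall w, {within `[0, +oo[, continuous (fun t => Z z t w)}},
      {ae P, forall w, forall t, 0 <= t ->
        (Z z t w).1 = z.1 + time_integral t (fun s => (Z z s w).2)
          - alpha *: time_integral t (fun s => grad U (Z z s w).1)
          + Num.sqrt (2 * alpha) *: B t w} &
      {ae P, forall w, forall t, 0 <= t ->
        (Z z t w).2 = z.2 - time_integral t (fun s => grad U (Z z s w).1)
          - gamma *: time_integral t (fun s => (Z z s w).2)
          + Num.sqrt (2 * gamma) *: W t w}].

(* (B, W) is a Brownian motion in R^(n + n), that is, B and W are independent
   Brownian motions in R^n; Z is the Langevin diffusion driven by them; p is
   its transition function; it is Markovian with invariant measure mu, and its
   L^2(mu) generator acts on C^2 functions with compact support as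
   [langevin_op]. *)
Record perturbed_langevin (U : X -> R) (alpha gamma : R)
    (mu : {measure set S -> \bar R})
    (d : measure_display) (O : measurableType d) (P : probability O R)
    (B W : R -> O -> X) (Z : S -> R -> O -> S) (p : R -> R.-pker S ~> S)
    : Prop := PerturbedLangevin {
  langevin_noise : brownian P (fun t w => row_mx (B t w) (W t w));
  langevin_sde : langevin_solution U alpha gamma P B W Z;
  langevin_transition : forall t, 0 <= t -> forall z A, measurable A ->
    p t z A = P (Z z t @^-1` A);
  langevin_markov : chapman_kolmogorov p;
  langevin_invariant : invariant_measure mu p;
  langevin_generator : forall f : S -> R, Ck 2 f -> compact_support f ->
    L2_generator mu p f (langevin_op U alpha gamma f) }.

End langevin.

(* Main.v *)
Require Import Defs.
From HB Require Import structures.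
From mathcomp Require Import all_boot all_order all_algebra.
From mathcomp Require Import ring lra.
From mathcomp Require Import all_classical all_reals all_analysis.
From mathcomp Require Import measurable_realfun.

Set Implicit Arguments.
Unset Strict Implicit.
Unset Printing Implicit Defensive.

Import Order.TTheory GRing.Theory Num.Theory.
Import numFieldNormedType.Exports.

Local Open Scope classical_set_scope.
Local Open Scope ring_scope.

(* If |f| = 1 in L_0^2(mu) and |P_s f - f| <= s c for all s, then |P_t| <= 1/e
   forces 1 - 1/e <= t c; averaging over [0, t] halves the constant.  Such a bound
   with c = |L f| follows from contractivity, so it suffices to find test
   functions with |L f| / |f| small.

   (i) The energy H = U + |v|^2 / 2 is conserved by the Hamiltonian flow, hence
   L H = gamma (n - |v|^2) =: - gamma phi when alpha = 0, and |phi|^2 = 2 n.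
   Since <H - mean, phi> = |phi|^2 / 2, the ratio is at most 2 gamma; H is
   truncated as g_N(H) to stay in the domain of the generator, and the two
   integrals converge by dominated convergence.

   (ii) For f = a.x + b, the function F = f + gamma^-1 a.v satisfies
   L F = (alpha + gamma^-1) L_x f and |F| >= |f|.  Truncation fails here, as only
   a.grad U is known to be square integrable, so F is treated along the paths:
   by the integral equation F(Z_t) - F(z) is the time integral of L F along the
   path plus a centred Gaussian variable.  Riemann sums and Fatou's lemma then
   give |P_t F - F| <= t |L F|, and the derivative of P_t F at 0 follows from
   the L^2-smallness of E|L F (Z_s) - L F (z)| as s -> 0.  When gamma = 0 the
   bounds are trivial because mtilde >= m > 0, by integration by parts. *)

(** * Measurability of continuous functions and invariance of Lebesgue measure *)

(** Likewise [averaged_semigroup] is only known to agree almost everywhere with a measurable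
    function. Moreover, the generator is prescribed on compactly supported C^2 functions only: the
    truncated energy is of this kind up to a constant, whereas for affine functions the derivative
    at time 0 has to be established by hand. The weight gamma^-1 in (ii) comes from L(a.x) = a.v -
    alpha a.grad U and L(a.v) = - a.grad U - gamma a.v: it makes the velocity cancel. The constant 2
    gamma in (i) is the quotient of |L H| = gamma sqrt(2 n) by sqrt(n / 2), the norm of the
    projection of H - mean onto phi. Neither bound need be attained, so the test functions have norm
    1 and carry a slack e > 0, removed at the end. *)

Lemma measurable_countable_fiber d (T : measurableType d) (I : countType)
    (R : realType) (c : T -> I) (h : I -> R) :
  (forall i, measurable (c @^-1` [set i])) -> measurable_fun setT (h \o c).
Proof.
move=> mc _ Y mY; rewrite setTI.
rewrite (_ : _ @^-1` _ =
    \bigcup_i (c @^-1` [set i] `&` [set _ : T | Y (h i)])).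
  apply: countable_bigcupT_measurable => // i; apply: measurableI => //.
  have [Yi|Yi] := pselect (Y (h i)).
    by rewrite (_ : [set _ | _] = setT)//; apply/seteqP; split.
  by rewrite (_ : [set _ | _] = set0)//; apply/seteqP; split.
apply/seteqP; split => [x /= Yx|x [i _ [/= <-]]//].
by exists (c x).
Qed.

Section grid.
Variable R : realType.
Local Open Scope ring_scope.

Definition grid_cell (n k : nat) (x : 'rV[R]_n) : 'rV[int]_n :=
  map_mx (fun a : R => Num.floor (k.+1%:R * a)) x.

Definition grid_point (n k : nat) (z : 'rV[int]_n) : 'rV[R]_n :=
  map_mx (fun a : int => k.+1%:R^-1 * a%:~R) z.

Lemma measurable_grid_cell n k (z : 'rV[int]_n) :
  measurable (@grid_cell n k @^-1` [set z]).
Proof.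
rewrite (_ : _ @^-1` _ = \bigcap_(i in [set: 'I_n])
    ((fun x : 'rV[R]_n => k.+1%:R * x ord0 i) @^-1`
      `[(z ord0 i)%:~R, (z ord0 i + 1)%:~R[)).
  apply: fin_bigcap_measurable => //.
  move=> i _; rewrite -[X in measurable X]setTI.
  apply: measurable_funM => //; exact: measurable_coord.
apply/seteqP; split => [x /= <- i _ /=|x /= h].
  by rewrite mxE in_itv /= floor_le floorD1_gt.
apply/rowP => i; rewrite mxE; have := h i I; rewrite /= in_itv /=.
by move/floor_def.
Qed.

Lemma cvg_grid n (x : 'rV[R]_n) :
  grid_point k (grid_cell k x) @[k --> \oo] --> x.
Proof.
apply/cvgrPdist_le => /= e e0.
have := near_infty_natSinv_lt (PosNum e0); apply: filterS => k /= ke.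
rewrite -[Num.norm _]/(mx_norm _) mx_normrE; apply: bigmax_le; first exact: ltW.
move=> [i j] _ /=; rewrite !mxE ord1.
set a := x _ _.
have k0 : 0 < k.+1%:R :> R by [].
have -> : a - k.+1%:R^-1 * (Num.floor (k.+1%:R * a))%:~R =
  k.+1%:R^-1 * (k.+1%:R * a - (Num.floor (k.+1%:R * a))%:~R).
  by rewrite mulrBr mulKf ?gt_eqF.
rewrite normrM ger0_norm ?invr_ge0 ?(ltW k0)//.
apply: le_trans (ltW ke); rewrite ler_piMr ?invr_ge0 ?(ltW k0)//.
rewrite ger0_norm ?subr_ge0 ?floor_le//.
by rewrite lerBlDl ltW// -[X in _ + X]/(1%:~R) -intrD floorD1_gt.
Qed.

(** The sigma-algebra is generated by the coordinates, so continuity does not give measurability by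
    definition. A continuous function is instead the pointwise limit of its values at the lower
    corners of the grid cells of side 1/(k+1), and these step functions factor through a map with
    countably many measurable fibres. *)
Lemma continuous_measurable_rV n (f : 'rV[R]_n -> R) :
  continuous f -> measurable_fun setT f.
Proof.
move=> cf; apply: (@measurable_realfun.measurable_fun_cvg _ _ _ _
  (fun k => (f \o @grid_point n k) \o @grid_cell n k)).
  by move=> k; apply: measurable_countable_fiber => z; exact: measurable_grid_cell.
move=> x _ /=; apply: (@cvg_comp _ _ _ _ f _ (nbhs x)); [exact: cvg_grid|exact: cf].
Qed.

Lemma continuous_measurable_rV2 n m (f : 'rV[R]_n * 'rV[R]_m -> R) :
  continuous f -> measurable_fun setT f.
Proof.
move=> cf; apply: (@measurable_realfun.measurable_fun_cvg _ _ _ _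
  (fun k => (fun z => f (@grid_point n k z.1, @grid_point m k z.2)) \o
            (fun x => (@grid_cell n k x.1, @grid_cell m k x.2)))).
  move=> k; apply: measurable_countable_fiber => -[y z].
  rewrite (_ : _ @^-1` _ = (@grid_cell n k @^-1` [set y]) `*` (@grid_cell m k @^-1` [set z])).
    by apply: measurableX; exact: measurable_grid_cell.
  by apply/seteqP; split => [[a b] [/= <- <-]//|[a b] [/= <- <-]].
move=> [x y] _ /=.
apply: (@cvg_comp _ _ _ (fun k => (_, _)) f _ (nbhs (x, y))); last exact: cf.
exact: (cvg_pair (@cvg_grid n x) (@cvg_grid m y)).
Qed.

End grid.

Section translation.
Variable R : realType.
Local Open Scope ereal_scope.

Lemma lebesgue_measure_translation (a : R) (A : set R) : measurable A ->
  lebesgue_measure ((fun x => x + a)%R @^-1` A) = lebesgue_measure A.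
Proof.
move=> mA; apply/esym.
rewrite -[RHS]/(pushforward lebesgue_measure
  (fun x : measurableTypeR R => (x + a : measurableTypeR R)%R) A).
have mf : measurable_fun setT
    (fun x : measurableTypeR R => (x + a : measurableTypeR R)%R).
  exact: measurable_funD.
apply: lebesgue_measure_unique => //= _ [[b c]] _ <-.
rewrite /pushforward /= (_ : _ @^-1` _ = `](b - a)%R, (c - a)%R]%classic).
  rewrite !lebesgue_measure_itv/= !lte_fin ltrD2r; case: ifPn => // _.
  by rewrite -!EFinB; congr EFin; ring.
by apply/seteqP; split => x /=; rewrite !in_itv/= ltrBlDr lerBrDr.
Qed.

Lemma product_measure_preserving d1 d2 (T1 : measurableType d1)
    (T2 : measurableType d2)
    (m1 : {sigma_finite_measure set T1 -> \bar R})
    (m2 : {sigma_finite_measure set T2 -> \bar R}) (f : T1 -> T1) (g : T2 -> T2) :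
  measurable_fun setT f -> measurable_fun setT g ->
  (forall A, measurable A -> m1 (f @^-1` A) = m1 A) ->
  (forall A, measurable A -> m2 (g @^-1` A) = m2 A) ->
  forall C, measurable C ->
    (m1 \x m2) ((fun z => (f z.1, g z.2)) @^-1` C) = (m1 \x m2) C.
Proof.
move=> mf mg m1f m2g C mC; apply/esym.
rewrite -[RHS]/(pushforward (m1 \x m2) (fun z => (f z.1, g z.2)) C).
have mfg : measurable_fun setT (fun z : T1 * T2 => (f z.1, g z.2)).
  by apply/measurable_fun_pairP; split;
    [exact: (measurableT_comp mf measurable_fst)
    |exact: (measurableT_comp mg measurable_snd)].
apply: product_measure_unique => // A B mA mB.
rewrite -[LHS]/((m1 \x m2) ((f @^-1` A) `*` (g @^-1` B))).
have mfA : measurable (f @^-1` A) by rewrite -[X in measurable X]setTI; exact: mf.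
have mgB : measurable (g @^-1` B) by rewrite -[X in measurable X]setTI; exact: mg.
by rewrite -(m1f A)// -(m2g B)//; exact: product_measure1E.
Qed.

Lemma leb_rVSE n (A : set 'rV[R]_n.+1) :
  leb n.+1 A = (lebesgue_measure \x leb n) (@rV_cons R n @^-1` A).
Proof. by []. Qed.

Lemma measurable_rV_translation n (a : 'rV[R]_n) :
  measurable_fun setT (fun x : 'rV[R]_n => x + a)%R.
Proof.
apply: measurable_fun_rV => i; under eq_fun do rewrite mxE.
by apply: measurable_funD => //; exact: measurable_coord.
Qed.

(** Induction on the dimension: under [rV_cons] a translation splits into one of the first
    coordinate and one of the others, and a product measure is determined by its values on
    rectangles. *)
Lemma leb_translation n (a : 'rV[R]_n) (A : set 'rV[R]_n) : measurable A ->
  leb n ((fun x => x + a)%R @^-1` A) = leb n A.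
Proof.
elim: n a A => [a A mA|n IH a A mA].
  congr (leb 0 _); apply/seteqP.
  by split => x /=; rewrite [(x + a)%R]thinmx0 [x]thinmx0.
have mcons B : measurable B -> measurable (@rV_cons R n @^-1` B).
  by move=> mB; rewrite -[X in measurable X]setTI; exact: measurable_rV_cons.
rewrite !leb_rVSE.
pose b := rV_uncons a.
have -> : @rV_cons R n @^-1` ((fun x => x + a)%R @^-1` A) =
    (fun z => (z.1 + b.1, z.2 + b.2)%R) @^-1` (@rV_cons R n @^-1` A).
  have E z : (rV_cons z + a = rV_cons (z.1 + b.1, z.2 + b.2))%R.
    apply/rowP => i; rewrite !mxE; case: (unliftP ord0 i) => [j|] ->.
      by rewrite /= !mxE.
    by [].
  by apply/seteqP; split => z; rewrite /preimage/mkset E.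
apply: (@product_measure_preserving _ _ _ _ lebesgue_measure (leb n)
  (fun x => x + b.1)%R (fun x => x + b.2)%R); last exact: mcons.
- exact: measurable_funD.
- exact: measurable_rV_translation.
- exact: lebesgue_measure_translation.
- exact: IH.
Qed.

End translation.

Section measure_preserving.
Context d (T : measurableType d) (R : realType).
Variables (m : {measure set T -> \bar R}) (f : T -> T).
Hypotheses (mf : measurable_fun setT f)
  (mpf : forall A, measurable A -> m (f @^-1` A) = m A).
Local Open Scope ereal_scope.

Lemma ge0_integral_preserving (h : T -> \bar R) : measurable_fun setT h ->
  (forall x, 0 <= h x) -> \int[m]_x h (f x) = \int[m]_x h x.
Proof.
move=> mh h0; rewrite -[LHS]/(\int[m]_(x in f @^-1` setT) (h \o f) x).
rewrite -ge0_integral_pushforward//.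
by apply: eq_measure_integral => A mA _; exact: mpf.
Qed.

Lemma integrable_preserving (h : T -> \bar R) : m.-integrable setT h ->
  m.-integrable setT (h \o f).
Proof.
move=> /integrableP[mh ih]; apply/integrableP; split.
  exact: measurableT_comp.
have /= -> // := @ge0_integral_preserving (abse \o h) _ (fun x => abse_ge0 _).
exact: measurableT_comp.
Qed.

Lemma integral_preserving (h : T -> \bar R) : m.-integrable setT h ->
  \int[m]_x h (f x) = \int[m]_x h x.
Proof.
move=> ih; have ih' := integrable_preserving ih.
rewrite -[LHS]/(\int[m]_(x in f @^-1` setT) (h \o f) x).
rewrite -integral_pushforward//; last by case/integrableP: ih.
by apply: eq_measure_integral => A mA _; exact: mpf.
Qed.

End measure_preserving.

Section flow.
Context d (T : measurableType d) (R : realType).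
Variables (m : {sigma_finite_measure set T -> \bar R}) (tau : R -> T -> T).
Hypotheses (mtau : measurable_fun setT (fun z : R * T => tau z.1 z.2))
  (mptau : forall s A, measurable A -> m (tau s @^-1` A) = m A).
Local Open Scope ereal_scope.

(** Integrate [G' (tau s x)] over [0, 1] x T in both orders. For each [s] the flow preserves [m], so
    one order gives the integral of [G']; the other gives that of [G (tau 1 x) - G x], which is 0 by
    invariance. Integrability of [G] and [G'] thus replaces any control of boundary terms at
    infinity. *)
Lemma integral_flow_derivative_eq0 (G G' : T -> R) :
  m.-integrable setT (EFin \o G) -> m.-integrable setT (EFin \o G') ->
  (forall x, \int[lebesgue_measure]_(s in `[0%R, 1%R]) (G' (tau s x))%:E =
    (G (tau 1 x))%:E - (G x)%:E) ->
  \int[m]_x (G' x)%:E = 0.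
Proof.
move=> iG iG' FTC.
have mts s : measurable_fun setT (tau s).
  exact: (measurableT_comp mtau (measurable_pair1 s)).
have mG' : measurable_fun setT G' by case/integrableP : iG' => /measurable_EFinP.
pose I : R -> R := \1_`[0%R, 1%R].
pose h (z : R * T) : \bar R := (I z.1)%:E * (G' (tau z.1 z.2))%:E.
have mh : measurable_fun setT h.
  apply: emeasurable_funM.
    by apply/measurable_EFinP; apply: measurableT_comp => //; exact: measurable_indic.
  by apply/measurable_EFinP; exact: measurableT_comp.
have Iint : \int[lebesgue_measure]_s (I s)%:E = 1.
  rewrite /I integral_indic//= setIT lebesgue_measure_itv/= lte01.
  by rewrite oppr0 adde0.
have ih : (lebesgue_measure \x m).-integrable setT h.
  apply/integrable12ltyP => //.
  have E s : \int[m]_y `|h (s, y)| = (I s)%:E * \int[m]_x `|(G' x)%:E|.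
    have I0 : (0 <= I s)%R by rewrite /I indicE.
    under eq_integral => y _.
      rewrite (_ : `|h (s, y)| = (I s)%:E * `|(G' (tau s y))%:E|); last first.
        by rewrite /h abseM gee0_abs ?lee_fin.
      over.
    rewrite ge0_integralZl//; last first.
      by apply: measurableT_comp => //; apply/measurable_EFinP; exact: measurableT_comp.
    congr (_ * _).
    rewrite (ge0_integral_preserving (mts s) (mptau s)
      (h := fun x => `|(G' x)%:E|))//.
    by apply: measurableT_comp => //; apply/measurable_EFinP.
  under eq_integral do rewrite E.
  rewrite ge0_integralZr//; last 3 first.
    by apply/measurable_EFinP; exact: measurable_indic.
    by move=> s _; rewrite lee_fin /I indicE.
    exact: integral_ge0.
  by rewrite Iint mul1e; case/integrableP : iG'.
have := Fubini ih.
have -> : \int[lebesgue_measure]_s \int[m]_y h (s, y) = \int[m]_x (G' x)%:E.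
  have E s : \int[m]_y h (s, y) = (I s)%:E * \int[m]_x (G' x)%:E.
    rewrite /h /= integralZl//; last first.
      exact: (integrable_preserving (mts s) (mptau s) iG').
    by rewrite (integral_preserving (mts s) (mptau s) iG').
  under eq_integral do rewrite E.
  have /fineK <- : \int[m]_x (G' x)%:E \is a fin_num by exact: integrable_fin_num.
  rewrite integralZr//; last exact: integrable_indic_itv.
  by rewrite Iint mul1e.
move=> ->; under eq_integral => x _.
  rewrite (_ : \int[_]_s _ = (G (tau 1 x))%:E - (G x)%:E); last first.
    rewrite -FTC [RHS]integral_mkcond; apply: eq_integral => s _.
    rewrite /h /I /= indicE patchE; case: ifPn => _; first by rewrite mul1e.
    by rewrite mul0e.
  over.
have iGt := integrable_preserving (mts 1%R) (mptau 1%R) iG.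
rewrite integralB//; rewrite (integral_preserving (mts 1%R) (mptau 1%R) iG).
by rewrite subee// integrable_fin_num.
Qed.

End flow.

(** * Integration by parts *)

Section derive_line.
Context (R : realType) (V W : normedModType R).

(** With its converse below, this reduces directional derivatives to one variable, where the chain
    rule, the mean value theorem and the fundamental theorem of calculus apply. *)
Lemma is_derive_line (G : V -> W) (x a : V) (s : R) (dG : W) :
  is_derive (x + s *: a) a G dG ->
  is_derive s (1 : R) (fun s : R => G (x + s *: a)) dG.
Proof.
move=> [dr dv].
have E : (fun h : R => h^-1 *: (((fun s : R => G (x + s *: a)) \o shift s) (h *: (1:R)) - G (x +
  s *: a))) =
  (fun h : R => h^-1 *: ((G \o shift (x + s *: a)) (h *: a) - G (x + s *: a))).
  apply/funext => h /=; congr (_ *: (G _ - _)).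
  by rewrite scalerDl [h *: 1]mulr1 addrCA.
by split; [rewrite /derivable E|rewrite /derive E].
Qed.

Lemma is_derive_of_line (G : V -> W) (x a : V) (dG : W) :
  is_derive (0 : R) (1 : R) (fun s : R => G (x + s *: a)) dG -> is_derive x a G dG.
Proof.
move=> [dr dv].
have E : (fun h : R => h^-1 *: (((fun s : R => G (x + s *: a)) \o shift (0:R)) (h *: (1:R)) - G
  (x + (0:R) *: a))) =
  (fun h : R => h^-1 *: ((G \o shift x) (h *: a) - G x)).
  apply/funext => h /=; rewrite scale0r !addr0; congr (_ *: (G _ - _)).
  by rewrite [h *: 1]mulr1 addrC.
by split; [move: dr; rewrite /derivable E|move: dv; rewrite /derive E].
Qed.

End derive_line.

Lemma is_derive_chain (R : realType) (V : normedModType R) (g : R -> R)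
    (H : V -> R) (x a : V) (dg dH : R) :
  is_derive (H x) 1 g dg -> is_derive x a H dH ->
  is_derive x a (g \o H) (dg * dH).
Proof.
move=> dgx dHx; apply: is_derive_of_line.
apply: (@is_derive1_comp _ g (fun s : R => H (x + s *: a))).
  by rewrite scale0r addr0.
by apply: is_derive_line; rewrite scale0r addr0.
Qed.

Lemma integral_derive_line (R : realType) (V : normedModType R) (G G' : V -> R)
    (x a : V) :
  (forall y, is_derive y a G (G' y)) -> continuous G' ->
  (\int[lebesgue_measure]_(s in `[0%R, 1%R]) (G' (x + s *: a))%:E =
    (G (x + a))%:E - (G x)%:E)%E.
Proof.
move=> dG cG'.
have dF (s : R) : is_derive s (1 : R) (fun s : R => G (x + s *: a)) (G' (x + s *: a)).
  exact: is_derive_line.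
have cF : continuous (fun s : R => G (x + s *: a)).
  move=> s; apply: differentiable_continuous; apply/derivable1_diffP.
  exact: ex_derive.
have cl : continuous (fun s : R => x + s *: a).
  by move=> s; apply: cvgD; [exact: cvg_cst|apply: scalel_continuous].
have cF' : continuous (fun s : R => G' (x + s *: a)).
  by move=> s; apply: continuous_comp; [exact: cl|exact: cG'].
rewrite (@continuous_FTC2 _ _ (fun s : R => G (x + s *: a))) ?ltr01//=.
- by rewrite scale1r scale0r addr0.
- exact: continuous_subspaceT.
- split.
  + by move=> s _; exact: ex_derive.
  + by apply: cvg_at_right_filter; exact: cF.
  + by apply: cvg_at_left_filter; exact: cF.
- by move=> s _; rewrite derive1E derive_val.
Qed.

Section leb_ibp.
Variable R : realType.

Lemma leb_integral_derive_eq0 n (a : 'rV[R]_n) (G G' : 'rV[R]_n -> R) :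
  (forall x, is_derive x a G (G' x)) -> continuous G' ->
  (leb n).-integrable setT (EFin \o G) -> (leb n).-integrable setT (EFin \o G') ->
  (\int[leb n]_x (G' x)%:E = 0)%E.
Proof.
move=> dG cG' iG iG'.
have mtau : measurable_fun setT (fun z : R * 'rV[R]_n => z.2 + z.1 *: a).
  apply: measurable_fun_rV => i; under eq_fun do rewrite !mxE.
  apply: measurable_funD.
    exact: (measurableT_comp (measurable_coord i) measurable_snd).
  by apply: measurable_funM => //; exact: measurable_fst.
apply: (@integral_flow_derivative_eq0 _ _ R (leb n) (fun s x => x + s *: a) mtau _
  G G' iG iG').
- by move=> s A mA; exact: leb_translation.
- by move=> x; rewrite scale1r; exact: integral_derive_line.
Qed.

Lemma ge0_integral_lebS n (f : 'rV[R]_n.+1 -> \bar R) :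
  measurable_fun setT f -> (forall x, 0 <= f x)%E ->
  (\int[leb n.+1]_x f x =
   \int[lebesgue_measure]_t \int[leb n]_x f (rV_cons (t, x)))%E.
Proof.
move=> mf f0.
transitivity (\int[lebesgue_measure \x leb n]_z f (rV_cons z))%E.
  rewrite -[RHS]/(\int[lebesgue_measure \x leb n]_(z in (@rV_cons R n) @^-1` setT)
    (f \o @rV_cons R n) z)%E.
  rewrite -ge0_integral_pushforward//; exact: measurable_rV_cons.
rewrite fubini_tonelli1//.
by apply: measurableT_comp => //; exact: measurable_rV_cons.
Qed.

(** Tonelli by induction on the dimension. It supplies the integrable majorants: [h] is the
    indicator of an interval for functions of bounded support, and a Gaussian for polynomial
    moments. *)
Lemma integral_leb_prod n (h : R -> R) :
  measurable_fun setT h -> (forall t, 0 <= h t) ->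
  lebesgue_measure.-integrable setT (EFin \o h) ->
  (\int[leb n]_x (\prod_i h (x ord0 i))%:E < +oo)%E.
Proof.
move=> mh h0 ih.
have mp k : measurable_fun setT (fun x : 'rV[R]_k => (\prod_i h (x ord0 i))%:E).
  apply/measurable_EFinP; apply: measurable_prod => i _.
  exact: (measurableT_comp mh (measurable_coord i)).
have p0 k (x : 'rV[R]_k) : (0 <= (\prod_i h (x ord0 i))%:E)%E.
  by rewrite lee_fin; apply: prodr_ge0 => i _.
elim: n => [|n IH].
  under eq_integral do rewrite big_ord0.
  by rewrite integral_cst// mul1e; rewrite /leb/= /leb_rV0 diracT ltry.
rewrite ge0_integral_lebS//.
under eq_integral => t _.
  under eq_integral => x _.
    rewrite big_ord_recl (_ : \prod_i _ = \prod_i h (x ord0 i)); last first.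
      by apply: eq_bigr => i _; rewrite mxE liftK.
    rewrite mxE unlift_none /= EFinM; over.
  rewrite ge0_integralZl//=; [|exact: mp|by move=> x _; exact: p0|by rewrite lee_fin].
  over.
rewrite ge0_integralZr//; last first.
- by apply: integral_ge0 => x _; exact: p0.
- by move=> t _; rewrite lee_fin.
- exact/measurable_EFinP.
rewrite lte_mul_pinfty//; first by apply: integral_ge0 => t _; rewrite lee_fin.
- by have /integrable_fin_num := ih; apply.
Qed.

End leb_ibp.

(** * Integration against mixtures of measures and densities *)

Section mixture.
Context d1 d2 (Y : measurableType d1) (Z : measurableType d2) (R : realType).
Variables (l : {measure set Y -> \bar R}) (k : Y -> {measure set Z -> \bar R})
  (m : {measure set Z -> \bar R}).
Hypothesis mk : forall A, measurable A -> measurable_fun setT (k ^~ A).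
Hypothesis mE : forall A, measurable A -> m A = (\int[l]_y k y A)%E.
Local Open Scope ereal_scope.
Import HBNNSimple.

Let mixture_nnsfun (f : {nnsfun Z >-> R}) :
  \int[m]_z (f z)%:E = \int[l]_y \int[k y]_z (f z)%:E.
Proof.
under [RHS]eq_integral do rewrite integralT_nnsfun sintegralE.
have f0 r y : 0 <= r%:E * k y (f @^-1` [set r]).
  have [r0|r0] := leP 0%R r; first by rewrite mule_ge0 ?lee_fin.
  by rewrite preimage_nnfun0// measure0 mule0.
rewrite ge0_integral_fsum//; last first.
  by move=> r; apply: measurable_funeM; exact: mk.
rewrite integralT_nnsfun sintegralE; apply: eq_fsbigr => r _.
have [r0|r0] := leP 0%R r.
  by rewrite ge0_integralZl//; [rewrite mE|exact: mk].
rewrite preimage_nnfun0// measure0 mule0 integral0_eq// => y _.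
by rewrite measure0 mule0.
Qed.

(** Linearity settles simple functions, and monotone convergence passes to the limit on both sides.
    The formula serves for densities, for the invariance of [mu] and for the Chapman-Kolmogorov
    equation. *)
Lemma ge0_integral_mixture (f : Z -> \bar R) :
  measurable_fun setT f -> (forall z, 0 <= f z) ->
  \int[m]_z f z = \int[l]_y \int[k y]_z f z.
Proof.
move=> mf f0; pose f_ := nnsfun_approx measurableT mf.
have cf z : (f_ n z)%:E @[n --> \oo] --> f z by exact: cvg_nnsfun_approx.
have mf_ n : measurable_fun setT (EFin \o f_ n) by exact/measurable_EFinP.
have f_0 n z : 0 <= (f_ n z)%:E by rewrite lee_fin.
have ndf_ z : {homo (fun n => (f_ n z)%:E) : a b / (a <= b)%N >-> a <= b}.
  by move=> a b ab; rewrite lee_fin; exact/lefP/nd_nnsfun_approx.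
have E (m' : {measure set Z -> \bar R}) :
    (\int[m']_z (f_ n z)%:E) @[n --> \oo] --> \int[m']_z f z.
  rewrite (_ : \int[m']_z f z = \int[m']_z lim ((f_ n z)%:E @[n --> \oo])).
    by apply: cvg_monotone_convergence => // z _; exact: ndf_.
  by apply: eq_integral => z _; apply/esym/cvg_lim => //; exact: cf.
suff : (\int[m]_z (f_ n z)%:E) @[n --> \oo] --> \int[l]_y \int[k y]_z f z.
  by move=> h; exact: (cvg_unique _ (E m) h).
rewrite (_ : (fun n => _) = fun n => \int[l]_y \int[k y]_z (f_ n z)%:E); last first.
  by apply/funext => n; exact: mixture_nnsfun.
rewrite (_ : \int[l]_y _ = \int[l]_y lim ((\int[k y]_z (f_ n z)%:E) @[n --> \oo])).
  apply: cvg_monotone_convergence => //.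
  - move=> n; exact: (measurable_fun_integral_kernel mk (f_0 n) (mf_ n)).
  - by move=> n y _; exact: integral_ge0.
  - by move=> y _ a b ab; apply: ge0_le_integral => //; [exact: mf_|exact: mf_|move=> z _;
    exact: ndf_].
by apply: eq_integral => y _; apply/esym/cvg_lim => //; exact: E.
Qed.

End mixture.

Section density.
Context d (T : measurableType d) (R : realType).
Variables (l m : {measure set T -> \bar R}) (rho : T -> R).
Hypotheses (mrho : measurable_fun setT rho) (rho0 : forall x, 0 <= rho x)
  (mE : forall A, measurable A -> m A = (\int[l]_(x in A) (rho x)%:E)%E).
Local Open Scope ereal_scope.

Lemma ge0_integral_density (f : T -> \bar R) : measurable_fun setT f ->
  (forall x, 0 <= f x) -> \int[m]_x f x = \int[l]_x (f x * (rho x)%:E).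
Proof.
move=> mf f0.
(* A measure of density [rho] is the mixture of the point masses at [x] weighted by [rho x]. *)
pose k (x : T) : {measure set T -> \bar R} := mscale (NngNum (rho0 x)) (dirac x).
have kE x A : measurable A -> k x A = (rho x)%:E * (\1_A x)%:E.
  by move=> mA; [].
rewrite (@ge0_integral_mixture _ _ T T R l k m)//.
- apply: eq_integral => x _.
  by rewrite /k ge0_integral_mscale//= integral_dirac// diracT mul1e muleC.
- move=> A mA; under eq_fun do rewrite kE//.
  by apply: emeasurable_funM; [exact/measurable_EFinP|
    apply/measurable_EFinP; exact: measurable_indic].
- move=> A mA; rewrite mE//; under [RHS]eq_integral do rewrite kE//.
  rewrite integral_mkcond; apply: eq_integral => x _.
  by rewrite patchE indicE; case: ifPn; rewrite ?mule1 ?mule0.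
Qed.

Lemma integrable_density (f : T -> R) : measurable_fun setT f ->
  m.-integrable setT (EFin \o f) <->
  l.-integrable setT (EFin \o (fun x => f x * rho x)%R).
Proof.
move=> mf.
have E : \int[m]_x `|(f x)%:E| = \int[l]_x `|(f x * rho x)%:E|.
  rewrite ge0_integral_density//; last by apply: measurableT_comp => //; exact/measurable_EFinP.
  by apply: eq_integral => x _; rewrite EFinM abseM (@gee0_abs _ (rho x)%:E) ?lee_fin.
split=> /integrableP[_ fi]; apply/integrableP; split.
- by apply/measurable_EFinP; exact: measurable_funM.
- by rewrite /= -E.
- exact/measurable_EFinP.
- by rewrite /= E.
Qed.

Lemma integral_density (f : T -> R) : measurable_fun setT f ->
  \int[m]_x (f x)%:E = \int[l]_x (f x * rho x)%:E.
Proof.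
move=> mf; rewrite integralE [RHS]integralE; congr (_ - _).
- rewrite ge0_integral_density//; last by apply: measurable_funepos; exact/measurable_EFinP.
  apply: eq_integral => x _; rewrite !funeposE -!EFin_max -EFinM; congr EFin.
  by rewrite maxr_pMl// mul0r.
- rewrite ge0_integral_density//; last by apply: measurable_funeneg; exact/measurable_EFinP.
  apply: eq_integral => x _; rewrite !funenegE -!EFinN -!EFin_max -EFinM; congr EFin.
  by rewrite maxr_pMl// mul0r mulNr.
Qed.

End density.

(** * The L2 norm *)

Section nonmeasurable.
Context d (T : measurableType d) (R : realType) (mu : {measure set T -> \bar R}).
Local Open Scope ereal_scope.
Import HBNNSimple.

(** The integral of a nonnegative function is a supremum over the simple functions below it, hence
    monotone without measurability. This is what allows L^2 norms of averaged semigroups and of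
    pointwise limits to be estimated. *)
Lemma ge0_le_integral_nomeas (f g : T -> \bar R) :
  (forall x, 0 <= f x) -> (forall x, f x <= g x) ->
  \int[mu]_x f x <= \int[mu]_x g x.
Proof.
move=> f0 fg; have g0 x : 0 <= g x by exact: le_trans (fg x).
rewrite !ge0_integralTE//; apply: le_ereal_sup => _ [h hf <-].
by exists h => // x; exact: le_trans (hf x) (fg x).
Qed.

Lemma ae_le_integral_nomeas (f g : T -> \bar R) :
  (forall x, 0 <= f x) -> measurable_fun setT g -> (forall x, 0 <= g x) ->
  {ae mu, forall x, f x <= g x} -> \int[mu]_x f x <= \int[mu]_x g x.
Proof.
move=> f0 mg g0 fg; rewrite [leLHS]ge0_integralTE//.
apply: ge_ereal_sup => _ [h hf <-]; rewrite -integralT_nnsfun.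
apply: ae_ge0_le_integral => //.
- by move=> x _; rewrite lee_fin.
- exact/measurable_EFinP.
by apply: filterS fg => x fgx _; exact: le_trans (hf x) fgx.
Qed.

Lemma ae_eq_integral_nomeas (f g : T -> \bar R) :
  (forall x, 0 <= f x) -> measurable_fun setT g -> (forall x, 0 <= g x) ->
  {ae mu, forall x, f x = g x} -> \int[mu]_x f x = \int[mu]_x g x.
Proof.
move=> f0 mg g0 fg; apply/eqP; rewrite eq_le ae_le_integral_nomeas//=; last first.
  by apply: filterS fg => x ->.
have [N [mN N0 sN]] := fg.
have mg' : measurable_fun setT (g \_ (~` N)).
  by apply/(measurable_restrictT _ _).1; [exact: measurableC|exact: measurable_funTS].
(* Other inequality: [g] set to 0 on a null set [N] containing every disagreement lies below [f]
   everywhere and has the same integral as [g]. *)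
rewrite (_ : \int[mu]_x g x = \int[mu]_x (g \_ (~` N)) x).
  apply: ge0_le_integral_nomeas => x; first by apply: erestrict_ge0 => ? _; exact: g0.
  rewrite patchE; case: ifPn => //; rewrite inE => Nx.
  by have [<-//|/sN] := pselect (f x = g x).
apply: ge0_ae_eq_integral => //.
- by move=> x _; apply: erestrict_ge0 => ? _; exact: g0.
- exists N; split => // x /= h; apply: contrapT => Nx; apply: h => _.
  by rewrite patchE mem_set.
Qed.

End nonmeasurable.

Section limn_einf.
Context (R : realType).
Local Open Scope ereal_scope.
Implicit Types u : (\bar R)^nat.

Lemma limn_einf_ge u c : (\forall n \near \oo, c <= u n) -> c <= limn_einf u.
Proof.
move=> [N _ cu]; rewrite limn_einf_lim; apply: lime_ge; first exact: is_cvg_einfs.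
exists N => // n /= Nn; apply: le_ereal_inf_tmp => _ [k /= nk <-].
by apply: cu => /=; exact: leq_trans nk.
Qed.

Lemma limn_einf_ge0 u : (forall n, 0 <= u n) -> 0 <= limn_einf u.
Proof. by move=> u0; apply: limn_einf_ge; exact: nearW. Qed.

Lemma limn_einf_le u c : (forall n, u n <= c) -> limn_einf u <= c.
Proof.
move=> uc; rewrite limn_einf_lim; apply: lime_le; first exact: is_cvg_einfs.
apply: nearW => n; apply: le_trans (uc n); apply: ereal_inf_lbound.
by exists n => /=.
Qed.

Lemma lt_limn_einf u c : c < limn_einf u -> \forall n \near \oo, c < u n.
Proof.
rewrite limn_einf_lim => cu.
have [N _ /(_ N (leqnn N)) cN] : \forall n \near \oo, c < einfs u n.
  move: cu; rewrite (cvg_lim _ (@cvg_einfs_sup R u))// => /ereal_sup_gt[_ [N _ <-] cN].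
  exists N => // n /= Nn; apply: (lt_le_trans cN); exact: nondecreasing_einfs.
exists N => // n /= Nn; apply: (lt_le_trans cN); apply: ereal_inf_lbound.
by exists n.
Qed.

(** Every [b < a] is eventually below [u], so [b ^+ 2] is at most the lower limit of the squares. If
    that limit were some [l < a ^+ 2], the midpoint of [l] and [a ^+ 2] would be such a [b ^+ 2], a
    contradiction. *)
Lemma limn_einf_sqr (u : R^nat) (a : R) : (0 <= a)%R -> (forall n, 0 <= u n)%R ->
  a%:E <= limn_einf (EFin \o u) ->
  (a ^+ 2)%:E <= limn_einf (fun n => (u n ^+ 2)%:E).
Proof.
move=> a0 u0 au; have [->|an0] := eqVneq a 0%R.
  by rewrite expr0n; apply: limn_einf_ge0 => n; rewrite lee_fin sqr_ge0.
have {}a0 : (0 < a)%R by rewrite lt_neqAle eq_sym an0.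
have mono (b : R) : (0 <= b)%R -> (b < a)%R ->
    (b ^+ 2)%:E <= limn_einf (fun n => (u n ^+ 2)%:E).
  move=> b0 ba; apply: limn_einf_ge.
  have : b%:E < limn_einf (EFin \o u) by apply: lt_le_trans au; rewrite lte_fin.
  move=> /lt_limn_einf; apply: filterS => n; rewrite /= lte_fin lee_fin => bu.
  by rewrite lerXn2r ?nnegrE// ltW.
have [e2|] := leP (a ^+ 2)%:E (limn_einf (fun n => (u n ^+ 2)%:E)) => //.
have l0 : 0 <= limn_einf (fun n => (u n ^+ 2)%:E).
  by apply: limn_einf_ge0 => n; rewrite lee_fin sqr_ge0.
move: l0 mono; case: (limn_einf _) => // l; rewrite lee_fin lte_fin => l0 mono la.
pose b := Num.sqrt ((l + a ^+ 2) / 2)%R.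
have lb : (l < (l + a ^+ 2) / 2)%R by lra.
have ba : (b < a)%R.
  rewrite -[ltRHS](ger0_norm (ltW a0)) -sqrtr_sqr ltr_sqrt ?exprn_gt0//; lra.
have := mono b (sqrtr_ge0 _) ba; rewrite lee_fin sqr_sqrtr; last by rewrite ltW// (le_lt_trans l0).
by rewrite leNgt lb.
Qed.

Lemma measurable_limn_einf d (T : measurableType d) (f : nat -> T -> \bar R) :
  (forall n, measurable_fun setT (f n)) ->
  measurable_fun setT (fun x => limn_einf (f ^~ x)).
Proof.
move=> mf; rewrite /limn_einf; apply: measurableT_comp; first exact: oppe_measurable.
by apply: measurable_fun_limn_esup => n; exact: measurableT_comp.
Qed.

End limn_einf.

Section L2.
Context d (T : measurableType d) (R : realType) (mu : {measure set T -> \bar R}).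
Local Open Scope ereal_scope.

Lemma L2normE (f : T -> R) : L2norm mu f = sqrte (\int[mu]_x (f x ^+ 2)%:E).
Proof.
rewrite /L2norm unlock poweR12_sqrt.
  by congr sqrte; apply: eq_integral => x _; rewrite /= powR_mulrn// -normrX ger0_norm ?sqr_ge0.
by apply: integral_ge0 => x _; rewrite lee_fin powR_ge0.
Qed.

Lemma L2norm_ge0 (f : T -> R) : 0 <= L2norm mu f.
Proof. exact: Lnorm_ge0. Qed.

Lemma integral_sqr_ge0 (f : T -> R) : 0 <= \int[mu]_x (f x ^+ 2)%:E.
Proof. by apply: integral_ge0 => x _; rewrite lee_fin sqr_ge0. Qed.

Lemma measurable_sqr (f : T -> R) : measurable_fun setT f ->
  measurable_fun setT (fun x => (f x ^+ 2)%:E).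
Proof. by move=> mf; apply/measurable_EFinP; exact: measurable_funX. Qed.

Lemma L2norm_le_fin (f : T -> R) (c : R) : (0 <= c)%R ->
  (L2norm mu f <= c%:E) = (\int[mu]_x (f x ^+ 2)%:E <= (c ^+ 2)%:E).
Proof.
move=> c0; rewrite L2normE -[in LHS](ger0_norm c0) -sqrtr_sqr.
by rewrite -[(Num.sqrt _)%:E]/(sqrte (c ^+ 2)%:E) lee_sqrt// lee_fin sqr_ge0.
Qed.

Lemma le_L2norm (f g : T -> R) : (forall x, (`|f x| <= `|g x|)%R) ->
  L2norm mu f <= L2norm mu g.
Proof.
move=> fg; rewrite !L2normE lee_sqrt ?integral_sqr_ge0//.
apply: ge0_le_integral_nomeas => x; first by rewrite lee_fin sqr_ge0.
by rewrite lee_fin -[leLHS]real_normK ?num_real// -[leRHS]real_normK ?num_real// lerXn2r ?nnegrE.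
Qed.

Lemma ae_le_L2norm (f g : T -> R) : measurable_fun setT g ->
  {ae mu, forall x, (`|f x| <= `|g x|)%R} -> L2norm mu f <= L2norm mu g.
Proof.
move=> mg fg; rewrite !L2normE lee_sqrt ?integral_sqr_ge0//.
apply: ae_le_integral_nomeas => [x||x|]; rewrite ?lee_fin ?sqr_ge0//.
  exact: measurable_sqr.
apply: filterS fg => x fgx.
by rewrite lee_fin -[leLHS]real_normK ?num_real// -[leRHS]real_normK ?num_real// lerXn2r ?nnegrE.
Qed.

Lemma ae_eq_L2norm (f g : T -> R) : measurable_fun setT g ->
  {ae mu, forall x, f x = g x} -> L2norm mu f = L2norm mu g.
Proof.
move=> mg fg; rewrite !L2normE; congr sqrte.
apply: ae_eq_integral_nomeas => [x||x|]; rewrite ?lee_fin ?sqr_ge0//.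
  exact: measurable_sqr.
by apply: filterS fg => x ->.
Qed.

Lemma L2norm_triangle (f g : T -> R) :
  measurable_fun setT f -> measurable_fun setT g ->
  L2norm mu (fun x => f x + g x)%R <= L2norm mu f + L2norm mu g.
Proof. by move=> mf mg; apply: minkowski_EFin => //; rewrite ler1n. Qed.

Lemma L2norm_sub (f g : T -> R) :
  L2norm mu (fun x => f x - g x)%R = L2norm mu (fun x => g x - f x)%R.
Proof.
by rewrite !L2normE; congr sqrte; apply: eq_integral => x _; rewrite -opprB sqrrN.
Qed.

Lemma L2normZ (c : R) (f : T -> R) : measurable_fun setT f ->
  L2norm mu (fun x => c * f x)%R = `|c|%:E * L2norm mu f.
Proof.
move=> mf; rewrite !L2normE.
under eq_integral do rewrite exprMn EFinM.
rewrite ge0_integralZl ?lee_fin ?sqr_ge0//; first last.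
- by move=> x _; rewrite lee_fin sqr_ge0.
- exact: measurable_sqr.
rewrite sqrteM ?lee_fin ?sqr_ge0//; congr (_ * _).
by rewrite /= sqrtr_sqr.
Qed.

Lemma L2norm0 : L2norm mu (fun=> 0%R) = 0.
Proof.
rewrite L2normE; under eq_integral do rewrite expr0n.
by rewrite integral0 sqrte0.
Qed.

Lemma L2norm_sum n (f : 'I_n -> T -> R) :
  (forall i, measurable_fun setT (f i)) ->
  L2norm mu (fun x => \sum_i f i x)%R <= \sum_i L2norm mu (f i).
Proof.
elim: n f => [|n IH] f mf.
  under [X in L2norm _ X]funext do rewrite big_ord0.
  by rewrite big_ord0 L2norm0.
under [X in L2norm _ X]funext do rewrite big_ord_recr.
rewrite big_ord_recr /=; apply: le_trans (leeD2r _ (IH _ _)); last by move=> i.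
by apply: L2norm_triangle => //; apply: measurable_sum.
Qed.

Lemma Lfun2P (f : T -> R) :
  f \in Lfun mu 2%:E <-> measurable_fun setT f /\ L2norm mu f < +oo.
Proof.
split=> [/andP[]|[mf nf]]; first by rewrite !inE /= => mf nf; split.
by apply/andP; rewrite !inE.
Qed.

Lemma L2norm_lty (f : T -> R) :
  (L2norm mu f < +oo) = (\int[mu]_x (f x ^+ 2)%:E < +oo).
Proof.
rewrite L2normE -!ge0_fin_numE ?sqrte_ge0 ?integral_sqr_ge0//.
by rewrite sqrte_fin_num// integral_sqr_ge0.
Qed.

(** Fatou's lemma for the squares. In the main applications [q n] is a Riemann sum in time of
    semigroup values, with an L^2 bound uniform in [n], and [h] is an increment of the semigroup,
    possibly with its linear part removed. *)
Lemma L2norm_fatou_le (q : nat -> T -> R) (h : T -> R) (c : R) :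
  (0 <= c)%R -> (forall n, measurable_fun setT (q n)) ->
  (forall n x, 0 <= q n x)%R -> (forall n, L2norm mu (q n) <= c%:E) ->
  {ae mu, forall x, `|h x|%:E <= limn_einf (fun n => (q n x)%:E)} ->
  L2norm mu h <= c%:E.
Proof.
move=> c0 mq q0 qc hq; rewrite L2norm_le_fin//.
have m2 n := measurable_sqr (mq n).
have sq0 n x : 0 <= (q n x ^+ 2)%:E by rewrite lee_fin sqr_ge0.
apply: (@le_trans _ _ (\int[mu]_x limn_einf (fun n => (q n x ^+ 2)%:E))).
  apply: ae_le_integral_nomeas => [x||x|].
  - by rewrite lee_fin sqr_ge0.
  - exact: measurable_limn_einf.
  - exact: limn_einf_ge0.
  - by apply: filterS hq => x hqx; rewrite -[(h x ^+ 2)%R]real_normK ?num_real//;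
    exact: limn_einf_sqr.
apply: le_trans (fatou _ _ _ _) _ => //.
by apply: limn_einf_le => n; rewrite -L2norm_le_fin.
Qed.

Lemma L2norm_fatou (f_ : nat -> T -> R) (f : T -> R) (c : R) :
  (0 <= c)%R -> (forall n, measurable_fun setT (f_ n)) ->
  (forall n, L2norm mu (f_ n) <= c%:E) ->
  {ae mu, forall x, (f_ n x @[n --> \oo] --> f x)%R} ->
  L2norm mu f <= c%:E.
Proof.
move=> c0 mf fc cf; apply: (@L2norm_fatou_le (fun n x => `|f_ n x|%R)) => //.
- by move=> n; exact: measurableT_comp.
- by move=> n; apply: le_trans (fc n); apply: le_L2norm => x; rewrite normr_id.
- apply: filterS cf => x cfx.
  rewrite (cvg_limn_einf_sup (l := `|f x|%:E) _).1//.
  by apply: cvg_EFin; [exact: nearW|exact: cvg_norm].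
Qed.

End L2.

Section ae_facts.
Context d (T : measurableType d) (R : realType) (mu : {measure set T -> \bar R}).

Lemma ae_integrable (f g : T -> R) : measurable_fun setT f ->
  {ae mu, forall x, f x = g x} -> mu.-integrable setT (EFin \o g) ->
  mu.-integrable setT (EFin \o f) /\ \int[mu]_x f x = \int[mu]_x g x.
Proof.
move=> mf fg /integrableP[mg ig].
have mf' : measurable_fun setT (EFin \o f) by exact/measurable_EFinP.
split; last first.
  by congr fine; apply: ae_eq_integral => //; apply: filterS fg => x -> _.
apply/integrableP; split => //.
rewrite (@ae_eq_integral _ _ _ mu setT (fun x => `|(EFin \o g) x|)%E)//.
- exact: measurableT_comp.
- exact: measurableT_comp.
- by apply: filterS fg => x /= -> _.
Qed.

Lemma Rintegral_sum (D : set T) n (f : 'I_n -> T -> R) : measurable D ->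
  (forall i, mu.-integrable D (EFin \o f i)) ->
  mu.-integrable D (EFin \o (fun v => \sum_i f i v)) /\
  \int[mu]_(v in D) (\sum_i f i v) = \sum_i \int[mu]_(v in D) f i v.
Proof.
move=> mD fi; split.
  rewrite (_ : EFin \o _ = (fun v => \sum_i (f i v)%:E)%E); last first.
    by apply/funext => v /=; rewrite sumEFin.
  apply: (@integrable_sum _ _ _ mu D mD _ _ xpredT (fun i v => (f i v)%:E)) => i _.
  exact: fi.
rewrite /Rintegral; under eq_integral do rewrite -sumEFin.
rewrite (integral_sum mD fi).
rewrite (eq_bigr (fun i => (fine (\int[mu]_(v in D) (f i v)%:E)%E)%:E)); first by rewrite sumEFin.
by move=> i _; rewrite fineK//; apply: integrable_fin_num => //; exact: fi.
Qed.

End ae_facts.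

(** * Riemann sums *)

Section riemann.
Variable R : realType.
Local Notation leb1 := (@lebesgue_measure R).

(** Paths are continuous on [0, +oo[ only; freezing them at their initial value for negative times
    gives functions continuous on all of R, to which the Riemann sum lemmas apply. *)
Lemma continuous_clamp0 (T : topologicalType) (f : R -> T) :
  {within `[0, +oo[, continuous f} -> continuous (fun s : R => f (Num.max 0 s)).
Proof.
move=> cf x; have c0 : (`[0, +oo[%classic : set R) (Num.max 0 x).
  by rewrite /= in_itv/= le_max lexx.
move: (cf) => /subspace_continuousP /(_ _ c0).
apply: (@cvg_comp _ _ _ (fun s : R => Num.max 0 s) f).
have cm : Num.max 0 s @[s --> x] --> Num.max 0 x.
  by apply: (@continuous_max R R (fun=> 0) idfun x); [exact: cvg_cst|exact: cvg_id].
move=> A /= /cm; rewrite nbhs_simpl/=; apply: filterS => s; apply.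
by rewrite /= in_itv/= le_max lexx.
Qed.

Lemma unif_continuous_segment (f : R -> R) (a b e : R) : continuous f -> 0 < e ->
  exists2 d, 0 < d & forall x y, a <= x <= b -> `|x - y| < d -> `|f x - f y| <= e.
Proof.
move=> cf e0.
have /compact_near_coveringP/(_ R (0 : R)^'+
  (fun d x => forall y, `|x - y| < d -> `|f x - f y| <= e)) :=
  @segment_compact R a b.
(* Compactness in its near-covering form: a tolerance valid around each point suffices. With radius
   r / 2, both [y] and [z] stay within [r] of the centre [x]. *)
case=> [x _|d /= d0 hd].
  have /cvgrPdist_le/(_ (e / 2)) := cf x.
  rewrite divr_gt0// => /(_ isT) [r /= r0 hr].
  exists (ball x (r / 2), [set d | d < r / 2]).
    split; first by apply: nbhsx_ballx; rewrite divr_gt0.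
    by apply: nbhs_right_lt; rewrite divr_gt0.
  move=> [y d] [/= xy dr] z yz.
  have -> : f y - f z = - (f x - f y) + (f x - f z) by ring.
  rewrite (le_trans (ler_normD _ _))// normrN (splitr e) lerD// hr//=.
    by rewrite (lt_trans xy)// ltr_pdivrMr// ltr_pMr// ltr1n.
  have -> : x - z = (x - y) + (y - z) by ring.
  by rewrite (le_lt_trans (ler_normD _ _))// (splitr r) ltrD// (lt_trans yz).
exists (d / 2); first by rewrite divr_gt0.
move=> x y xab xy; apply: (hd (d / 2)) => //=.
- by rewrite sub0r normrN gtr0_norm ?divr_gt0// ltr_pdivrMr// ltr_pMr// ltr1n.
- by rewrite divr_gt0.
Qed.

Lemma continuous_integrable_itv (f : R -> R) (a b : R) (x y : bool) : continuous f ->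
  leb1.-integrable [set` Interval (BSide x a) (BSide y b)] (EFin \o f).
Proof.
move=> cf; apply: (@integrableS _ _ _ leb1 `[a, b]%classic) => //.
  by apply: subset_itv; rewrite bnd_simp.
apply: continuous_compact_integrable; first exact: segment_compact.
exact: continuous_subspaceT.
Qed.

Let block (f : R -> R) (a b e : R) : continuous f -> a <= b ->
  (forall s, a <= s <= b -> `|f a - f s| <= e) ->
  `|\int[leb1]_(s in `]a, b]) f s - (b - a) * f a| <= (b - a) * e.
Proof.
move=> cf ab h.
have fin : fine (leb1 `]a, b]) = b - a.
  rewrite lebesgue_measure_itv/= lte_fin; case: ifPn => //=.
  by rewrite -leNgt => ba; apply/eqP; rewrite eq_sym subr_eq0 eq_le ab ba.
have -> : (b - a) * f a = \int[leb1]_(s in `]a, b]) (fun=> f a) s.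
  by rewrite Rintegral_cst// fin mulrC.
have ic : leb1.-integrable `]a, b] (EFin \o (fun=> f a)).
  by apply: (@continuous_integrable_itv (fun=> f a)) => ?; exact: cvg_cst.
rewrite -RintegralB//; last exact: continuous_integrable_itv.
apply: le_trans (le_normr_Rintegral _ _) _ => //.
  by apply: (@continuous_integrable_itv (fun s => f s - f a)) => s;
     apply: cvgB; [exact: cf|exact: cvg_cst].
have -> : (b - a) * e = \int[leb1]_(s in `]a, b]) (fun=> e) s.
  by rewrite Rintegral_cst// fin mulrC.
apply: le_Rintegral => //.
- apply: (@continuous_integrable_itv (fun s => `|f s - f a|)) => s.
  by apply: cvg_norm; apply: cvgB; [exact: cf|exact: cvg_cst].
- by apply: (@continuous_integrable_itv (fun=> e)) => ?; exact: cvg_cst.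
- move=> s /=; rewrite in_itv/= => /andP[as_ sb].
  by rewrite distrC h// (ltW as_).
Qed.

Lemma riemann_sum_cvg (f : R -> R) (t : R) : continuous f -> 0 <= t ->
  t / n.+1%:R * \sum_(k < n.+1) f (k%:R * (t / n.+1%:R)) @[n --> \oo] -->
  \int[leb1]_(s in `[0, t]) f s.
Proof.
move=> cf t0; apply/cvgrPdist_le => e e0.
(* The errors of the blocks add up to [t] times this tolerance, hence to at most [e]; the
   denominator [t + 1] also covers t = 0. *)
have e'0 : 0 < e / (t + 1) by rewrite divr_gt0// ltr_wpDl.
have [d d0 hd] := @unif_continuous_segment f 0 t _ cf e'0.
near=> n; set h := t / n.+1%:R.
have h0 : 0 <= h by rewrite divr_ge0.
have hdl : h < d.
  rewrite /h ltr_pdivrMr// -ltr_pdivrMl// mulrC.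
  apply: (@lt_trans _ _ n%:R); last by rewrite ltr_nat.
  by near: n; exact: nbhs_infty_gtr.
have nh : n.+1%:R * h = t by rewrite /h mulrC divfK.
(* Induction on the number of blocks, the error being proportional to the length already covered. *)
suff H k : (k <= n.+1)%N ->
    `|\int[leb1]_(s in `[0, k%:R * h]) f s - h * \sum_(j < k) f (j%:R * h)| <=
    k%:R * h * (e / (t + 1)).
  have := H n.+1 (leqnn _); rewrite nh => /le_trans; apply.
  rewrite mulrA ler_pdivrMr ?ltr_wpDl// mulrC ler_pM2l//.
  by rewrite lerDl.
elim: k => [_|k IH kn].
  by rewrite !mul0r big_ord0 mulr0 subr0 set_itv1 Rintegral_set1 normr0.
have kh0 : 0 <= k%:R * h by rewrite mulr_ge0.
have kkh : k%:R * h <= k.+1%:R * h by rewrite ler_wpM2r// ler_nat.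
have := @Rintegral_itvB R f (BLeft 0) (BRight (k.+1%:R * h)) (k%:R * h)
  (continuous_integrable_itv _ _ _ _ cf).
rewrite !bnd_simp => /(_ kh0 kkh) split_int.
rewrite big_ord_recr /= mulrDr.
have -> : \int[leb1]_(s in `[0, k.+1%:R * h]) f s =
  \int[leb1]_(s in `[0, k%:R * h]) f s + \int[leb1]_(s in `]k%:R * h, k.+1%:R * h]) f s.
  by rewrite -split_int addrC subrK.
rewrite opprD addrACA (le_trans (ler_normD _ _))//.
rewrite -natr1 mulrDl mul1r [leRHS]mulrDl lerD//; first exact: IH (ltnW kn).
have := @block f (k%:R * h) (k%:R * h + h) (e / (t + 1)) cf.
rewrite lerDl addrAC subrr add0r => /(_ h0); apply => s /andP[ks skh].
apply: hd.
  rewrite kh0/=; apply: le_trans kkh _; rewrite -nh ler_wpM2r// ler_nat//.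
rewrite distrC ger0_norm ?subr_ge0//; apply: le_lt_trans hdl.
by rewrite lerBlDl.
Unshelve. all: by end_near. Qed.

End riemann.

(** * Markov semigroups *)

Section probability_L2.
Context d (T : measurableType d) (R : realType).
Variable q : {measure set T -> \bar R}.
Hypothesis q1 : q setT = 1%E.
Local Open Scope ereal_scope.

Lemma bounded_integrable (f : T -> R) (M : R) : measurable_fun setT f ->
  (forall x, `|f x| <= M)%R -> q.-integrable setT (EFin \o f).
Proof.
move=> mf fM; apply: measurable_bounded_integrable => //.
  by rewrite q1 ltry.
by exists M; split; [exact: num_real|move=> y My x _; exact: le_trans (fM x) (ltW My)].
Qed.

Lemma L2_integrable (f : T -> R) : measurable_fun setT f ->
  \int[q]_x (f x ^+ 2)%:E < +oo -> q.-integrable setT (EFin \o f).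
Proof.
move=> mf f2; apply/Lfun1_integrable; apply: Lfun_subset12.
  by rewrite q1.
by apply/Lfun2P; rewrite L2norm_lty.
Qed.

Lemma integral_cst_prob (c : R) : \int[q]_x c%:E = c%:E.
Proof. by rewrite integral_cst// q1 mule1. Qed.

(** Jensen's inequality, by integrating f^2 >= 2 a f - a^2 with [a] the mean of [f]; an infinite
    right-hand side is treated apart. *)
Lemma sqr_Rintegral_le (f : T -> R) : measurable_fun setT f ->
  ((Rintegral q setT f) ^+ 2)%:E <= \int[q]_x (f x ^+ 2)%:E.
Proof.
move=> mf; have [->|f2] := eqVneq (\int[q]_x (f x ^+ 2)%:E) +oo; first exact: leey.
have fi : q.-integrable setT (EFin \o f) by apply: L2_integrable => //; rewrite ltey.
set a := Rintegral q setT f.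
have aE : \int[q]_x (f x)%:E = a%:E by rewrite /a fineK// integrable_fin_num.
have ci : q.-integrable setT (EFin \o (fun=> - (a ^+ 2))%R).
  by apply: (@bounded_integrable _ `|- a ^+ 2|%R).
have i1 : q.-integrable setT (EFin \o (fun x => 2 * a * f x)%R) by exact: (integrableZl
  measurableT (2 * a)%R fi).
have -> : (a ^+ 2)%:E = \int[q]_x (2 * a * f x + - (a ^+ 2))%:E.
  under eq_integral do rewrite EFinD.
  rewrite integralD//= integral_cst_prob.
  under eq_integral do rewrite EFinM.
  by rewrite integralZl// aE -EFinM -EFinD; congr EFin; ring.
apply: le_integral => //.
- exact: (integrableD measurableT i1 ci).
- apply/integrableP; split; first exact: measurable_sqr.
  rewrite (_ : \int[q]_x _ = \int[q]_x (f x ^+ 2)%:E) ?ltey//.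
  by apply: eq_integral => x _; rewrite gee0_abs// lee_fin sqr_ge0.
- move=> x _; rewrite lee_fin -subr_ge0.
  by rewrite (_ : _ - _ = (f x - a) ^+ 2)%R ?sqr_ge0//; ring.
Qed.

End probability_L2.

Section semigroup.
Context d (T : measurableType d) (R : realType).
Variables (mu : probability T R) (P : R -> R.-pker T ~> T).
Hypothesis inv : invariant_measure mu P.
Local Notation Pt := (transition_semigroup P).
Local Open Scope ereal_scope.

Lemma pker1 t z : P t z setT = 1. Proof. exact: prob_kernel. Qed.

Lemma measurable_semigroup t (f : T -> R) : measurable_fun setT f ->
  measurable_fun setT (Pt t f).
Proof.
move=> mf; apply: measurableT_comp; first exact: fine_measurable.
under eq_fun do rewrite integralE.
apply: emeasurable_funB.
  apply: measurable_fun_integral_kernel => [U mU|z|].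
  - exact: measurable_kernel.
  - exact: funepos_ge0.
  - by apply: measurable_funepos; exact/measurable_EFinP.
apply: measurable_fun_integral_kernel => [U mU|z|].
- exact: measurable_kernel.
- exact: funeneg_ge0.
- by apply: measurable_funeneg; exact/measurable_EFinP.
Qed.

Lemma ge0_integral_invariant t (f : T -> \bar R) : (0 <= t)%R ->
  measurable_fun setT f -> (forall z, 0 <= f z) ->
  \int[mu]_z \int[P t z]_y f y = \int[mu]_z f z.
Proof.
move=> t0 mf f0; apply/esym; apply: (@ge0_integral_mixture _ _ _ _ R mu (P t) mu) => //.
- by move=> A mA; exact: measurable_kernel.
- by move=> A mA; rewrite inv.
Qed.

(** Jensen's inequality under the kernel at each point, then invariance of [mu]. *)
Lemma semigroup_contraction t (f : T -> R) : (0 <= t)%R -> measurable_fun setT f ->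
  L2norm mu (Pt t f) <= L2norm mu f.
Proof.
move=> t0 mf; rewrite !L2normE lee_sqrt ?integral_sqr_ge0//.
rewrite -(ge0_integral_invariant t0 (measurable_sqr mf)); last first.
  by move=> z; rewrite lee_fin sqr_ge0.
apply: ge0_le_integral_nomeas => z; first by rewrite lee_fin sqr_ge0.
by apply: sqr_Rintegral_le => //; exact: pker1.
Qed.

Lemma semigroup_bounded t (f : T -> R) M z : measurable_fun setT f ->
  (forall x, `|f x| <= M)%R -> (`|Pt t f z| <= M)%R.
Proof.
move=> mf fM; have fi := bounded_integrable (pker1 t z) mf fM.
apply: le_trans (le_normr_Rintegral _ fi) _ => //.
rewrite -[leRHS](_ : \int[P t z]_y M = M)%R; last first.
  by rewrite Rintegral_cst// pker1 mulr1.
apply: le_Rintegral => //.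
  apply: (bounded_integrable (pker1 t z) (M := M)) => [|x].
    exact: measurableT_comp.
  by rewrite normr_id.
by apply: (bounded_integrable (pker1 t z) (M := `|M|)).
Qed.

Lemma semigroupB t (f g : T -> R) M N : measurable_fun setT f ->
  measurable_fun setT g ->
  (forall x, `|f x| <= M)%R -> (forall x, `|g x| <= N)%R ->
  Pt t (fun x => f x - g x)%R = (fun z => Pt t f z - Pt t g z)%R.
Proof.
move=> mf mg fM gN; apply/funext => z; apply: RintegralB => //.
  exact: (bounded_integrable (pker1 t z) mf fM).
exact: (bounded_integrable (pker1 t z) mg gN).
Qed.

Lemma semigroup_cst t (c : R) z : Pt t (fun=> c) z = c.
Proof. by rewrite /transition_semigroup Rintegral_cst// pker1 mulr1. Qed.

Hypothesis CK : chapman_kolmogorov P.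

Lemma semigroup_comp s t (f : T -> R) (M : R) z : (0 <= s)%R -> (0 <= t)%R ->
  measurable_fun setT f -> (forall x, `|f x| <= M)%R ->
  Pt s (Pt t f) z = Pt (s + t) f z.
Proof.
move=> s0 t0 mf fM.
(* Adding the bound [M] makes the function nonnegative, so that the mixture formula applies; the
   kernels fix constants, and [M] cancels at the end. *)
have mg : measurable_fun setT (fun x => f x - (- M))%R by exact: measurable_funB.
have g0 x : (0 <= f x - - M)%R by have := fM x; rewrite ler_norml; lra.
have mk A : measurable A -> measurable_fun setT ((fun y => P t y) ^~ A).
  by move=> mA; exact: measurable_kernel.
have key : \int[P (s + t) z]_y (f y - - M)%:E =
    \int[P s z]_y \int[P t y]_x (f x - - M)%:E.
  apply: (@ge0_integral_mixture _ _ _ _ R (P s z) (P t) (P (s + t) z)) => //.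
  - by move=> A mA; exact: CK.
  - exact/measurable_EFinP.
have cM (x : T) : (`|- M| <= `|- M|)%R by [].
have := semigroupB (s + t) mf (measurable_cst (- M)%R) fM cM.
move=> /(congr1 (@^~ z)); rewrite semigroup_cst => H1.
have H2 := semigroupB t mf (measurable_cst (- M)%R) fM cM.
have := semigroupB s (measurable_semigroup t mf) (measurable_cst (- M)%R)
  (fun y => semigroup_bounded t y mf fM) cM.
move=> /(congr1 (@^~ z)); rewrite semigroup_cst => H3.
apply: (@addIr _ (- - M)%R); rewrite -H1 -H3 /transition_semigroup/Rintegral key.
congr fine; apply: eq_integral => y _.
have := congr1 (@^~ y) H2; rewrite /= semigroup_cst => <-.
rewrite /transition_semigroup /Rintegral fineK//; apply: integrable_fin_num => //.
apply: (bounded_integrable (pker1 t y) mg (M := (M + M)%R)) => x.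
have M0 : (0 <= M)%R := le_trans (normr_ge0 _) (fM x).
by rewrite opprK (le_trans (ler_normD _ _))// lerD// ger0_norm.
Qed.

(** Telescoping: P_((k+1)h) f - f is the sum of P_(kh) (P_h f - f) and P_(kh) f - f, and P_(kh) is a
    contraction. *)
Lemma semigroup_subadditive h n (f : T -> R) (M : R) : (0 <= h)%R ->
  measurable_fun setT f -> (forall x, `|f x| <= M)%R ->
  L2norm mu (fun z => Pt (n.+1%:R * h) f z - f z)%R <=
  n.+1%:R%:E * L2norm mu (fun z => Pt h f z - f z)%R.
Proof.
move=> h0 mf fM.
have mP t : measurable_fun setT (Pt t f) by exact: measurable_semigroup.
have bP t z : (`|Pt t f z| <= M)%R by exact: semigroup_bounded.
elim: n => [|n IH]; first by rewrite mul1r mul1e.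
have nh0 : (0 <= n.+1%:R * h)%R by rewrite mulr_ge0.
have -> : (fun z => Pt (n.+2%:R * h) f z - f z)%R =
  (fun z => Pt (n.+1%:R * h) (fun y => Pt h f y - f y) z + (Pt (n.+1%:R * h) f z - f z))%R.
  apply/funext => z; rewrite (semigroupB _ (mP h) mf (bP h) fM)/=.
  rewrite (semigroup_comp z nh0 h0 mf fM) addrA subrK.
  by congr (Pt _ f z - f z)%R; rewrite -[in LHS]natr1; ring.
apply: le_trans (L2norm_triangle _ _ _) _.
- by apply: measurable_semigroup; exact: measurable_funB.
- exact: measurable_funB.
rewrite -[in leRHS]natr1 EFinD ge0_muleDl ?lee_fin// mul1e addeC leeD//.
by apply: semigroup_contraction => //; exact: measurable_funB.
Qed.

Hypothesis P0 : forall z A, measurable A -> P 0 z A = dirac z A.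

Lemma semigroup0 (f : T -> R) z : measurable_fun setT f -> Pt 0 f z = f z.
Proof.
move=> mf; rewrite /transition_semigroup /Rintegral.
rewrite (eq_measure_integral (dirac z : {measure set T -> \bar R})); last first.
  by move=> A mA _; exact: P0.
by rewrite integral_dirac ?diracT ?mul1e//; exact/measurable_EFinP.
Qed.

(** This stands in for the formula writing P_t f - f as the integral of P_s g over [0, t]. Cut
    [0, t] into N + 1 steps of length h: each contributes at most |P_h f - f|, which is at most h
    (|g| + e / t) for h small because (P_h f - f) / h tends to g. *)
Lemma L2norm_generator_bound (f g : T -> R) (M t : R) : (0 <= t)%R ->
  measurable_fun setT f -> (forall x, `|f x| <= M)%R -> L2_generator mu P f g ->
  L2norm mu (fun z => Pt t f z - f z)%R <= t%:E * L2norm mu g.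
Proof.
move=> t0 mf fM [_ /Lfun2P[mg g2] /cvge_at_rightP cfg].
have [->|tn0] := eqVneq t 0%R.
  rewrite mul0e (_ : (fun z => _) = fun=> 0%R) ?L2norm0//.
  by apply/funext => z; rewrite semigroup0// subrr.
have {}t0 : (0 < t)%R by rewrite lt_neqAle eq_sym tn0.
have mP s : measurable_fun setT (Pt s f) by exact: measurable_semigroup.
pose u n : R := (t / n.+1%:R)%R.
have u0 n : (0 < u n)%R by rewrite divr_gt0.
have cu : (u n @[n --> \oo] --> 0)%R.
  rewrite -[X in _ --> X](mulr0 t); apply: cvgM; first exact: cvg_cst.
  exact: cvg_harmonic.
have := cfg u (conj u0 cu).
move=> /fine_cvgP[fin /cvgrPdist_lt cv].
have gfin : L2norm mu g \is a fin_num by rewrite ge0_fin_numE ?L2norm_ge0.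
apply/lee_addgt0Pr => e e0.
have e'0 : (0 < e / t)%R by rewrite divr_gt0.
have [N _ /(_ N (leqnn N))[/= finN]] := filterI fin (cv _ e'0).
rewrite sub0r normrN ger0_norm ?fine_ge0 ?L2norm_ge0// => Ne.
set h := u N in finN Ne.
have hne : h != 0%R by rewrite gt_eqF//; exact: u0.
have -> : t = (N.+1%:R * h)%R by rewrite /h /u mulrC divfK.
apply: le_trans (semigroup_subadditive N (ltW (u0 N)) mf fM) _.
rewrite -/h.
pose D z := (h^-1 * (Pt h f z - f z) - g z)%R.
have mD : measurable_fun setT D.
  apply: measurable_funB => //; apply: measurable_funM => //.
  exact: measurable_funB.
have -> : (fun z => Pt h f z - f z)%R = (fun z => h * (D z + g z))%R.
  by apply/funext => z; rewrite /D subrK mulrA divff// mul1r.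
rewrite L2normZ; last exact: measurable_funD.
have h0 : (0 < h)%R := u0 N.
rewrite (gtr0_norm h0) muleA -EFinM.
have Nh : (N.+1%:R * h = t)%R by rewrite /h /u mulrC divfK.
rewrite Nh; apply: (@le_trans _ _ (t%:E * ((e / t)%:E + L2norm mu g))).
  apply: lee_wpmul2l; first by rewrite lee_fin ltW.
  apply: le_trans (@L2norm_triangle _ _ _ mu _ _ mD mg) _.
  by rewrite leeD2r// -[leLHS]fineK// lee_fin ltW.
rewrite ge0_muleDr ?L2norm_ge0 ?lee_fin ?(ltW e'0)// -EFinM mulrC divfK//.
by rewrite addeC.
Qed.

(** The Riemann sum with n + 1 points is at distance at most the mean of k t c / (n + 1), k = 0,
    ..., n, from [f]; this mean is at most t c / 2, which is why averaging halves the constant. [h]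
    is the lower limit of the sums, a measurable version of the average, and [phi] provides the
    continuity in time that makes the sums converge. *)
Lemma averaged_semigroup_bound (f : T -> R) (c t : R) : (0 <= c)%R -> (0 < t)%R ->
  measurable_fun setT f ->
  (forall s, (0 <= s <= t)%R ->
    L2norm mu (fun z => Pt s f z - f z)%R <= (s * c)%:E) ->
  {ae mu, forall z, exists2 phi : R -> R, continuous phi &
     forall s, (0 <= s <= t)%R -> phi s = Pt s f z} ->
  exists h : T -> R, [/\ measurable_fun setT h,
    {ae mu, forall z, averaged_semigroup P t f z = h z} &
    L2norm mu (fun z => h z - f z)%R <= (t / 2 * c)%:E].
Proof.
move=> c0 t0 mf fb cont.
have mP s : measurable_fun setT (Pt s f) by exact: measurable_semigroup.
pose S n z := (n.+1%:R^-1 * \sum_(k < n.+1) Pt (k%:R * (t / n.+1%:R)) f z)%R.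
have mS n : measurable_fun setT (S n).
  by apply: measurable_funM => //; apply: measurable_sum.
have cS : {ae mu, forall z, (S n z @[n --> \oo] --> averaged_semigroup P t f z)%R}.
  apply: filterS cont => z [phi cphi phiE].
  rewrite /averaged_semigroup.
  have -> : (\int[lebesgue_measure]_(s in `[0, t]) Pt s f z =
      \int[lebesgue_measure]_(s in `[0, t]) phi s)%R.
    by apply: eq_Rintegral => s; rewrite inE/= in_itv/= => st; rewrite phiE.
  have := @riemann_sum_cvg R phi t cphi (ltW t0).
  move=> /(@cvgM _ _ _ _ (fun=> t^-1)%R _ _ _ (cvg_cst _)).
  apply: cvg_trans; apply: near_eq_cvg; apply: nearW => n /=.
  rewrite /S /GRing.mul_fun/= mulrA mulKf ?gt_eqF//; congr (_ * _)%R.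
  apply: eq_bigr => k _; rewrite phiE// mulr_ge0 ?divr_ge0 ?(ltW t0)//=.
  rewrite mulrCA ler_piMr ?(ltW t0)// ler_pdivrMr// mul1r ler_nat.
  exact: ltnW.
pose h z := fine (limn_einf (fun n => (S n z)%:E)).
have hE : {ae mu, forall z, averaged_semigroup P t f z = h z}.
  apply: filterS cS => z cSz; rewrite /h.
  by rewrite (cvg_limn_einf_sup (l := (averaged_semigroup P t f z)%:E) _).1//; apply: cvg_EFin;
    [exact: nearW|].
have mh : measurable_fun setT h.
  apply: measurableT_comp; first exact: fine_measurable.
  by apply: measurable_limn_einf => n; exact/measurable_EFinP.
exists h; split => //.
apply: (@L2norm_fatou _ _ _ _ (fun n z => S n z - f z)%R).
- by rewrite mulr_ge0// divr_ge0// ltW.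
- by move=> n; exact: measurable_funB.
- move=> n.
  have -> : (fun z => S n z - f z)%R = (fun z => n.+1%:R^-1 *
      \sum_(k < n.+1) (Pt (k%:R * (t / n.+1%:R)) f z - f z))%R.
    apply/funext => z; rewrite sumrB mulrBr; congr (_ - _)%R.
    by rewrite sumr_const card_ord -[(f z *+ _)%R]mulr_natl mulKf.
  rewrite L2normZ; last by apply: measurable_sum => k; exact: measurable_funB.
  rewrite gtr0_norm ?invr_gt0//.
  apply: (@le_trans _ _ (n.+1%:R^-1%:E * \sum_(k < n.+1) (k%:R * (t / n.+1%:R) * c)%:E)).
    apply: lee_wpmul2l; first by rewrite lee_fin invr_ge0.
    apply: le_trans (L2norm_sum _ _) _.
      by move=> k; exact: measurable_funB.
    apply: lee_sum => k _; apply: fb; rewrite mulr_ge0 ?divr_ge0 ?(ltW t0)//=.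
    rewrite mulrCA ler_piMr ?(ltW t0)// ler_pdivrMr// mul1r ler_nat.
    exact: ltnW.
  rewrite sumEFin -EFinM lee_fin -!mulr_suml.
  have -> : (\sum_(k < n.+1) k%:R = n.+1%:R * n%:R / 2 :> R)%R.
    elim: (n) => [|k IH]; first by rewrite big_ord_recr big_ord0/= addr0 mulr0 mul0r.
    by rewrite big_ord_recr /= IH -!natr1; field.
  have -> : (n.+1%:R^-1 * (n.+1%:R * n%:R / 2 * (t / n.+1%:R) * c) =
    (t / 2 * c) * (n%:R / n.+1%:R))%R by field.
  rewrite ler_piMr ?mulr_ge0 ?divr_ge0 ?(ltW t0)//.
  by rewrite ler_pdivrMr// mul1r ler_nat.
- near=> z; rewrite -(near hE z)//; apply: cvgB; last exact: cvg_cst.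
  exact: (near cS z).
Unshelve. all: by end_near. Qed.

Lemma trel_ge (f : T -> R) (c t : R) : L02 mu f -> L2norm mu f = 1 ->
  (0 <= t)%R -> L2norm mu (fun z => Pt t f z - f z)%R <= (t * c)%:E ->
  opnorm0 mu (Pt t) <= (expR (-1))%:E -> (1 - expR (-1) <= t * c)%R.
Proof.
move=> f0 f1 t0 fb op.
have mf : measurable_fun setT f by case: f0 => /Lfun2P[].
have Pf : L2norm mu (Pt t f) <= (expR (-1))%:E.
  apply: le_trans op; apply: ereal_sup_ubound; exists f; split => //.
  by rewrite f1.
rewrite lerBlDr -lee_fin -f1.
have := @L2norm_triangle _ _ _ mu _ _ (measurable_funB mf (measurable_semigroup t mf))
  (measurable_semigroup t mf).
under [X in L2norm _ X <= _]funext do rewrite /= subrK.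
move/le_trans; apply; rewrite EFinD leeD// L2norm_sub//.
Qed.

Lemma trel_bar_ge (f h : T -> R) (c t : R) : L02 mu f -> L2norm mu f = 1 ->
  measurable_fun setT h ->
  {ae mu, forall z, averaged_semigroup P t f z = h z} ->
  L2norm mu (fun z => h z - f z)%R <= c%:E ->
  opnorm0 mu (averaged_semigroup P t) <= (expR (-1))%:E -> (1 - expR (-1) <= c)%R.
Proof.
move=> f0 f1 mh hE fb op.
have mf : measurable_fun setT f by case: f0 => /Lfun2P[].
have Pf : L2norm mu h <= (expR (-1))%:E.
  rewrite -(ae_eq_L2norm mh hE).
  apply: le_trans op; apply: ereal_sup_ubound; exists f; split => //.
  by rewrite f1.
rewrite lerBlDr -lee_fin -f1.
have := @L2norm_triangle _ _ _ mu _ _ (measurable_funB mf mh) mh.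
under [X in L2norm _ X <= _]funext do rewrite /= subrK.
move/le_trans; apply; rewrite EFinD leeD// L2norm_sub//.
Qed.

End semigroup.

(** * Calculus of directional derivatives *)

Lemma is_derive_mul (R : realType) (V : normedModType R) (f g : V -> R) (x v : V) (df dg : R) :
  is_derive x v f df -> is_derive x v g dg ->
  is_derive x v (fun y => f y * g y) (df * g x + f x * dg).
Proof.
move=> Hf Hg; apply: (@is_derive_eq _ _ _ _ _ _ _ _ (is_deriveM Hf Hg)).
by rewrite addrC mulrC.
Qed.

Lemma is_derive_mulr_id (R : realType) (c s : R) :
  is_derive s 1 (fun s : R => s * c) c.
Proof.
apply: (@is_derive_eq _ _ _ _ _ _ _ _
  (is_derive_mul (is_derive_id s 1) (is_derive_cst c s 1))).
by rewrite mul1r mulr0 addr0.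
Qed.

Section derive_direction.
Context (R : realType) (V : normedModType R).

Lemma is_derive_scale (f : V -> R) (x v : V) (c d : R) :
  is_derive x v f d -> is_derive x (c *: v) f (c * d).
Proof.
move=> df; apply: is_derive_of_line.
have -> : (fun s : R => f (x + s *: (c *: v))) =
    (fun r : R => f (x + r *: v)) \o (fun s : R => s * c).
  by apply/funext => s /=; rewrite scalerA.
rewrite mulrC; apply: is_derive1_comp.
  by apply: is_derive_line; rewrite mul0r scale0r addr0.
exact: is_derive_mulr_id.
Qed.

(** [Ck] speaks of directional derivatives only, so additivity in the direction has to be proved. Go
    from x to x + h (v + w) through x + h v: by the mean value theorem the second leg contributes h
    times ['D_w f] at a point within |h| (|v| + |w|) of x, where continuity of ['D_w f] applies. *)
Lemma derive_add (f : V -> R) (x v w : V) :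
  (forall y u, derivable f y u) -> continuous (fun y => 'D_w f y) ->
  'D_(v + w) f x = 'D_v f x + 'D_w f x.
Proof.
move=> df cw.
have mvt h : exists2 s, `|s| <= 1 &
    f (x + h *: (v + w)) - f (x + h *: v) = h * 'D_w f (x + h *: v + (s * h) *: w).
  pose phi (s : R) := f (x + h *: v + s *: (h *: w)).
  have dphi (s : R) : is_derive s (1 : R) phi (h * 'D_w f (x + h *: v + s *: (h *: w))).
    by apply: is_derive_line; apply: is_derive_scale; exact: derivableP.
  have cphi : continuous phi.
    move=> s; apply: differentiable_continuous; apply/derivable1_diffP.
    exact: ex_derive.
  have [s] := @MVT _ phi _ 0 1 ltr01 (fun s _ => dphi s) (continuous_subspaceT cphi).
  rewrite in_itv/= => /andP[s0 s1] E.
  exists s; first by rewrite gtr0_norm// ltW.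
  move: E; rewrite /phi scale1r scale0r addr0 subr0 mulr1 scalerDr addrA => ->.
  by rewrite scalerA.
apply/eqP; rewrite eq_sym -subr_eq0 -normr_le0; apply/ler_addgt0Pr => e e0.
rewrite add0r.
have e3 : 0 < e / 3 by rewrite divr_gt0.
have near_quot u : \forall h \near (0 : R)^',
    `|h^-1 * (f (x + h *: u) - f x) - 'D_u f x| < e / 3.
  have := derivableP (df x u) => -[/cvg_ex[l hl] dl].
  have El : 'D_u f x = l by apply/cvg_lim => //.
  rewrite El; have /cvgrPdist_lt/(_ _ e3) := hl; apply: filterS => h.
  by rewrite distrC /= [h *: u + x]addrC.
have near_w : \forall h \near (0 : R)^',
    forall s, `|s| <= 1 -> `|'D_w f (x + h *: v + (s * h) *: w) - 'D_w f x| < e / 3.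
  have /cvgrPdist_lt/(_ _ e3) := cw x.
  move=> /nbhs_ballP[r /= r0 hr].
  (* Chosen so that |h| < q implies |h| (|v| + |w|) < r; the 1 keeps the denominator positive when
     both directions vanish. *)
  pose q := r / (`|v| + `|w| + 1).
  have q0 : 0 < q by rewrite divr_gt0// ltr_wpDl// addr_ge0.
  exists q => // h /= hq hn0 s s1; rewrite distrC; apply: hr.
  rewrite -ball_normE /ball_/= -!addrA opprD addNKr normrN.
  apply: le_lt_trans (ler_normD _ _) _; rewrite !normrZ.
  have sh : `|s| * `|h| <= `|h| by rewrite ler_piMl.
  have hq' : `|h| < q by move: hq; rewrite sub0r normrN.
  apply: (@le_lt_trans _ _ (`|h| * (`|v| + `|w|))).
    by rewrite mulrDr lerD2l ler_wpM2r.
  apply: (@le_lt_trans _ _ (q * (`|v| + `|w|))).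
    by rewrite ler_wpM2r ?addr_ge0// ltW.
  by rewrite /q -mulrA gtr_pMr// mulrC ltr_pdivrMr ?mul1r ?ltrDl// ltr_wpDl// addr_ge0.
have [h [hn0 [hv [hvw hw]]]] : exists h : R, h != 0 /\
    `|h^-1 * (f (x + h *: v) - f x) - 'D_v f x| < e / 3 /\
    `|h^-1 * (f (x + h *: (v + w)) - f x) - 'D_(v + w) f x| < e / 3 /\
    forall s, `|s| <= 1 -> `|'D_w f (x + h *: v + (s * h) *: w) - 'D_w f x| < e / 3.
  suff /filter_ex[h hP] : \forall h \near (0 : R)^', h != 0 /\
    `|h^-1 * (f (x + h *: v) - f x) - 'D_v f x| < e / 3 /\
    `|h^-1 * (f (x + h *: (v + w)) - f x) - 'D_(v + w) f x| < e / 3 /\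
    forall s, `|s| <= 1 -> `|'D_w f (x + h *: v + (s * h) *: w) - 'D_w f x| < e / 3.
    by exists h.
  near=> h; split; first by near: h; exact: nbhs_dnbhs_neq.
  split; first by near: h; exact: near_quot.
  split; first by near: h; exact: near_quot.
  by near: h; exact: near_w.
have [s s1 E] := mvt h.
have {hw} hw := hw _ s1.
set D := 'D_w f (x + h *: v + (s * h) *: w) in E hw.
have E2 : h^-1 * (f (x + h *: (v + w)) - f x) = D + h^-1 * (f (x + h *: v) - f x).
  have -> : f (x + h *: (v + w)) - f x =
    (f (x + h *: (v + w)) - f (x + h *: v)) + (f (x + h *: v) - f x) by ring.
  by rewrite E mulrDr mulKf.
rewrite E2 in hvw.
move: hv hvw hw; rewrite !ltr_norml => /andP[h1 h2] /andP[h3 h4] /andP[h5 h6].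
by rewrite ler_norml; apply/andP; split; lra.
Unshelve. all: by end_near. Qed.

End derive_direction.

Section rV_facts.
Variable R : realType.

Lemma coord_le_norm n (x : 'rV[R]_n) i : `|x ord0 i| <= `|x|.
Proof.
rewrite -[leRHS]/(mx_norm x) mx_normrE.
exact: (le_bigmax _ (fun ij => `|x ij.1 ij.2|) (ord0, i)).
Qed.

Lemma dotv_sumE n (a x : 'rV[R]_n) : dotv a x = \sum_i a ord0 i * x ord0 i.
Proof. by []. Qed.

Lemma continuous_coord n (i : 'I_n) : continuous (fun x : 'rV[R]_n => x ord0 i).
Proof. exact: coord_continuous. Qed.

Lemma continuous_dotv n (a : 'rV[R]_n) : continuous (dotv a).
Proof.
apply: (continuous_big (op := +%R)); first exact: add_continuous.
by move=> i _ x; exact: (cvgM (cvg_cst _) (@continuous_coord n i x)).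
Qed.

Lemma is_derive_dotv n (a x v : 'rV[R]_n) : is_derive x v (dotv a) (dotv a v).
Proof.
have E : (fun h : R => h^-1 *: ((dotv a \o shift x) (h *: v) - dotv a x)) @ 0^' --> dotv a v.
  apply: (@cvg_trans _ (cst (dotv a v) h @[h --> (0 : R)^'])); last exact: cvg_cst.
  apply: near_eq_cvg; near=> h.
  have hn0 : h != 0 by near: h; exact: nbhs_dnbhs_neq.
  rewrite /= /dotv -sumrB scaler_sumr; apply: eq_bigr => i _.
  rewrite !mxE mulrDr addrK mulrCA [_ *: _]mulrC.
  by rewrite mulrAC divff// mul1r.
by split; [apply/cvg_ex; exists (dotv a v)|apply/cvg_lim].
Unshelve. all: by end_near. Qed.

(** Additivity in the direction, coordinate by coordinate. It reconciles ['D_a U], natural for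
    affine test functions, with [grad U], which is built from partial derivatives and drives the
    diffusion. *)
Lemma derive_dotv_sum n (U : 'rV[R]_n -> R) (a x : 'rV[R]_n) :
  Ck 1 U -> 'D_a U x = dotv a (grad U x).
Proof.
move=> [_ dU].
have dU1 y u : derivable U y u by have [] := dU u.
have cU1 u : continuous (fun y => 'D_u U y) by have [_ []] := dU u.
have -> : a = \sum_i a ord0 i *: delta_mx ord0 i by exact: row_sum_delta.
have dsum (s : seq 'I_n) : 'D_(\sum_(i <- s) a ord0 i *: delta_mx ord0 i) U x =
    \sum_(i <- s) a ord0 i * partial i U x.
  elim: s => [|i s IH]; first rewrite !big_nil.
    exact: (@derive_val _ _ _ _ _ _ _ (is_derive0 U x)).
  rewrite !big_cons addrC derive_add//.
  rewrite IH addrC; congr (_ + _); apply: derive_val; apply: is_derive_scale.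
  exact: derivableP.
rewrite dsum dotv_sumE; apply: eq_bigr => i _; rewrite mxE; congr (_ * _).
rewrite summxE (bigD1 i)//= big1 ?addr0; first by rewrite !mxE !eqxx mulr1.
by move=> j ji; rewrite !mxE eqxx/= eq_sym (negbTE ji) mulr0.
Qed.

End rV_facts.

(** * Gibbs measures and affine functions *)

Section continuity.
Context (R : realType) (T : topologicalType).
Implicit Types f g : T -> R.

Lemma continuous_add f g : continuous f -> continuous g ->
  continuous (fun x => f x + g x).
Proof. by move=> cf cg x; apply: cvgD; [exact: cf|exact: cg]. Qed.

Lemma continuous_sub f g : continuous f -> continuous g ->
  continuous (fun x => f x - g x).
Proof. by move=> cf cg x; apply: cvgB; [exact: cf|exact: cg]. Qed.

Lemma continuous_opp f : continuous f -> continuous (fun x => - f x).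
Proof. by move=> cf x; apply: cvgN; exact: cf. Qed.

Lemma continuous_mul f g : continuous f -> continuous g ->
  continuous (fun x => f x * g x).
Proof. by move=> cf cg x; apply: cvgM; [exact: cf|exact: cg]. Qed.

Lemma continuous_const (c : R) : continuous (fun _ : T => c).
Proof. by move=> x; exact: cvg_cst. Qed.

Lemma continuous_lcomp (g : R -> R) f : continuous g -> continuous f ->
  continuous (fun x => g (f x)).
Proof. by move=> cg cf x; apply: continuous_comp; [exact: cf|exact: cg]. Qed.

End continuity.

Section density_ibp.
Variable R : realType.
Local Open Scope ereal_scope.

(** [dV] is the derivative of - log [rho] along [a], so [psi' - psi * dV] times [rho] is the
    derivative of [psi * rho], whose Lebesgue integral vanishes. Serves the Gibbs measure with [dV]
    equal to ['D_a U] and the Gaussian with [dV] equal to [dotv a]. *)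
Lemma density_ibp n (m : {measure set 'rV[R]_n -> \bar R}) (rho dV psi psi' : 'rV[R]_n -> R)
    (a : 'rV[R]_n) :
  (forall x, 0 <= rho x)%R -> continuous rho -> continuous dV ->
  (forall A, measurable A -> m A = \int[leb n]_(x in A) (rho x)%:E) ->
  (forall x, is_derive x a rho (- dV x * rho x)%R) ->
  continuous psi -> continuous psi' -> (forall x, is_derive x a psi (psi' x)) ->
  m.-integrable setT (EFin \o psi) -> m.-integrable setT (EFin \o psi') ->
  m.-integrable setT (EFin \o (fun x => psi x * dV x)%R) ->
  \int[m]_x (psi' x)%:E = \int[m]_x (psi x * dV x)%:E.
Proof.
move=> r0 cr cV mE dr cp cp' dp ip ip' ipV.
have mr := continuous_measurable_rV cr.
have mp := continuous_measurable_rV cp.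
have mp' := continuous_measurable_rV cp'.
have mV := continuous_measurable_rV cV.
have mpV : measurable_fun setT (fun x => psi x * dV x)%R by exact: measurable_funM.
have f2 : \int[m]_x (psi x * dV x)%:E \is a fin_num by exact: integrable_fin_num.
suff E : \int[m]_x (psi' x)%:E - \int[m]_x (psi x * dV x)%:E = 0.
  by rewrite -[LHS](subeK _ f2) E add0e.
rewrite -integralB_EFin//.
under eq_integral do rewrite -EFinB.
rewrite (integral_density mr r0 mE); last exact: measurable_funB.
apply: (@leb_integral_derive_eq0 R n a (fun x => psi x * rho x)%R).
- move=> x; apply: (@is_derive_eq _ _ _ _ _ _ _ _ (is_derive_mul (dp x) (dr x))).
  by ring.
- by apply: continuous_mul => //; apply: continuous_sub => //; exact: continuous_mul.
- exact/(integrable_density mr r0 mE mp).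
- have := integrableB measurableT ip' ipV.
  by move/(integrable_density mr r0 mE (measurable_funB mp' mpV)).
Qed.

End density_ibp.

Section gibbs.
Variables (R : realType) (n : nat).
Local Notation X := 'rV[R]_n.
Variables (U : X -> R) (nu : probability X R).
Hypotheses (cU : continuous U)
  (iU : (leb n).-integrable setT (fun x => (expR (- U x))%:E)) (gU : gibbs U nu).

Lemma gibbs_density : exists2 c : R, 0 < c & forall A, measurable A ->
  (nu A = \int[leb n]_(x in A) (c * expR (- U x))%:E)%E.
Proof.
pose z := (\int[leb n]_x (expR (- U x))%:E)%E.
have zfin : z \is a fin_num by exact: integrable_fin_num.
have z0 : (0 <= z)%E by apply: integral_ge0 => x _; rewrite lee_fin expR_ge0.
have zn0 : z != 0%E.
  (* With a vanishing normalisation the quotient giving [nu setT] would be 0 instead of 1. *)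
  apply/eqP => ze; have := gU measurableT; rewrite -/z ze mul0e probability_setT.
  by move=> /eqP; rewrite onee_eq0.
have fz0 : 0 < fine z by rewrite fine_gt0// lt_neqAle eq_sym zn0 z0 ltey_eq zfin.
exists (fine z)^-1; first by rewrite invr_gt0.
move=> A mA; rewrite gU// -/z.
under [RHS]eq_integral do rewrite EFinM.
rewrite ge0_integralZl//; last 2 first.
- apply: measurable_funTS; apply/measurable_EFinP; apply: continuous_measurable_rV.
  exact: (continuous_lcomp (@continuous_expR R) (continuous_opp cU)).
- by rewrite lee_fin invr_ge0 ltW.
by rewrite muleC -[in LHS](fineK zfin) inver gt_eqF.
Qed.

End gibbs.

Section compactly_supported.
Variables (R : realType) (n : nat).
Local Notation X := 'rV[R]_n.

Lemma bounded_support_integrable (G : X -> R) (r : R) : 0 <= r -> continuous G ->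
  (forall x, r < `|x| -> G x = 0) -> (leb n).-integrable setT (EFin \o G).
Proof.
move=> r0 cG G0.
have cK : compact [set x : X | `|x| <= r].
  apply: bounded_closed_compact.
    exists r; split; first exact: num_real.
    by move=> y ry x /= xr; exact: le_trans xr (ltW ry).
  by apply: (@closed_comp _ _ (fun x : X => `|x|) [set y | y <= r]);
    [move=> x _; exact: norm_continuous|exact: closed_le].
have [M [_ GM]] : bounded_set (G @` [set x : X | `|x| <= r]).
  apply: (@compact_bounded R R^o); apply: continuous_compact => //.
  exact: continuous_subspaceT.
pose h (t : R) : R := \1_`[- r, r] t.
have ih : lebesgue_measure.-integrable setT (EFin \o h) by exact: integrable_indic_itv.
have mh : measurable_fun setT h by exact: measurable_indic.
have h0 t : 0 <= h t by rewrite /h indicE.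
pose C := `|M| + 1.
apply/integrableP; split; first by apply/measurable_EFinP; exact: continuous_measurable_rV.
apply: (@le_lt_trans _ _ (\int[leb n]_x (C%:E * (\prod_i h (x ord0 i))%:E)))%E; last first.
  have mp : measurable_fun setT (fun x : X => (\prod_i h (x ord0 i))%:E).
    apply/measurable_EFinP; apply: measurable_prod => i _.
    exact: (measurableT_comp mh (measurable_coord i)).
  have C0 : 0 <= C by rewrite addr_ge0.
  rewrite ge0_integralZl//; last first.
    by move=> x _; rewrite lee_fin prodr_ge0.
  rewrite lte_mul_pinfty//; exact: integral_leb_prod.
apply: ge0_le_integral_nomeas => // x; rewrite /= lee_fin.
have [xr|xr] := leP `|x| r.
  rewrite (_ : \prod_i _ = 1) ?mulr1.
    by apply: (GM C); [rewrite (le_lt_trans (ler_norm _))// ltrDl|exists x].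
  apply: big1 => i _; rewrite /h indicE mem_set//= in_itv/= -ler_norml.
  exact: le_trans (coord_le_norm x i) xr.
by rewrite G0// normr0 mulr_ge0 ?addr_ge0// prodr_ge0.
Qed.

(** The derivative of (a.x + b) phi is continuous with bounded support, so its integral vanishes.
    This opens the Poincare inequality to affine functions, with constant gradient [a]. *)
Lemma affine_weak_gradient (a : X) (b : R) :
  weak_gradient (fun x => dotv a x + b) (fun=> a).
Proof.
move=> phi i smooth supp.
have [r [_ hr]] := compact_bounded supp.
pose r1 := `|r| + 1.
have r10 : 0 <= r1 by rewrite addr_ge0.
have phi0 x : r1 < `|x| -> phi x = 0.
  move=> xr; apply/eqP; apply: contraTT xr => px; rewrite -leNgt.
  apply: (hr r1); first by rewrite (le_lt_trans (ler_norm _))// ltrDl.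
  exact: subset_closure.
have [cphi dphi] := smooth 1%N; have [dphi1 [cphi1 _]] := dphi (delta_mx ord0 i).
(* Derivatives are local, so the partial derivative vanishes on the open exterior of the ball, where
   [phi] is 0. *)
have dphi0 x : r1 < `|x| -> partial i phi x = 0.
  move=> xr; rewrite /partial (near_eq_derive (g := fun=> 0)).
    by apply: derive_val.
  have : open [set y : X | r1 < `|y|].
    by apply: (@open_comp _ _ (fun x : X => `|x|) [set y | r1 < y]);
      [move=> y _; exact: norm_continuous|exact: open_gt].
  by rewrite openE => /(_ x xr); apply: filterS => y /= /phi0.
have ca : continuous (fun x => dotv a x + b).
  by apply: continuous_add; [exact: continuous_dotv|exact: continuous_const].
have cfd : continuous (fun x => (dotv a x + b) * partial i phi x).
  exact: continuous_mul.
have cap : continuous (fun x => a ord0 i * phi x).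
  by apply: continuous_mul => //; exact: continuous_const.
have i1 : (leb n).-integrable setT (EFin \o (fun x => (dotv a x + b) * partial i phi x)).
  by apply: (@bounded_support_integrable _ r1) => // x /dphi0 ->; rewrite mulr0.
have i2 : (leb n).-integrable setT (EFin \o (fun x => a ord0 i * phi x)).
  by apply: (@bounded_support_integrable _ r1) => // x /phi0 ->; rewrite mulr0.
have := @leb_integral_derive_eq0 R n (delta_mx ord0 i) (fun x => (dotv a x + b) * phi x)
  (fun x => a ord0 i * phi x + (dotv a x + b) * partial i phi x).
have E : dotv a (delta_mx ord0 i) = a ord0 i.
  rewrite dotv_sumE (bigD1 i)//= big1 ?addr0; first by rewrite !mxE !eqxx mulr1.
  by move=> j ji; rewrite !mxE eqxx/= (negbTE ji) mulr0.
have H1 x : is_derive x (delta_mx ord0 i : X) (fun x => (dotv a x + b) * phi x)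
    (a ord0 i * phi x + (dotv a x + b) * partial i phi x).
  apply: is_derive_mul; last exact: derivableP.
  rewrite -E -[dotv a (delta_mx _ _)]addr0.
  exact: (is_deriveD (is_derive_dotv a x _) (is_derive_cst b x _)).
have H2 : continuous (fun x => a ord0 i * phi x + (dotv a x + b) * partial i phi x).
  exact: continuous_add.
have H3 : (leb n).-integrable setT (EFin \o (fun x => (dotv a x + b) * phi x)).
  apply: (@bounded_support_integrable _ r1) => //.
    exact: continuous_mul.
  by move=> x /phi0 ->; rewrite mulr0.
move=> /(_ H1 H2 H3 (integrableD measurableT i2 i1)) H.
have : \int[leb n]_x (a ord0 i * phi x) + \int[leb n]_x ((dotv a x + b) * partial i phi x) = 0.
  rewrite -RintegralD//; rewrite /Rintegral; move: H => ->//.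
by move/eqP; rewrite addr_eq0 => /eqP ->; rewrite opprK.
Qed.

End compactly_supported.

Section L2_facts.
Context d (T : measurableType d) (R : realType) (mu : probability T R).

Lemma L2_mul_integrable (f g : T -> R) : measurable_fun setT f -> measurable_fun setT g ->
  (L2norm mu f < +oo)%E -> (L2norm mu g < +oo)%E ->
  mu.-integrable setT (EFin \o (fun x => f x * g x)).
Proof.
move=> mf mg f2 g2; apply/Lfun1_integrable; apply: Lfun2_mul_Lfun1; exact/Lfun2P.
Qed.

Lemma L2_sqr_integrable (f : T -> R) : measurable_fun setT f -> (L2norm mu f < +oo)%E ->
  mu.-integrable setT (EFin \o (fun x => f x ^+ 2)).
Proof. by move=> mf f2; exact: L2_mul_integrable. Qed.

Lemma L2normE_fin (f : T -> R) : measurable_fun setT f -> (L2norm mu f < +oo)%E ->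
  L2norm mu f = (Num.sqrt (\int[mu]_x (f x ^+ 2)))%:E.
Proof.
move=> mf f2; rewrite L2normE /Rintegral.
have : (\int[mu]_x (f x ^+ 2)%:E)%E \is a fin_num.
  by apply: integrable_fin_num => //; exact: L2_sqr_integrable.
by move/fineK => {1}<-.
Qed.

End L2_facts.

Section poincare.
Variables (R : realType) (n : nat).
Local Notation X := 'rV[R]_n.
Variables (U : X -> R) (nu : probability X R).
Hypotheses (U_C2 : Ck 2 U)
  (iU : (leb n).-integrable setT (fun x => (expR (- U x))%:E)) (gU : gibbs U nu).

Lemma Ck_continuous k (V : normedModType R) (f : V -> R) : Ck k f -> continuous f.
Proof. by case: k => [|k] []. Qed.

Lemma partial_affine (a : X) (b : R) i x : partial i (fun x => dotv a x + b) x = a ord0 i.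
Proof.
have E : dotv a (delta_mx ord0 i) = a ord0 i.
  rewrite dotv_sumE (bigD1 i)//= big1 ?addr0; first by rewrite !mxE !eqxx mulr1.
  by move=> j ji; rewrite !mxE eqxx/= (negbTE ji) mulr0.
rewrite /partial -E -[RHS]addr0; apply: derive_val.
exact: (is_deriveD (is_derive_dotv a x _) (is_derive_cst b x _)).
Qed.

Lemma Lx_affine (a : X) (b : R) x :
  Lx U (fun x => dotv a x + b) x = - 'D_a U x.
Proof.
have C1 : Ck 1 U.
  have [cU dU] := U_C2; split => // v; split; first by have [] := dU v.
  by have [_ []] := dU v.
rewrite /Lx (derive_dotv_sum _ _ C1) /laplacian big1 ?addr0.
  congr (- _); rewrite /dotv; apply: eq_bigr => i _.
  by rewrite mulrC; congr (_ * _); rewrite mxE partial_affine.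
move=> i _; rewrite /partial.
under [X in 'D__ X _]funext do rewrite -/(partial i _ _) partial_affine.
exact: derive_val.
Qed.

Lemma continuous_derive_U (a : X) : continuous (fun x => 'D_a U x).
Proof. by have [_ /(_ a)[_ []]] := U_C2. Qed.

Lemma derivable_U (a x : X) : derivable U x a.
Proof. by have [_ /(_ a)[]] := U_C2. Qed.

Lemma continuous_affine (a : X) (b : R) : continuous (fun x => dotv a x + b).
Proof. by apply: continuous_add; [exact: continuous_dotv|exact: continuous_const]. Qed.

(** Integration by parts replaces ['D_a U] by the derivative of [f] along [a], which is the constant
    |a|^2, and [nu] has mass 1. *)
Lemma gibbs_ibp_affine (a : X) (b : R) :
  let f x := dotv a x + b in
  (L2norm nu f < +oo)%E -> (L2norm nu (fun x => 'D_a U x) < +oo)%E ->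
  \int[nu]_x (f x * 'D_a U x) = dotv a a.
Proof.
move=> f f2 D2; have cU := Ck_continuous U_C2.
have [c c0 nuE] := gibbs_density cU iU gU.
have cf : continuous f by exact: continuous_affine.
have mf := continuous_measurable_rV cf.
have cD := @continuous_derive_U a; have mD := continuous_measurable_rV cD.
have E : (\int[nu]_x (dotv a a)%:E = \int[nu]_x (f x * 'D_a U x)%:E)%E.
  apply: (@density_ibp R n nu (fun x => c * expR (- U x)) (fun x => 'D_a U x) f
    (fun=> dotv a a) a) => //.
  - by move=> x; rewrite mulr_ge0 ?expR_ge0// ltW.
  - apply: continuous_mul; first exact: continuous_const.
    exact: (continuous_lcomp (@continuous_expR R) (continuous_opp cU)).
  - move=> x; have dU := derivableP (@derivable_U a x).
    have dN : is_derive x a (fun x => - U x) (- 'D_a U x) := is_deriveN dU.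
    have H := is_derive_mul (is_derive_cst c x a)
      (@is_derive_chain R _ expR (fun x => - U x) x a _ _ (is_derive_expR _) dN).
    by apply: (@is_derive_eq _ _ _ _ _ _ _ _ H); rewrite /cst/=; ring.
  - exact: continuous_const.
  - move=> x; rewrite -[dotv a a]addr0.
    exact: (is_deriveD (is_derive_dotv a x _) (is_derive_cst b x _)).
  - apply: L2_integrable => //; first exact: probability_setT.
    by rewrite -L2norm_lty.
  - apply: (@bounded_integrable _ _ _ _ _ _ `|dotv a a|) => //; exact: probability_setT.
  - exact: L2_mul_integrable.
by rewrite /Rintegral -E integral_cst_prob//; exact: probability_setT.
Qed.

Lemma poincare_affine (m : R) (a : X) (b : R) :
  let f x := dotv a x + b in
  poincare nu m -> L02 nu f -> \int[nu]_x (f x ^+ 2) <= m^-1 * dotv a a.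
Proof.
move=> f pm f0.
have -> : dotv a a = \int[nu]_x (enorm a ^+ 2).
  rewrite Rintegral_cst//= probability_setT mulr1 /enorm sqr_sqrtr//.
  by apply: sumr_ge0 => i _; rewrite -expr2 sqr_ge0.
apply: (pm f (fun=> a)) => //; last exact: affine_weak_gradient.
by move=> i; exact: Lfun_cst.
Qed.

(* Rules out [mtilde = 0], for which [gamma%:E^-1 * mtilde] would be the junk
   value [+oo * 0 = 0] when [gamma = 0]. *)
Lemma mtilde_ge (m : R) : 0 < m -> poincare nu m -> (m%:E <= mtilde U nu)%E.
Proof.
move=> m0 pm; apply: le_ereal_inf_tmp => _ [f [[a [b fE]] f0 fn0 ->]].
have {fE}fE : f = (fun x => dotv a x + b) by apply/funext.
subst f; set f := (fun x => dotv a x + b) in f0 fn0 *.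
have [/Lfun2P[mf f2] _] := f0.
have LE : Lx U f = (fun x => - 'D_a U x) by apply/funext => x; exact: Lx_affine.
have cD := @continuous_derive_U a; have mD := continuous_measurable_rV cD.
have f0' : (0 < L2norm nu f)%E by rewrite lt_neqAle eq_sym fn0 L2norm_ge0.
have fE := L2normE_fin mf f2.
rewrite LE.
have -> : L2norm nu (fun x => - 'D_a U x) = L2norm nu (fun x => 'D_a U x).
  by rewrite !L2normE; congr sqrte; apply: eq_integral => x _; rewrite sqrrN.
have s0 : 0 < Num.sqrt (\int[nu]_x (f x ^+ 2)) by move: f0'; rewrite fE lte_fin.
rewrite fE inver gt_eqF// lee_pdivlMr//.
have [->|D2] := eqVneq (L2norm nu (fun x => 'D_a U x)) +oo%E; first exact: leey.
have {}D2 : (L2norm nu (fun x => 'D_a U x) < +oo)%E by rewrite ltey.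
rewrite (L2normE_fin mD D2) -EFinM lee_fin.
have A := gibbs_ibp_affine (b := b) f2 D2; rewrite -/f in A.
have B := poincare_affine pm f0; rewrite -/f in B.
set F := \int[nu]_x (f x ^+ 2) in B *.
set D := \int[nu]_x ('D_a U x ^+ 2).
have if2 := L2_sqr_integrable mf f2.
have iD2 := L2_sqr_integrable mD D2.
(* |a|^2 is the integral of f times ['D_a U], so expanding the square of f - m^-1 ['D_a U] gives 2
   |a|^2 <= m F + D / m. The Poincare inequality m F <= |a|^2 turns this into m |a|^2 <= D, hence
   m^2 F <= D. *)
have key : 2 * dotv a a <= m * F + m^-1 * D.
  have i1 : nu.-integrable setT (EFin \o (fun x => m * f x ^+ 2)).
    exact: (integrableZl measurableT m if2).
  have i2 : nu.-integrable setT (EFin \o (fun x => m^-1 * 'D_a U x ^+ 2)).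
    exact: (integrableZl measurableT m^-1 iD2).
  rewrite -A /F /D -(RintegralZl _ measurableT if2) -(RintegralZl _ measurableT iD2) -RintegralD//.
  rewrite -(RintegralZl _ measurableT (L2_mul_integrable mf mD f2 D2)).
  apply: le_Rintegral => //.
  - exact: (integrableZl measurableT 2 (L2_mul_integrable mf mD f2 D2)).
  - exact: (integrableD measurableT i1 i2).
  - move=> x _; rewrite -subr_ge0.
    have -> : m * f x ^+ 2 + m^-1 * 'D_a U x ^+ 2 - 2 * (f x * 'D_a U x) =
      m * (f x - m^-1 * 'D_a U x) ^+ 2 by field; rewrite gt_eqF.
    by rewrite mulr_ge0 ?sqr_ge0// ltW.
have B' : m * F <= dotv a a by move: B; rewrite -ler_pdivlMl ?invr_gt0// invrK.
have key2 : m * dotv a a <= D.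
  have : dotv a a <= m^-1 * D by lra.
  by rewrite -ler_pdivrMl ?invr_gt0// invrK.
have key3 : m ^+ 2 * F <= D.
  by apply: le_trans key2; rewrite expr2 -mulrA ler_wpM2l// ltW.
rewrite -[m](ger0_norm (ltW m0)) -sqrtr_sqr -sqrtrM ?sqr_ge0//.
by rewrite ler_wsqrtr.
Qed.

End poincare.

(** * Gaussian moments *)

Section gaussian.
Variables (R : realType) (n : nat).
Local Notation X := 'rV[R]_n.

Lemma is_derive_sqnorm (x a : X) :
  is_derive x a (fun v : X => dotv v v) (2 * dotv a x).
Proof.
apply: is_derive_of_line.
have -> : (fun s : R => dotv (x + s *: a) (x + s *: a)) =
    (fun s => (dotv x x + s * (2 * dotv a x)) + s * (s * dotv a a)).
  apply/funext => s; rewrite /dotv !mulr_sumr -!big_split/=; apply: eq_bigr => i _.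
  by rewrite !mxE; ring.
have H1 := is_derive_mulr_id (2 * dotv a x) 0.
have H2 := is_derive_mul (is_derive_id (0:R) 1) (is_derive_mulr_id (dotv a a) 0).
have H3 := is_deriveD (is_deriveD (is_derive_cst (dotv x x) (0:R) 1) H1) H2.
by apply: (@is_derive_eq _ _ _ _ _ _ _ _ H3); rewrite /cst/=; ring.
Qed.

Lemma continuous_sqnorm : continuous (fun v : X => dotv v v).
Proof.
apply: (continuous_big (op := +%R)); first exact: add_continuous.
by move=> i _; apply: continuous_mul; exact: continuous_coord.
Qed.

Lemma sqnorm_ge0 (v : X) : 0 <= dotv v v.
Proof. by apply: sumr_ge0 => i _; rewrite -expr2 sqr_ge0. Qed.

Lemma sqr_coord_le_sqnorm (v : X) i : v ord0 i ^+ 2 <= dotv v v.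
Proof.
rewrite /dotv (bigD1 i)//= expr2 lerDl.
by apply: sumr_ge0 => j _; rewrite -expr2 sqr_ge0.
Qed.

(** Cauchy-Schwarz, from the squared length of the component of [v] orthogonal to [a]. *)
Lemma sqr_dotv_le (a v : X) : dotv a v ^+ 2 <= dotv a a * dotv v v.
Proof.
have [a0|a0] := eqVneq (dotv a a) 0.
  have az i : a ord0 i = 0.
    apply/eqP; rewrite -sqrf_eq0 -[_ == 0]andbT; apply/andP; split => //.
    by rewrite eq_le sqr_ge0 andbT -a0 sqr_coord_le_sqnorm.
  rewrite a0 mul0r {1}/dotv big1 ?expr0n// => i _.
  by rewrite az mul0r.
have {}a0 : 0 < dotv a a by rewrite lt_neqAle eq_sym a0 sqnorm_ge0.
pose c := dotv a v / dotv a a.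
have : 0 <= dotv (v - c *: a) (v - c *: a) by exact: sqnorm_ge0.
have -> : dotv (v - c *: a) (v - c *: a) = dotv v v - 2 * c * dotv a v + c ^+ 2 * dotv a a.
  rewrite /dotv !mulr_sumr -sumrB -big_split/=; apply: eq_bigr => i _.
  by rewrite !mxE; ring.
rewrite /c => h.
have {h} : 0 <= dotv v v - dotv a v ^+ 2 / dotv a a.
  apply: le_trans h _; rewrite le_eqVlt; apply/orP; left; apply/eqP.
  by field; rewrite gt_eqF.
by rewrite subr_ge0 ler_pdivrMr// mulrC.
Qed.

Variable kappa : probability X R.
Hypothesis kg : std_gaussian kappa.

Let rho (v : X) : R := \prod_i normal_pdf 0 1 (v ord0 i).

Lemma gaussian_densityE : exists2 c : R, 0 < c &
  forall v, rho v = c * expR (- (dotv v v / 2)).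
Proof.
exists (\prod_(i < n) normal_peak 1).
  by apply: prodr_gt0 => i _; rewrite normal_peak_gt0// oner_neq0.
move=> v; rewrite /rho.
under eq_bigr do rewrite normal_pdfE ?oner_neq0//.
rewrite big_split/=; congr (_ * _).
rewrite -mulNr /dotv -sumrN mulr_suml -expR_sum.
by congr expR; apply: eq_bigr => i _; rewrite subr0 expr1n -expr2.
Qed.

Lemma gaussian_density_ge0 v : 0 <= rho v.
Proof. by apply: prodr_ge0 => i _; exact: normal_pdf_ge0. Qed.

Lemma continuous_gaussian_density : continuous rho.
Proof.
have [c _ rE] := gaussian_densityE.
have -> : rho = fun v => c * expR (- (dotv v v / 2)) by apply/funext.
apply: continuous_mul; first exact: continuous_const.
apply: (continuous_lcomp (@continuous_expR R)); apply: continuous_opp.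
by apply: continuous_mul; [exact: continuous_sqnorm|exact: continuous_const].
Qed.

Lemma is_derive_gaussian_density (x a : X) : is_derive x a rho (- dotv a x * rho x).
Proof.
have [c _ rE] := gaussian_densityE.
have E : rho = fun v => c * expR (- (dotv v v / 2)) by apply/funext.
rewrite E.
have H1 := is_deriveN (is_derive_mul (is_derive_sqnorm x a) (is_derive_cst (2^-1 : R) x a)).
have H2 := is_derive_mul (is_derive_cst c x a)
  (@is_derive_chain R _ expR (fun v => - (dotv v v / 2)) x a _ _ (is_derive_expR _) H1).
by apply: (@is_derive_eq _ _ _ _ _ _ _ _ H2); rewrite /cst/=; field.
Qed.

(** Up to a constant this is the normal density of variance 2. *)
Lemma integrable_expR_quarter :
  lebesgue_measure.-integrable setT (EFin \o (fun t : R => expR (- (t ^+ 2 / 4)))).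
Proof.
have s2 : Num.sqrt 2 != 0 :> R by rewrite gt_eqF// sqrtr_gt0.
have -> : (fun t : R => expR (- (t ^+ 2 / 4))) =
    fun t => (normal_peak (Num.sqrt 2))^-1 * normal_pdf 0 (Num.sqrt 2) t.
  apply/funext => t; rewrite normal_pdfE// mulKf ?gt_eqF ?normal_peak_gt0//.
  rewrite /normal_fun subr0 sqr_sqrtr// mulNr; congr (expR (- (_ / _))).
  by rewrite mulr2n; ring.
exact: (integrableZl measurableT _ (integrable_normal_pdf _ _)).
Qed.

(** Half of the Gaussian weight absorbs the growth: exp (- q / 2) is the square of exp (- q / 4);
    one factor compensates 1 + q^2, the other is an integrable product over the coordinates. *)
Lemma gaussian_integrable (psi : X -> R) (C : R) : measurable_fun setT psi ->
  (forall v, `|psi v| <= C * (1 + dotv v v ^+ 2)) ->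
  kappa.-integrable setT (EFin \o psi).
Proof.
move=> mpsi bnd.
have mr := continuous_measurable_rV continuous_gaussian_density.
apply/(integrable_density mr gaussian_density_ge0 kg mpsi).
have [c c0 rE] := gaussian_densityE.
have C0 : 0 <= C.
  have := bnd 0; rewrite [dotv 0 0]big1 => [|i _]; last by rewrite mxE mul0r.
  by rewrite expr0n addr0 mulr1; exact: le_trans.
pose h (t : R) := expR (- (t ^+ 2 / 4)).
have ch : continuous h.
  apply: (continuous_lcomp (@continuous_expR R)); apply: continuous_opp.
  by apply: continuous_mul; [exact: exprn_continuous|exact: continuous_const].
have mh : measurable_fun setT h by exact: continuous_measurable_fun.
have h0 t : 0 <= h t by exact: expR_ge0.
have hE (v : X) : \prod_i h (v ord0 i) = expR (- (dotv v v / 4)).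
  rewrite -mulNr /dotv -sumrN mulr_suml expR_sum; apply: eq_bigr => i _.
  by rewrite /h -expr2 mulNr.
have mp : measurable_fun setT (fun v : X => (\prod_i h (v ord0 i))%:E).
  apply/measurable_EFinP; apply: measurable_prod => i _.
  exact: (measurableT_comp mh (measurable_coord i)).
have ip : (leb n).-integrable setT (fun v : X => (\prod_i h (v ord0 i))%:E).
  apply/integrableP; split => //.
  under eq_integral do rewrite gee0_abs ?lee_fin ?prodr_ge0//.
  by apply: integral_leb_prod => //; exact: integrable_expR_quarter.
apply: (@le_integrable _ X R (leb n) setT measurableT
  (EFin \o (fun x => psi x * rho x)) (fun v : X => (C * c * 65)%:E * (\prod_i h (v ord0
    i))%:E)%E) => //.
- by apply/measurable_EFinP; exact: measurable_funM.
- move=> v _ /=; rewrite lee_fin hE rE normrM.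
  rewrite [`|c * _|]ger0_norm ?mulr_ge0 ?expR_ge0 ?(ltW c0)//.
  rewrite [leRHS]ger0_norm ?mulr_ge0 ?expR_ge0 ?(ltW c0)//.
  set q := dotv v v.
  have q0 : 0 <= q by exact: sqnorm_ge0.
  have -> : expR (- (q / 2)) = expR (- (q / 4)) * expR (- (q / 4)).
    by rewrite -expRD; congr expR; field.
  (* Squaring 1 + q / 8 <= exp (q / 8) bounds exp (q / 4) from below, and 65 (1 + q / 8)^2 dominates
     1 + q^2 because 65 exceeds 8^2. *)
  have key : (1 + q ^+ 2) * expR (- (q / 4)) <= 65.
    rewrite expRN -[leRHS]mulr1 -[X in _ <= _ * X](@mulVf _ (expR (q / 4))) ?gt_eqF ?expR_gt0//.
    rewrite mulrCA mulrC ler_wpM2l ?invr_ge0 ?expR_ge0//.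
    have e8 : 1 + q / 8 <= expR (q / 8) by exact: expR_ge1Dx.
    have -> : expR (q / 4) = expR (q / 8) ^+ 2.
      by rewrite expr2 -expRD; congr expR; field.
    have : (1 + q / 8) ^+ 2 <= expR (q / 8) ^+ 2.
      by rewrite lerXn2r ?nnegrE ?expR_ge0// addr_ge0// divr_ge0.
    move=> e64; have : 65 * (1 + q / 8) ^+ 2 <= 65 * expR (q / 8) ^+ 2 by rewrite ler_pM2l.
    apply: le_trans; nra.
  apply: (@le_trans _ _ (C * (1 + q ^+ 2) * (c * (expR (- (q / 4)) * expR (- (q / 4)))))).
    by rewrite ler_wpM2r// !mulr_ge0 ?expR_ge0// ltW.
  have -> : C * (1 + q ^+ 2) * (c * (expR (- (q / 4)) * expR (- (q / 4)))) =
    (C * c * expR (- (q / 4))) * ((1 + q ^+ 2) * expR (- (q / 4))) by ring.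
  have -> : C * c * 65 * expR (- (q / 4)) = (C * c * expR (- (q / 4))) * 65 by ring.
  by rewrite ler_wpM2l// !mulr_ge0 ?expR_ge0// ltW.
- exact: (integrableZl measurableT _ ip).
Qed.

Let gaussian_ibp (psi psi' : X -> R) (a : X) (C : R) :
  continuous psi -> continuous psi' -> (forall x, is_derive x a psi (psi' x)) ->
  (forall v, `|psi v| <= C * (1 + dotv v v ^+ 2)) ->
  (forall v, `|psi' v| <= C * (1 + dotv v v ^+ 2)) ->
  (forall v, `|psi v * dotv a v| <= C * (1 + dotv v v ^+ 2)) ->
  \int[kappa]_v (psi' v) = \int[kappa]_v (psi v * dotv a v).
Proof.
move=> cp cp' dp b1 b2 b3; rewrite /Rintegral; congr fine.
apply: (@density_ibp R n kappa rho (dotv a) psi psi' a) => //.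
- exact: gaussian_density_ge0.
- exact: continuous_gaussian_density.
- exact: continuous_dotv.
- by move=> x; apply: is_derive_gaussian_density.
- by apply: (gaussian_integrable _ b1); exact: continuous_measurable_rV.
- by apply: (gaussian_integrable _ b2); exact: continuous_measurable_rV.
- apply: (gaussian_integrable _ b3); apply: continuous_measurable_rV.
  by apply: continuous_mul => //; exact: continuous_dotv.
Qed.

Let sqr1 (t : R) : `|t| <= 1 + t ^+ 2.
Proof.
rewrite -[t ^+ 2]real_normK ?num_real//.
have := sqr_ge0 (`|t| - 1); have := normr_ge0 t; nra.
Qed.

Lemma abs_dotv_le (a v : X) : `|dotv a v| <= 1 + dotv a a * dotv v v.
Proof. by rewrite (le_trans (sqr1 _))// lerD2l; exact: sqr_dotv_le. Qed.

(** The case psi = 1 of the integration by parts; the higher moments below come from psi = v_i and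
    psi = v_i |v|^2. *)
Lemma gaussian_mean (a : X) : \int[kappa]_v dotv a v = 0.
Proof.
have aa := sqnorm_ge0 a.
have b v : `|dotv a v| <= (2 * (1 + dotv a a)) * (1 + dotv v v ^+ 2).
  apply: le_trans (abs_dotv_le a v) _.
  have := sqnorm_ge0 v; have := sqr_ge0 (dotv v v - 1); nra.
have b1 (v : X) : 1 <= (2 * (1 + dotv a a)) * (1 + dotv v v ^+ 2).
  have := sqr_ge0 (dotv v v); nra.
have := @gaussian_ibp (fun=> 1) (fun=> 0) a (2 * (1 + dotv a a)) (@continuous_const R X 1)
   (@continuous_const R X 0) (fun x => is_derive_cst _ x a).
rewrite Rintegral_cst// mul0r => H; rewrite (_ : \int[_]_v _ = \int[kappa]_v (1 * dotv a v)).
  rewrite -H// => v; rewrite ?normr1 ?normr0 ?mul1r//.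
  by rewrite (le_trans _ (b1 v)).
by congr fine; apply: eq_integral => v _; rewrite mul1r.
Qed.

Lemma dotv_delta (i : 'I_n) (v : X) : dotv (delta_mx ord0 i) v = v ord0 i.
Proof.
rewrite dotv_sumE (bigD1 i)//= big1 ?addr0; first by rewrite !mxE !eqxx mul1r.
by move=> j ji; rewrite !mxE eqxx/= (negbTE ji) mul0r.
Qed.

Lemma gaussian_sqr_coord i : \int[kappa]_v (v ord0 i ^+ 2) = 1.
Proof.
have := @gaussian_ibp (fun v => v ord0 i) (fun=> 1) (delta_mx ord0 i) 2
  (@continuous_coord R n i) (@continuous_const R X 1).
rewrite Rintegral_cst//= probability_setT mulr1 => H.
transitivity (\int[kappa]_v (v ord0 i * dotv (delta_mx ord0 i) v)).
  by congr fine; apply: eq_integral => v _; rewrite dotv_delta expr2.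
apply/esym/H.
- move=> x; have H1 := is_derive_dotv (delta_mx ord0 i) x (delta_mx ord0 i).
  rewrite dotv_delta !mxE !eqxx/= in H1.
  by under [X in is_derive _ _ X]funext do rewrite -dotv_delta.
- move=> v; have := sqr_coord_le_sqnorm v i; have := sqr1 (v ord0 i).
  have := sqr_ge0 (dotv v v - 1); have := sqr_ge0 (v ord0 i); nra.
- move=> v; rewrite normr1; have := sqr_ge0 (dotv v v); nra.
- move=> v; rewrite dotv_delta -expr2 ger0_norm ?sqr_ge0//.
  have := sqr_coord_le_sqnorm v i; have := sqr_ge0 (dotv v v - 1); nra.
Qed.

Lemma gaussian_sqnorm_integrable :
  kappa.-integrable setT (EFin \o (fun v : X => dotv v v)).
Proof.
apply: (@gaussian_integrable _ 1).
  exact: continuous_measurable_rV continuous_sqnorm.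
move=> v; rewrite mul1r ger0_norm ?sqnorm_ge0//.
have := sqnorm_ge0 v; have := sqr_ge0 (dotv v v - 1); nra.
Qed.

Lemma gaussian_sqnorm2_integrable :
  kappa.-integrable setT (EFin \o (fun v : X => dotv v v ^+ 2)).
Proof.
apply: (@gaussian_integrable _ 1).
  by apply: continuous_measurable_rV; apply: continuous_mul; exact: continuous_sqnorm.
by move=> v; rewrite mul1r ger0_norm ?sqr_ge0// lerDr.
Qed.

Lemma gaussian_sqr_coord_integrable i :
  kappa.-integrable setT (EFin \o (fun v : X => v ord0 i ^+ 2)).
Proof.
apply: (@gaussian_integrable _ 1).
  by apply: continuous_measurable_rV; apply: continuous_mul; exact: continuous_coord.
move=> v; rewrite mul1r ger0_norm ?sqr_ge0//.
have := sqr_coord_le_sqnorm v i; have := sqr_ge0 (dotv v v - 1); nra.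
Qed.

Lemma gaussian_sqnorm : \int[kappa]_v dotv v v = n%:R.
Proof.
transitivity (\int[kappa]_v (\sum_i v ord0 i ^+ 2)).
  by congr fine; apply: eq_integral => v _; congr EFin; apply: eq_bigr => i _; rewrite expr2.
rewrite (Rintegral_sum measurableT gaussian_sqr_coord_integrable).2.
by under eq_bigr do rewrite gaussian_sqr_coord; rewrite sumr_const card_ord.
Qed.

(** Taking psi = v_i |v|^2, the mean of v_i^2 |v|^2 equals that of |v|^2 + 2 v_i^2, namely n + 2;
    summing over the n coordinates gives the fourth moment. *)
Lemma gaussian_sqnorm2 : \int[kappa]_v (dotv v v ^+ 2) = n%:R * (n%:R + 2).
Proof.
have iq := gaussian_sqnorm_integrable.
have step i : \int[kappa]_v (v ord0 i ^+ 2 * dotv v v) = n%:R + 2.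
  have := @gaussian_ibp (fun v => v ord0 i * dotv v v)
    (fun v => dotv v v + 2 * v ord0 i ^+ 2) (delta_mx ord0 i) 3.
  have cq := continuous_sqnorm.
  have ci := @continuous_coord R n i.
  move=> /(_ (continuous_mul ci cq)) H.
  transitivity (\int[kappa]_v (v ord0 i * dotv v v * dotv (delta_mx ord0 i) v)).
    by congr fine; apply: eq_integral => v _; rewrite dotv_delta; congr EFin; ring.
  transitivity (\int[kappa]_v (dotv v v + 2 * v ord0 i ^+ 2)); last first.
    rewrite RintegralD//;
      last exact: (integrableZl measurableT _ (gaussian_sqr_coord_integrable i)).
    rewrite gaussian_sqnorm RintegralZl//; last exact: gaussian_sqr_coord_integrable.
    by rewrite gaussian_sqr_coord mulr1.
  apply/esym/H.
  - apply: continuous_add => //; apply: continuous_mul; first exact: continuous_const.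
    exact: continuous_mul.
  - move=> x; have H1 := is_derive_dotv (delta_mx ord0 i) x (delta_mx ord0 i).
    rewrite dotv_delta !mxE !eqxx/= in H1.
    have H2 := is_derive_mul H1 (is_derive_sqnorm x (delta_mx ord0 i)).
    rewrite !dotv_delta in H2.
    under [X in is_derive _ _ X]funext do rewrite -dotv_delta.
    by apply: (@is_derive_eq _ _ _ _ _ _ _ _ H2); ring.
  - move=> v; rewrite normrM [`|dotv v v|]ger0_norm ?sqnorm_ge0//.
    have := sqnorm_ge0 v; have := sqr_coord_le_sqnorm v i; have := sqr1 (v ord0 i).
    set t := `|_|; set q := dotv v v => h1 h2 h3.
    have : t * q <= (1 + q) * q by rewrite ler_wpM2r//; lra.
    have := sqr_ge0 (q - 1); nra.
  - move=> v; rewrite ger0_norm; last by rewrite addr_ge0 ?sqnorm_ge0// mulr_ge0// sqr_ge0.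
    have := sqr_coord_le_sqnorm v i; have := sqr_ge0 (dotv v v - 1); nra.
  - move=> v; rewrite dotv_delta.
    have -> : v ord0 i * dotv v v * v ord0 i = v ord0 i ^+ 2 * dotv v v by ring.
    rewrite ger0_norm; last by apply: mulr_ge0; [exact: sqr_ge0|exact: sqnorm_ge0].
    have := sqr_coord_le_sqnorm v i; have := sqnorm_ge0 v; have := sqr_ge0 (v ord0 i); nra.
transitivity (\int[kappa]_v (\sum_i v ord0 i ^+ 2 * dotv v v)).
  congr fine; apply: eq_integral => v _; congr EFin; rewrite expr2 {1}/dotv mulr_suml.
  by apply: eq_bigr => i _; rewrite expr2.
rewrite (Rintegral_sum measurableT _).2.
  by under eq_bigr do rewrite step; rewrite sumr_const card_ord mulr_natl.
move=> i; apply: (@gaussian_integrable _ 1).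
  by apply: continuous_measurable_rV; apply: continuous_mul;
    [apply: continuous_mul; exact: continuous_coord|exact: continuous_sqnorm].
move=> v; rewrite mul1r ger0_norm; last by apply: mulr_ge0; [exact: sqr_ge0|exact: sqnorm_ge0].
have := sqr_coord_le_sqnorm v i; have := sqnorm_ge0 v; have := sqr_ge0 (v ord0 i); nra.
Qed.

End gaussian.

(** * Truncated energy *)

Section cutoff.
Variable R : realType.
Implicit Types y s h : R.

(** A second order remainder controls both sides of [y] at once; the square of the positive part is
    thereby differentiated at its junction 0 as well. *)
Lemma is_derive_quadratic (f : R -> R) (y d C : R) :
  (forall h, `|f (y + h) - f y - d * h| <= C * h ^+ 2) -> is_derive y 1 f d.
Proof.
move=> bnd.
have E : (fun h : R => h^-1 *: ((f \o shift y) (h *: (1:R)) - f y)) @ 0^' --> d.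
  apply/cvgrPdist_le => e e0.
  have C1 : 0 < `|C| + 1 by rewrite ltr_wpDl.
  exists (e / (`|C| + 1)); first by rewrite /= divr_gt0.
  move=> h /=; rewrite sub0r normrN => he hn0.
  have -> : d - h^-1 *: (f (h *: 1 + y) - f y) = - (h^-1 * (f (y + h) - f y - d * h)).
    rewrite [h *: 1]mulr1 [h + y]addrC.
    rewrite -[h^-1 *: _]/(h^-1 * (f (y + h) - f y)) [in RHS]mulrBr mulrCA mulVf// mulr1.
    by rewrite opprB.
  rewrite normrN normrM normfV ler_pdivrMl ?normr_gt0//.
  apply: le_trans (bnd h) _.
  rewrite -[h ^+ 2]real_normK ?num_real// expr2 mulrA mulrC.
  rewrite ler_wpM2l//; apply: (@le_trans _ _ ((`|C| + 1) * `|h|)).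
    by rewrite ler_wpM2r// (le_trans (ler_norm _))// lerDl.
  by rewrite -ler_pdivlMl// mulrC ltW.
by split; [apply/cvg_ex; exists d|apply/cvg_lim].
Qed.

Definition posp y := Num.max 0 y.

Lemma posp_sqr y : posp y ^+ 2 = posp y * y.
Proof. by rewrite /posp; case: ltP => // _; rewrite expr0n mul0r. Qed.

Lemma continuous_posp : continuous posp.
Proof.
by move=> y; apply: (@continuous_max R R (fun=> 0) idfun y); [exact: cvg_cst|exact: cvg_id].
Qed.

Lemma is_derive_posp2 y : is_derive y 1 (fun y => posp y ^+ 2) (2 * posp y).
Proof.
apply: (@is_derive_quadratic _ _ _ 1) => h; rewrite mul1r ler_norml /posp.
have := sqr_ge0 (y + h); have := sqr_ge0 y; have := sqr_ge0 h.
case: (ltP 0 (y + h)) => h1; case: (ltP 0 y) => h2; rewrite ?expr0n/= => *; apply/andP; split; nra.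
Qed.

(* [s * max(0, 1 - s)^3], a C^2 function equal to [s + O(s^2)] at 0 and
   vanishing on [1, +oo[; [cutG1] and [cutG2] are its two derivatives. *)
Definition cutG s := s * (posp (1 - s) ^+ 2 * (1 - s)).
Definition cutG1 s := posp (1 - s) ^+ 2 * (1 - s) - 3 * s * posp (1 - s) ^+ 2.
Definition cutG2 s := 6 * s * posp (1 - s) - 6 * posp (1 - s) ^+ 2.

Lemma is_derive_1sub s : is_derive s (1 : R) (fun s : R => 1 - s) (- 1).
Proof.
apply: (@is_derive_eq _ _ _ _ _ _ _ _ (is_deriveB (is_derive_cst (1:R) s 1) (is_derive_id s 1))).
by rewrite sub0r.
Qed.

Lemma is_derive_posp2_1sub s :
  is_derive s 1 (fun s => posp (1 - s) ^+ 2) (- 2 * posp (1 - s)).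
Proof.
have := @is_derive1_comp _ (fun y => posp y ^+ 2) (fun s => 1 - s) s _ _
  (is_derive_posp2 (1 - s)) (is_derive_1sub s).
by move=> H; apply: (@is_derive_eq _ _ _ _ _ _ _ _ H); ring.
Qed.

Lemma is_derive_cutG s : is_derive s 1 cutG (cutG1 s).
Proof.
have H := is_derive_mul (is_derive_id s 1)
  (is_derive_mul (is_derive_posp2_1sub s) (is_derive_1sub s)).
apply: (@is_derive_eq _ _ _ _ _ _ _ _ H); rewrite /cutG1.
have -> : - 2 * posp (1 - s) * (1 - s) = - 2 * posp (1 - s) ^+ 2 by rewrite posp_sqr; ring.
ring.
Qed.

Lemma is_derive_cutG1 s : is_derive s 1 cutG1 (cutG2 s).
Proof.
have H1 := is_derive_mul (is_derive_posp2_1sub s) (is_derive_1sub s).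
have H2 := is_derive_mul (is_derive_mul (is_derive_cst (3:R) s 1) (is_derive_id s 1))
   (is_derive_posp2_1sub s).
apply: (@is_derive_eq _ _ _ _ _ _ _ _ (is_deriveB H1 H2)); rewrite /cutG2 /cst/=.
have -> : - 2 * posp (1 - s) * (1 - s) = - 2 * posp (1 - s) ^+ 2 by rewrite posp_sqr; ring.
ring.
Qed.

Lemma continuous_1sub : continuous (fun s : R => 1 - s).
Proof. by apply: continuous_sub; [exact: continuous_const|move=> x; exact: cvg_id]. Qed.

Lemma continuous_posp1 : continuous (fun s : R => posp (1 - s)).
Proof. exact: (continuous_lcomp continuous_posp continuous_1sub). Qed.

Lemma continuous_cutG1 : continuous cutG1.
Proof.
have c1 := continuous_posp1; have c2 := continuous_1sub.
apply: continuous_sub; apply: continuous_mul => //; try exact: continuous_mul.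
by apply: continuous_mul; [exact: continuous_const|move=> x; exact: cvg_id].
Qed.

Lemma continuous_cutG2 : continuous cutG2.
Proof.
have c1 := continuous_posp1; have c2 := continuous_1sub.
apply: continuous_sub; apply: continuous_mul => //; try exact: continuous_mul;
  try exact: continuous_const.
by apply: continuous_mul; [exact: continuous_const|move=> x; exact: cvg_id].
Qed.

(** Only s >= 0 occurs, since the argument will be a scaled energy above a lower bound of [U]. For s
    > 1 the positive part vanishes, and for s in [0, 1] all factors lie in [0, 1]. *)
Lemma cut_bounds s : 0 <= s -> [/\ 0 <= posp (1 - s) <= 1, 0 <= s * posp (1 - s) <= 1
   & 0 <= posp (1 - s) ^+ 2 * (1 - s) <= 1].
Proof.
move=> s0; rewrite /posp; have [h|h] := leP (1 - s) 0.
  by rewrite expr0n/= mul0r mulr0 !lexx ler01.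
have t1 : 0 <= 1 - s <= 1 by apply/andP; split; lra.
have t2 : 0 <= (1 - s) ^+ 2 <= 1 by rewrite exprn_ge0 ?(ltW h)//= exprn_ile1//; lra.
move/andP: t1 t2 => [a b] /andP[c e].
split; [by rewrite a|by apply/andP; split; nra|apply/andP; split; nra].
Qed.

Lemma cutG1_bound s : 0 <= s -> `|cutG1 s| <= 4.
Proof.
move=> /cut_bounds[/andP[a b] /andP[c d] /andP[e f]]; rewrite /cutG1.
have : 0 <= s * posp (1 - s) * posp (1 - s) <= 1 by apply/andP; split; nra.
rewrite expr2 in e f *; move=> /andP[g h].
have -> : 3 * s * (posp (1 - s) * posp (1 - s)) = 3 * (s * posp (1 - s) * posp (1 - s)) by ring.
by rewrite ler_norml; apply/andP; split; lra.
Qed.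

Lemma cutG2_bound s : 0 <= s -> `|cutG2 s| <= 12.
Proof.
move=> /cut_bounds[/andP[a b] /andP[c d] /andP[e f]]; rewrite /cutG2.
have : 0 <= posp (1 - s) ^+ 2 <= 1 by apply/andP; split; nra.
move=> /andP[g h]; rewrite ler_norml -!mulrA; apply/andP; split; lra.
Qed.

Lemma cutG_bound s : 0 <= s -> `|cutG s| <= 1.
Proof.
move=> s0; have [/andP[a b] /andP[c d] /andP[e f]] := cut_bounds s0; rewrite /cutG.
rewrite posp_sqr in e f *.
have [h|h] := leP 1 s.
  by rewrite /posp max_l ?subr_le0// !mul0r mulr0 normr0.
by rewrite normrM [`|s|]ger0_norm// [`|_ * _|]ger0_norm//; nra.
Qed.

Lemma cutG_gt1 s : 1 <= s -> cutG s = 0.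
Proof. by move=> h; rewrite /cutG /posp max_l ?subr_le0// expr0n/= mul0r mulr0. Qed.

Lemma cutG_lipschitz s t : 0 <= s -> s <= t -> `|cutG t - cutG s| <= 4 * (t - s).
Proof.
move=> s0; rewrite le_eqVlt => /predU1P[->|st]; first by rewrite !subrr normr0 mulr0.
have cG : continuous cutG.
  move=> x; apply: differentiable_continuous; apply/derivable1_diffP.
  by case: (is_derive_cutG x).
have [c] := @MVT _ cutG cutG1 s t st (fun x _ => is_derive_cutG x) (continuous_subspaceT cG).
rewrite in_itv/= => /andP[sc _] ->; rewrite normrM [`|t - s|]gtr0_norm ?subr_gt0//.
by rewrite ler_wpM2r ?subr_ge0 ?(ltW st)// cutG1_bound// (le_trans s0)// ltW.
Qed.

End cutoff.

Lemma Ck2_intro (R : realType) (V : normedModType R) (f : V -> R) (f1 : V -> V -> R)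
    (f2 : V -> V -> V -> R) :
  continuous f -> (forall v z, is_derive z v f (f1 v z)) ->
  (forall v, continuous (f1 v)) -> (forall v w z, is_derive z w (f1 v) (f2 v w z)) ->
  (forall v w, continuous (f2 v w)) -> Ck 2 f.
Proof.
move=> cf d1 c1 d2 c2; split=> // v.
have E1 : (fun x => 'D_v f x) = f1 v by apply/funext => x; exact: derive_val.
split; first by move=> x; case: (d1 v x).
rewrite E1; split=> // w.
have E2 : (fun x => 'D_w (f1 v) x) = f2 v w by apply/funext => x; exact: derive_val.
split; first by move=> x; case: (d2 v w x).
by rewrite E2; split.
Qed.

Section energy.
Variables (R : realType) (n : nat).
Local Notation X := 'rV[R]_n.
Local Notation S := ('rV[R]_n * 'rV[R]_n)%type.
Variable U : X -> R.
Hypothesis U_C2 : Ck 2 U.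

Definition energy (z : S) : R := U z.1 + dotv z.2 z.2 / 2.

Lemma continuous_fst_comp (f : X -> R) : continuous f -> continuous (fun z : S => f z.1).
Proof. by move=> cf z; apply: continuous_comp; [exact: cvg_fst|exact: cf]. Qed.

Lemma continuous_snd_comp (f : X -> R) : continuous f -> continuous (fun z : S => f z.2).
Proof. by move=> cf z; apply: continuous_comp; [exact: cvg_snd|exact: cf]. Qed.

Lemma is_derive_fst_comp (f : X -> R) (z v : S) l : is_derive z.1 v.1 f l ->
  is_derive z v (fun z => f z.1) l.
Proof. by case=> d <-; split. Qed.

Lemma is_derive_snd_comp (f : X -> R) (z v : S) l : is_derive z.2 v.2 f l ->
  is_derive z v (fun z => f z.2) l.
Proof. by case=> d <-; split. Qed.

Let U1 v x : derivable U x v. Proof. by case: U_C2 => _ /(_ v)[]. Qed.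

Let cU1 v : continuous (fun x => 'D_v U x).
Proof. by case: U_C2 => _ /(_ v)[_ []]. Qed.

Let U2 v w x : derivable (fun x => 'D_v U x) x w.
Proof. by case: U_C2 => _ /(_ v)[_ [_ /(_ w)[]]]. Qed.

Let cU2 v w : continuous (fun x => 'D_w (fun x => 'D_v U x) x).
Proof. by case: U_C2 => _ /(_ v)[_ [_ /(_ w)[_ []]]]. Qed.

Let cU : continuous U. Proof. by case: U_C2. Qed.

Lemma continuous_energy : continuous energy.
Proof.
apply: continuous_add; first exact: continuous_fst_comp.
apply: continuous_mul; last exact: continuous_const.
by apply: (@continuous_snd_comp (fun v => dotv v v)); exact: continuous_sqnorm.
Qed.

Let dH (v z : S) : R := 'D_(v.1) U z.1 + dotv v.2 z.2.

Let cdH v : continuous (dH v).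
Proof.
apply: continuous_add; first exact: (continuous_fst_comp (cU1 (v:=v.1))).
by apply: continuous_snd_comp; exact: continuous_dotv.
Qed.

Lemma is_derive_energy (v z : S) :
  is_derive z v energy ('D_(v.1) U z.1 + dotv v.2 z.2).
Proof.
have d1 : is_derive z.1 v.1 U ('D_(v.1) U z.1) by apply: DeriveDef.
have d2 := is_derive_fst_comp d1.
have d3 := is_derive_snd_comp (is_derive_sqnorm z.2 v.2).
have d4 := is_derive_mul d3 (is_derive_cst (2^-1 : R) z v).
apply: (@is_derive_eq _ _ _ _ _ _ _ _ (is_deriveD d2 d4)).
by rewrite /cst/=; field.
Qed.

Variables g g1 g2 : R -> R.
Hypotheses (dg : forall s : R, is_derive s (1 : R) g (g1 s)) (dg1 : forall s : R, is_derive s (1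
  : R) g1 (g2 s))
  (cg2 : continuous g2).

Let cg : continuous g.
Proof. by move=> x; apply/differentiable_continuous/derivable1_diffP; case: (dg x). Qed.

Let cg1 : continuous g1.
Proof. by move=> x; apply/differentiable_continuous/derivable1_diffP; case: (dg1 x). Qed.

Lemma Ck2_energy : Ck 2 (fun z => g (energy z)).
Proof.
apply: (@Ck2_intro _ _ _ (fun v z => g1 (energy z) * dH v z)
  (fun v w z => g2 (energy z) * dH w z * dH v z +
     g1 (energy z) * ('D_(w.1) (fun x => 'D_(v.1) U x) z.1 + dotv v.2 w.2))).
- exact: (continuous_lcomp cg continuous_energy).
- by move=> v z; apply: is_derive_chain => //; exact: is_derive_energy.
- move=> v; apply: continuous_mul => //; exact: (continuous_lcomp cg1 continuous_energy).
- move=> v w z; apply: is_derive_mul.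
    by apply: is_derive_chain => //; exact: is_derive_energy.
  have d1 : is_derive z.1 w.1 (fun x => 'D_(v.1) U x) ('D_(w.1) (fun x => 'D_(v.1) U x) z.1).
    by apply: DeriveDef => //; exact: U2.
  exact: (is_deriveD (is_derive_fst_comp d1) (is_derive_snd_comp (is_derive_dotv v.2 z.2 w.2))).
- move=> v w; apply: continuous_add; apply: continuous_mul => //.
  + by apply: continuous_mul => //; exact: (continuous_lcomp cg2 continuous_energy).
  + exact: (continuous_lcomp cg1 continuous_energy).
  + apply: continuous_add; last exact: continuous_const.
    exact: (continuous_fst_comp (@cU2 v.1 w.1)).
Qed.

(** Both halves of the Hamiltonian part equal [g1] times v.grad U and cancel. In [Lv], the drift
    gives - [g1] |v|^2, and the Laplacian gives n [g1] + [g2] |v|^2. *)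
Lemma langevin_op_energy (gamma : R) (z : S) :
  langevin_op U 0 gamma (fun z => g (energy z)) z =
  gamma * (g1 (energy z) * (n%:R - dotv z.2 z.2) + g2 (energy z) * dotv z.2 z.2).
Proof.
case: z => x v /=.
have Dx (y a : X) : is_derive y a (fun y => g (energy (y, v))) (g1 (energy (y, v)) * 'D_a U y).
  apply: (is_derive_chain (dg _)) => /=.
  have d1 : is_derive y a U ('D_a U y) by apply: DeriveDef.
  apply: (@is_derive_eq _ _ _ _ _ _ _ _ (is_deriveD d1 (is_derive_cst (dotv v v / 2) y a))).
  by rewrite addr0.
have DE (u a : X) : is_derive u a (fun u => energy (x, u)) (dotv a u).
  have d4 := is_derive_mul (is_derive_sqnorm u a) (is_derive_cst (2^-1 : R) u a).
  apply: (@is_derive_eq _ _ _ _ _ _ _ _ (is_deriveD (is_derive_cst (U x) u a) d4)).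
  by rewrite /cst/=; field.
have Dv (u a : X) : is_derive u a (fun u => g (energy (x, u))) (g1 (energy (x, u)) * dotv a u).
  exact: (is_derive_chain (dg _) (DE u a)).
have D2 (u : X) i : is_derive u (delta_mx ord0 i) (fun u => g1 (energy (x, u)) * u ord0 i)
    (g2 (energy (x, u)) * u ord0 i ^+ 2 + g1 (energy (x, u))).
  have d1 := is_derive_dotv (delta_mx ord0 i) u (delta_mx ord0 i).
  have e : dotv (delta_mx ord0 i) = (fun u : X => u ord0 i).
    by apply/funext => w; rewrite dotv_delta.
  rewrite dotv_delta mxE !eqxx/= e in d1.
  have d2 := is_derive_mul (is_derive_chain (dg1 _) (DE u (delta_mx ord0 i))) d1.
  apply: (@is_derive_eq _ _ _ _ _ _ _ _ d2); rewrite dotv_delta /=; ring.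
rewrite /langevin_op /hamiltonian_op /Lv mul0r addr0 /=.
have -> : grad (fun x0 => g (energy (x0, v))) x = g1 (energy (x, v)) *: grad U x.
  apply/rowP => i; rewrite !mxE /partial; exact: derive_val.
have E1 i u : partial i (fun u => g (energy (x, u))) u = g1 (energy (x, u)) * u ord0 i.
  by rewrite -[u ord0 i]dotv_delta; exact: derive_val.
have -> : grad (fun v0 => g (energy (x, v0))) v = g1 (energy (x, v)) *: v.
  by apply/rowP => i; rewrite !mxE E1.
have -> : laplacian (fun v0 => g (energy (x, v0))) v =
    g2 (energy (x, v)) * dotv v v + n%:R * g1 (energy (x, v)).
  rewrite /laplacian;
    transitivity (\sum_i (g2 (energy (x, v)) * v ord0 i ^+ 2 + g1 (energy (x, v)))).
    apply: eq_bigr => i _.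
    have -> : partial i (fun u => g (energy (x, u))) = (fun u => g1 (energy (x, u)) * u ord0 i).
      by apply/funext => u; exact: E1.
    exact: derive_val.
  rewrite big_split/= -mulr_sumr sumr_const card_ord mulr_natl; congr (_ * _ + _).
rewrite /dotv.
have -> : \sum_i v ord0 i * (g1 (energy (x, v)) *: grad U x) ord0 i =
   \sum_i grad U x ord0 i * (g1 (energy (x, v)) *: v) ord0 i.
  by apply: eq_bigr => i _; rewrite !mxE; ring.
have -> : \sum_i v ord0 i * (g1 (energy (x, v)) *: v) ord0 i =
   g1 (energy (x, v)) * \sum_i v ord0 i * v ord0 i.
  by rewrite mulr_sumr; apply: eq_bigr => i _; rewrite !mxE; ring.
ring.
Qed.

Variable (U_infty : forall M : R, exists r : R, forall x, r < enorm x -> M < U x).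

(** Compactness is expressed in the sup norm, the growth of [U] in the Euclidean length. *)
Lemma norm_le_enorm (x : X) : `|x| <= enorm x.
Proof.
rewrite /enorm [leLHS]mx_normrE; apply/bigmax_leP; split; first exact: sqrtr_ge0.
move=> [i j] _ /=; rewrite -sqrtr_sqr ler_wsqrtr// (ord1 i).
exact: sqr_coord_le_sqnorm.
Qed.

Lemma compact_norm_ball (r : R) : compact [set x : X | `|x| <= r].
Proof.
apply: bounded_closed_compact.
  exists r; split; first by rewrite num_real.
  by move=> M rM x /= /le_trans; apply; exact: ltW.
rewrite (_ : [set _ | _] = (fun x : X => `|x|) @^-1` [set y : R | y <= r])//.
apply: closed_comp; last exact: closed_le.
by move=> x _; exact: norm_continuous.
Qed.

Lemma potential_lower_bound : exists c : R, forall x, c <= U x.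
Proof.
have [r Hr] := U_infty 0.
have [x0 _ Hm] : exists2 c, c \in [set x : X | `|x| <= `|r|] &
    forall t, t \in [set x : X | `|x| <= `|r|] -> U c <= U t.
  apply: (@compact_EVT_min _ _ U [set x : X | `|x| <= `|r|]).
  - by exists 0; rewrite /= normr0.
  - exact: compact_norm_ball.
  - exact: continuous_subspaceT.
(* [U x0] is the minimum over a compact ball containing the Euclidean ball of radius [r]; beyond
   that radius [U] is positive. *)
exists (Num.min (U x0) 0) => x; rewrite ge_min.
have [h|h] := leP (enorm x) r; last by rewrite [X in _ || X]ltW ?orbT ?Hr.
rewrite Hm// inE/=; apply: le_trans (norm_le_enorm x) _.
exact: le_trans h (ler_norm r).
Qed.

(** Sublevel sets of the energy are bounded: U <= K bounds x because [U] tends to infinity, and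
    |v|^2 <= 2 (K - c0) bounds v, with [c0] a lower bound of [U]. *)
Lemma compact_support_energy (K : R) : (forall s, K < s -> g s = 0) ->
  compact_support (fun z => g (energy z)).
Proof.
move=> gK; have [c0 Uc] := potential_lower_bound.
have [r Hr] := U_infty K.
pose r2 := (2 * (K - c0) + 1).
pose C := [set x : X | `|x| <= r] `*` [set v : X | `|v| <= Num.sqrt r2].
have cC : compact C by apply: compact_setX; exact: compact_norm_ball.
apply: (@subclosed_compact _ _ C) => //; first exact: closed_closure.
have clC : closed C by apply: compact_closed => //; exact: norm_hausdorff.
rewrite [X in _ `<=` X](closure_id C).1//; apply: closure_subset => -[x v] /= gn0.
have HK : energy (x, v) <= K.
  by rewrite leNgt; apply/negP => /gK; exact/eqP.
have q0 := sqnorm_ge0 v; have := Uc x; move: HK; rewrite /energy/= => HK Ux.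
split => /=.
  apply: le_trans (norm_le_enorm x) _; rewrite leNgt; apply/negP => /Hr h.
  by lra.
apply: le_trans (norm_le_enorm v) _; rewrite /enorm ler_wsqrtr// /r2; lra.
Qed.

End energy.

(** * Dominated convergence and product measures *)

Section Rintegral_limits.
Context d (T : measurableType d) (R : realType) (mu : {measure set T -> \bar R}).

Lemma Rintegral_dominated (f_ : nat -> T -> R) (f h : T -> R) :
  (forall n, measurable_fun setT (f_ n)) -> measurable_fun setT f ->
  {ae mu, forall x, f_ ^~ x @ \oo --> f x} ->
  mu.-integrable setT (EFin \o h) ->
  {ae mu, forall x, forall n, `|f_ n x| <= h x} ->
  \int[mu]_x f_ n x @[n --> \oo] --> \int[mu]_x f x.
Proof.
move=> mf_ mf cf hi dom.
have cf' : {ae mu, forall x, [set: T] x -> (EFin (f_ n x)) @[n --> \oo] --> (f x)%:E}.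
  by apply: filterS cf => x H _; apply: cvg_EFin => //; exact: nearW.
have dom' : {ae mu, forall x n, [set: T] x -> (`|(f_ n x)%:E| <= (h x)%:E)%E}.
  by apply: filterS dom => x H n _ /=; rewrite lee_fin.
have mf_' n : measurable_fun setT (EFin \o f_ n) by exact/measurable_EFinP.
have mf' : measurable_fun setT (EFin \o f) by exact/measurable_EFinP.
have [fi _ cvi] := dominated_convergence measurableT mf_' mf' cf' hi dom'.
apply: fine_cvg; rewrite fineK//; exact: integrable_fin_num.
Qed.

End Rintegral_limits.

Section product.
Context d1 d2 (X : measurableType d1) (Y : measurableType d2) (R : realType).
Variables (nu : probability X R) (kappa : probability Y R).
Local Notation mu := (nu \x kappa)%E.

Lemma product_integrable (a : X -> R) (b : Y -> R) :
  nu.-integrable setT (EFin \o a) -> kappa.-integrable setT (EFin \o b) ->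
  mu.-integrable setT (EFin \o (fun z => a z.1 * b z.2)).
Proof.
move=> /integrableP[ma ia] /integrableP[mb ib].
have mab : measurable_fun setT (fun z : X * Y => a z.1 * b z.2).
  apply: measurable_funM.
    by apply: (measurableT_comp _ measurable_fst); exact/measurable_EFinP.
  by apply: (measurableT_comp _ measurable_snd); exact/measurable_EFinP.
apply/integrableP; split; first exact/measurable_EFinP.
rewrite fubini_tonelli1//; last by apply: measurableT_comp => //; exact/measurable_EFinP.
rewrite (eq_integral (fun x => (`|(EFin \o a) x| * \int[kappa]_y `|(EFin \o b) y|)%E)).
  have bf : (\int[kappa]_y `|(EFin \o b) y|)%E \is a fin_num.
    by rewrite ge0_fin_numE// integral_ge0.
  rewrite -(fineK bf) ge0_integralZr//; last 2 first.
  - by apply: measurableT_comp.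
  - by rewrite fineK// integral_ge0.
  by rewrite lte_mul_pinfty ?ltry ?integral_ge0// ge0_fin_numE ?integral_ge0.
move=> x _; rewrite /fubini_F -ge0_integralZl//; last by apply: measurableT_comp.
by apply: eq_integral => y _ /=; rewrite normrM EFinM.
Qed.

Lemma product_integral (a : X -> R) (b : Y -> R) :
  nu.-integrable setT (EFin \o a) -> kappa.-integrable setT (EFin \o b) ->
  \int[mu]_z (a z.1 * b z.2) = (\int[nu]_x a x) * \int[kappa]_y b y.
Proof.
move=> ia ib; rewrite {1}/Rintegral -integral12_prod_meas1; last exact: product_integrable.
transitivity (\int[nu]_x (a x * \int[kappa]_y b y)); last by rewrite RintegralZr.
congr fine; apply: eq_integral => x _; rewrite /fubini_F/=.
under eq_integral do rewrite EFinM.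
rewrite [LHS](integralZl measurableT ib) EFinM; congr (_ * _)%E.
by rewrite /Rintegral fineK//; exact: integrable_fin_num.
Qed.

Lemma fst_integrable (a : X -> R) : nu.-integrable setT (EFin \o a) ->
  mu.-integrable setT (EFin \o (fun z => a z.1)).
Proof.
move=> ia; have := product_integrable ia (@bounded_integrable _ _ _ kappa (probability_setT _)
  (fun=> 1) 1
  (measurable_cst _) (fun=> ltac:(by rewrite normr1))).
by under [X in _.-integrable _ X -> _]funext do rewrite /= mulr1.
Qed.

Lemma snd_integrable (b : Y -> R) : kappa.-integrable setT (EFin \o b) ->
  mu.-integrable setT (EFin \o (fun z => b z.2)).
Proof.
move=> ib; have := product_integrable (@bounded_integrable _ _ _ nu (probability_setT _) (fun=> 1) 1
  (measurable_cst _) (fun=> ltac:(by rewrite normr1))) ib.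
by under [X in _.-integrable _ X -> _]funext do rewrite /= mul1r.
Qed.

Lemma fst_integral (a : X -> R) : nu.-integrable setT (EFin \o a) ->
  \int[mu]_z a z.1 = \int[nu]_x a x.
Proof.
move=> ia; have := product_integral ia (@bounded_integrable _ _ _ kappa (probability_setT _)
  (fun=> 1) 1
  (measurable_cst _) (fun=> ltac:(by rewrite normr1))).
rewrite (Rintegral_cst kappa measurableT) /= probability_setT mulr1/= mulr1 => <-.
by apply: eq_Rintegral => z _; rewrite mulr1.
Qed.

Lemma snd_integral (b : Y -> R) : kappa.-integrable setT (EFin \o b) ->
  \int[mu]_z b z.2 = \int[kappa]_y b y.
Proof.
move=> ib; have := product_integral (@bounded_integrable _ _ _ nu (probability_setT _) (fun=> 1) 1
  (measurable_cst _) (fun=> ltac:(by rewrite normr1))) ib.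
rewrite (Rintegral_cst nu measurableT) /= probability_setT mulr1/= mul1r => <-.
by apply: eq_Rintegral => z _; rewrite mul1r.
Qed.

End product.

(** * Asymptotics of the truncated energy *)

Section energy_limits.
Variables (R : realType) (n : nat).
Local Notation X := 'rV[R]_n.
Local Notation S := ('rV[R]_n * 'rV[R]_n)%type.
Variables (U : X -> R) (nu kappa : probability X R) (c0 : R).
Hypotheses (U_C2 : Ck 2 U) (Uc0 : forall x, c0 <= U x) (kg : std_gaussian kappa).
Local Notation mu := (nu \x kappa)%E.
Local Notation E := (energy U).
Local Notation q := (fun v : X => dotv v v).

(** This scaling keeps the slope at most 4 in absolute value above [c0], uniformly in [N], while the
    second derivative is of order 1 / N; as [N] grows the function tends to h - c0. *)
Definition cutN (N : nat) (h : R) : R := N.+1%:R * cutG ((h - c0) / N.+1%:R).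
Definition cutN1 (N : nat) (h : R) : R := cutG1 ((h - c0) / N.+1%:R).
Definition cutN2 (N : nat) (h : R) : R := cutG2 ((h - c0) / N.+1%:R) / N.+1%:R.

Let is_derive_affine (N : nat) (h : R) :
  is_derive h (1 : R) (fun h : R => (h - c0) / N.+1%:R) N.+1%:R^-1.
Proof.
have H := is_derive_mul (is_deriveB (is_derive_id h (1:R)) (is_derive_cst c0 h (1:R)))
  (is_derive_cst (N.+1%:R^-1 : R) h (1:R)).
by apply: (@is_derive_eq _ _ _ _ _ _ _ _ H); rewrite /cst/=; ring.
Qed.

Lemma is_derive_cutN N h : is_derive h (1 : R) (cutN N) (cutN1 N h).
Proof.
have H1 := @is_derive1_comp _ (@cutG R) (fun h => (h - c0) / N.+1%:R) h _ _
  (is_derive_cutG _) (is_derive_affine N h).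
have H2 := is_derive_mul (is_derive_cst (N.+1%:R : R) h (1:R)) H1.
apply: (@is_derive_eq _ _ _ _ _ _ _ _ H2); rewrite /cst/= /cutN1 mul0r add0r mulrCA.
by rewrite mulfV ?mulr1// pnatr_eq0.
Qed.

Lemma is_derive_cutN1 N h : is_derive h (1 : R) (cutN1 N) (cutN2 N h).
Proof.
exact: (@is_derive1_comp _ (@cutG1 R) (fun h => (h - c0) / N.+1%:R) h _ _
  (is_derive_cutG1 _) (is_derive_affine N h)).
Qed.

Let continuous_arg N : continuous (fun h : R => (h - c0) / N.+1%:R).
Proof.
apply: continuous_mul; last exact: continuous_const.
by apply: continuous_sub; [move=> x; exact: cvg_id|exact: continuous_const].
Qed.

Lemma continuous_cutN N : continuous (cutN N).
Proof. by move=> x; apply/differentiable_continuous/derivable1_diffP;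
  case: (is_derive_cutN N x). Qed.

Lemma continuous_cutN1 N : continuous (cutN1 N).
Proof. exact: (continuous_lcomp (@continuous_cutG1 R) (@continuous_arg N)). Qed.

Lemma continuous_cutN2 N : continuous (cutN2 N).
Proof.
apply: continuous_mul; last exact: continuous_const.
exact: (continuous_lcomp (@continuous_cutG2 R) (@continuous_arg N)).
Qed.

Let arg_ge0 N h : c0 <= h -> 0 <= (h - c0) / N.+1%:R.
Proof. by move=> h0; rewrite divr_ge0// subr_ge0. Qed.

Lemma cutN_bound N h : c0 <= h -> `|cutN N h| <= N.+1%:R.
Proof.
move=> h0; rewrite /cutN normrM ger0_norm// -[leRHS]mulr1 ler_wpM2l//.
by rewrite cutG_bound// arg_ge0.
Qed.

Lemma cutN1_bound N h : c0 <= h -> `|cutN1 N h| <= 4.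
Proof. by move=> h0; rewrite cutG1_bound// arg_ge0. Qed.

Lemma cutN2_bound N h : c0 <= h -> `|cutN2 N h| <= 12.
Proof.
move=> h0; rewrite /cutN2 normrM normfV [`|N.+1%:R|]ger0_norm//.
rewrite ler_pdivrMr// (le_trans (cutG2_bound (arg_ge0 N h0)))//.
by rewrite ler_peMr// ler1n.
Qed.

Lemma cutN_lipschitz N h k : c0 <= h -> h <= k -> `|cutN N k - cutN N h| <= 4 * (k - h).
Proof.
move=> h0 hk; rewrite /cutN -mulrBr normrM ger0_norm// mulrC -ler_pdivlMr//.
apply: (le_trans (cutG_lipschitz (arg_ge0 N h0) _)); first by rewrite ler_pM2r ?invr_gt0// lerB.
by rewrite -mulrBl -mulrA; have -> : k - c0 - (h - c0) = k - h by ring.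
Qed.

Let cvg_arg (h : R) : (h - c0) / N.+1%:R @[N --> \oo] --> 0.
Proof.
rewrite -(mulr0 (h - c0)); apply: cvgM; first exact: cvg_cst.
exact: (@cvg_harmonic R).
Qed.

Lemma cvg_cutN1 h : cutN1 N h @[N --> \oo] --> (1 : R).
Proof.
have := cvg_comp _ _ (cvg_arg h) (@continuous_cutG1 R 0).
by rewrite /cutG1 /posp max_r subr0 ?ler01// expr1n mulr0 mul0r mulr1 subr0.
Qed.

Lemma cvg_cutN2 h : cutN2 N h @[N --> \oo] --> (0 : R).
Proof.
rewrite -[X in _ --> X](mulr0 (cutG2 (0:R))); apply: cvgM; last exact: (@cvg_harmonic R).
exact: (cvg_comp _ _ (cvg_arg h) (@continuous_cutG2 R 0)).
Qed.

Lemma cvg_cutN h : cutN N h @[N --> \oo] --> h - c0.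
Proof.
have -> : (fun N => cutN N h) = (fun N => (h - c0) *
    (posp (1 - (h - c0) / N.+1%:R) ^+ 2 * (1 - (h - c0) / N.+1%:R))).
  apply/funext => N; rewrite /cutN /cutG; set z := _ ^+ 2 * _.
  by rewrite mulrA; congr (_ * _); rewrite mulrC mulfVK// pnatr_eq0.
rewrite -[X in _ --> X]mulr1; apply: cvgM; first exact: cvg_cst.
have c : continuous (fun s : R => posp (1 - s) ^+ 2 * (1 - s)).
  by apply: continuous_mul; [apply: continuous_mul|];
    [exact: continuous_posp1|exact: continuous_posp1|exact: continuous_1sub].
have := cvg_comp _ _ (cvg_arg h) (c 0).
by rewrite /posp subr0 max_r ?ler01// expr1n mulr1.
Qed.

Lemma cutN_support N s : c0 + N.+1%:R < s -> cutN N s = 0.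
Proof.
move=> h; rewrite /cutN cutG_gt1 ?mulr0// ler_pdivlMr// mul1r lerBrDl; exact: ltW.
Qed.

Lemma energy_ge z : c0 <= E z.
Proof.
by rewrite (le_trans (Uc0 z.1))// lerDl divr_ge0// sqnorm_ge0.
Qed.

(** The bound depends on the velocity alone: Gaussian moments are all finite, whereas nothing is
    assumed about the moments of [U] under [nu]. *)
Lemma poly_integrable (psi : S -> R) (C : R) : measurable_fun setT psi ->
  (forall z, `|psi z| <= C * (1 + q z.2 ^+ 2)) -> mu.-integrable setT (EFin \o psi).
Proof.
move=> mpsi bnd.
have C0 : 0 <= C.
  have := le_trans (normr_ge0 _) (bnd (0, 0)); rewrite pmulr_lge0//.
  by rewrite ltr_wpDr// sqr_ge0.
have i : kappa.-integrable setT (EFin \o (fun v : X => C * (1 + q v ^+ 2))).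
  apply: (@gaussian_integrable _ _ _ kg _ C).
    by apply: continuous_measurable_rV; apply: continuous_mul; [exact: continuous_const|];
      apply: continuous_add; [exact: continuous_const|];
      apply: continuous_mul; exact: continuous_sqnorm.
  by move=> v; rewrite ger0_norm// mulr_ge0// addr_ge0// sqr_ge0.
apply: (le_integrable measurableT _ _ (snd_integrable nu i)); first exact/measurable_EFinP.
move=> z _ /=; rewrite lee_fin (le_trans (bnd z))// ler_norm//.
Qed.

Let cE := continuous_energy U_C2.
Let cq : continuous (fun z : S => q z.2).
Proof. by apply: (@continuous_snd_comp R n q); exact: continuous_sqnorm. Qed.
Let cUf : continuous (fun z : S => U z.1).
Proof. by apply: continuous_fst_comp; exact: (Ck_continuous U_C2). Qed.
Let q0 (z : S) : 0 <= q z.2 := sqnorm_ge0 z.2.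

Let dom_ge0 (C : R) (z : S) : 0 <= C -> 0 <= C * (1 + q z.2 ^+ 2).
Proof.
by move=> C0; rewrite mulr_ge0// addr_ge0//; exact: sqr_ge0.
Qed.

Let C2_ge0 : 0 <= 32 * n%:R ^+ 2 + 512 :> R.
Proof. have := sqr_ge0 (n%:R : R); lra. Qed.

(* The generator applied to the truncated energy, up to the factor [gamma]: the
   Hamiltonian part vanishes because the energy is conserved. *)
Definition cutL N (z : S) : R := cutN1 N (E z) * (n%:R - q z.2) + cutN2 N (E z) * q z.2.

Lemma continuous_cutL N : continuous (cutL N).
Proof.
apply: continuous_add; apply: continuous_mul => //.
- exact: (continuous_lcomp (@continuous_cutN1 N) cE).
- by apply: continuous_sub => //; exact: continuous_const.
- exact: (continuous_lcomp (@continuous_cutN2 N) cE).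
Qed.

(** By the bounds 4 and 12 on the derivatives, |[cutL]| <= 4 (n + q) + 12 q = 4 n + 16 q, and (s +
    t)^2 <= 2 s^2 + 2 t^2 gives the constants 32 and 512. *)
Lemma cutL_bound N z : `|cutL N z ^+ 2| <= (32 * n%:R ^+ 2 + 512) * (1 + q z.2 ^+ 2).
Proof.
have b1 := cutN1_bound N (energy_ge z); have b2 := cutN2_bound N (energy_ge z).
have : `|cutL N z| <= 4 * n%:R + 16 * q z.2.
  rewrite (le_trans (ler_normD _ _))// [X in X + _ <= _]normrM [X in _ + X <= _]normrM (ger0_norm
    (q0 z)).
  have h1 : `|n%:R - q z.2| <= n%:R + q z.2.
    by rewrite (le_trans (ler_normB _ _))// !ger0_norm.
  have h2 := ler_pM (normr_ge0 _) (normr_ge0 _) b1 h1.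
  have h3 := ler_wpM2r (q0 z) b2.
  by apply: le_trans (lerD h2 h3) _; lra.
rewrite normrX; have := normr_ge0 (cutL N z); have := q0 z; have := ler0n R n.
set a := `|_|; set b := dotv _ _; set m := n%:R => m0 b0 a0 ab.
have : a ^+ 2 <= (4 * m + 16 * b) ^+ 2 by rewrite ler_sqr ?nnegrE//; lra.
have := sqr_ge0 (4 * m - 16 * b); nra.
Qed.

Let continuous_phi : continuous (fun v : X => q v - n%:R).
Proof. by apply: continuous_sub; [exact: continuous_sqnorm|exact: continuous_const]. Qed.

Let integrable_phi2 : kappa.-integrable setT (EFin \o (fun v : X => (n%:R - q v) ^+ 2)).
Proof.
apply: (@gaussian_integrable _ _ _ kg _ (2 * n%:R ^+ 2 + 2)).
      apply: continuous_measurable_rV; apply: continuous_mul;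
      by apply: continuous_sub; [exact: continuous_const|exact: continuous_sqnorm].
    move=> v; rewrite ger0_norm ?sqr_ge0//; have := sqr_ge0 (n%:R + q v).
    have := sqr_ge0 (n%:R : R); have := sqr_ge0 (q v); nra.
Qed.

Let integral_phi2 : \int[mu]_z ((n%:R - q z.2) ^+ 2) = 2 * n%:R.
Proof.
have i1 := gaussian_sqnorm_integrable kg; have i2 := gaussian_sqnorm2_integrable kg.
rewrite (snd_integral nu integrable_phi2).
  transitivity (\int[kappa]_v (n%:R ^+ 2 - 2 * n%:R * q v + q v ^+ 2)).
    by apply: eq_Rintegral => v _; ring.
  have ic : kappa.-integrable setT (EFin \o (fun v : X => n%:R ^+ 2 : R)).
    by apply: (@bounded_integrable _ _ _ kappa (probability_setT _) _ (n%:R ^+ 2)) => // x;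
      rewrite ger0_norm// sqr_ge0.
  have iz : kappa.-integrable setT (EFin \o (fun v : X => 2 * n%:R * q v)).
    exact: (integrableZl measurableT (2 * n%:R) i1).
  rewrite RintegralD//; last exact: (integrableB measurableT ic iz).
  rewrite RintegralB// RintegralZl// (gaussian_sqnorm kg) (gaussian_sqnorm2 kg).
  by rewrite Rintegral_cst//= probability_setT/=; ring.
Qed.

Let bphi (v : X) : `|q v - n%:R| <= q v + n%:R.
Proof. by rewrite (le_trans (ler_normB _ _))// !ger0_norm// sqnorm_ge0. Qed.

Let integrable_phi : kappa.-integrable setT (EFin \o (fun v : X => q v - n%:R)).
Proof.
apply: (@gaussian_integrable _ _ _ kg _ (1 + n%:R)); first exact: continuous_measurable_rV.
move=> v; apply: le_trans (bphi v) _; have := sqr_ge0 (q v - 1); have := ler0n R n.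
have := sqnorm_ge0 v; nra.
Qed.

Let integral_phi : \int[kappa]_v (q v - n%:R) = 0.
Proof.
rewrite RintegralB//; last 2 first.
  exact: (gaussian_sqnorm_integrable kg).
  by apply: (@bounded_integrable _ _ _ kappa (probability_setT _) _ (n%:R)) => // x;
    rewrite ger0_norm.
by rewrite (gaussian_sqnorm kg) Rintegral_cst//= probability_setT/= mulr1 subrr.
Qed.

Lemma cvg_cutL2 : \int[mu]_z (cutL N z ^+ 2) @[N --> \oo] --> (2 * n%:R : R).
Proof.
have mc (f : S -> R) : continuous f -> measurable_fun setT (fun z => f z ^+ 2).
  by move=> cf; apply: continuous_measurable_rV2; exact: continuous_mul.
have cnq : continuous (fun z : S => n%:R - q z.2).
  by apply: continuous_sub => //; exact: continuous_const.
rewrite -integral_phi2.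
apply: (@Rintegral_dominated _ _ _ mu _ _ (fun z => (32 * n%:R ^+ 2 + 512) * (1 + q z.2 ^+ 2))).
- by move=> N; apply: mc; exact: continuous_cutL.
- exact: mc.
- apply: nearW => z.
  have h : cutL N z @[N --> \oo] --> n%:R - q z.2.
    rewrite -[X in _ --> X]addr0; apply: cvgD.
      by rewrite -[X in _ --> X]mul1r; apply: cvgM; [exact: cvg_cutN1|exact: cvg_cst].
    by rewrite -[X in _ --> X](mul0r (q z.2)); apply: cvgM; [exact: cvg_cutN2|exact: cvg_cst].
  exact: (cvgM h h).
- apply: (@poly_integrable _ (32 * n%:R ^+ 2 + 512)).
    apply: continuous_measurable_rV2; apply: continuous_mul; first exact: continuous_const.
    by apply: continuous_add; [exact: continuous_const|exact: continuous_mul].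
  by move=> z; rewrite (ger0_norm (dom_ge0 z C2_ge0)).
- by apply: nearW => z N; exact: cutL_bound.
Qed.

(* [cutN N (U x)] is independent of [v], hence orthogonal to [|v|^2 - n]; it can
   be subtracted, which makes the integrand dominated uniformly in [N]. *)
Lemma cvg_cut_phi : \int[mu]_z (cutN N (E z) * (q z.2 - n%:R)) @[N --> \oo] --> (n%:R : R).
Proof.
have cphi := continuous_phi.
have cphi2 : continuous (fun z : S => q z.2 - n%:R).
  by apply: continuous_sub => //; exact: continuous_const.
have cD N : continuous (fun z => (cutN N (E z) - cutN N (U z.1)) * (q z.2 - n%:R)).
  apply: continuous_mul => //; apply: continuous_sub.
    exact: (continuous_lcomp (@continuous_cutN N) cE).
  exact: (continuous_lcomp (@continuous_cutN N) cUf).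
have bD N z : `|(cutN N (E z) - cutN N (U z.1)) * (q z.2 - n%:R)| <=
    (3 + 3 * n%:R) * (1 + q z.2 ^+ 2).
  (* The two arguments differ by |v|^2 / 2 and the slope is at most 4, so the bound does not depend
     on [N]. *)
  have h1 : `|cutN N (E z) - cutN N (U z.1)| <= 2 * q z.2.
    apply: le_trans (@cutN_lipschitz N _ _ (Uc0 z.1) _) _.
      by rewrite lerDl divr_ge0.
    by rewrite /energy; lra.
  rewrite normrM; apply: le_trans (ler_pM (normr_ge0 _) (normr_ge0 _) h1 (bphi z.2)) _.
  have := sqr_ge0 (q z.2 - 1); have := q0 z; have := ler0n R n; nra.
have iD N : mu.-integrable setT (EFin \o (fun z => (cutN N (E z) - cutN N (U z.1)) * (q z.2 -
  n%:R))).
  by apply: poly_integrable (bD N); exact: continuous_measurable_rV2.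
have iU N : nu.-integrable setT (EFin \o (fun x => cutN N (U x))).
  apply: (@bounded_integrable _ _ _ nu (probability_setT _) _ N.+1%:R).
    apply: continuous_measurable_rV.
    exact: (continuous_lcomp (@continuous_cutN N) (Ck_continuous U_C2)).
  by move=> x; exact: cutN_bound.
have -> : (fun N => \int[mu]_z (cutN N (E z) * (q z.2 - n%:R))) =
    (fun N => \int[mu]_z ((cutN N (E z) - cutN N (U z.1)) * (q z.2 - n%:R))).
  apply/funext => N.
  transitivity (\int[mu]_z ((cutN N (E z) - cutN N (U z.1)) * (q z.2 - n%:R) +
      cutN N (U z.1) * (q z.2 - n%:R))).
    by apply: eq_Rintegral => z _; ring.
  rewrite RintegralD//; last exact: (product_integrable (iU N) integrable_phi).
  by rewrite (product_integral (iU N) integrable_phi) integral_phi mulr0 addr0.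
have i2 : kappa.-integrable setT (EFin \o (fun v : X => q v * (q v - n%:R) / 2)).
  apply: (@gaussian_integrable _ _ _ kg _ (1 + n%:R)).
    apply: continuous_measurable_rV; apply: continuous_mul; last exact: continuous_const.
    by apply: continuous_mul => //; exact: continuous_sqnorm.
  move=> v; rewrite !normrM (ger0_norm (sqnorm_ge0 v)) (@ger0_norm _ 2^-1)//.
  have := ler_wpM2l (sqnorm_ge0 v) (bphi v).
  have := sqr_ge0 (q v - 1); have := sqnorm_ge0 v; have := ler0n R n; nra.
(* Value of the limit: |v|^2 / 2 times |v|^2 - n has mean (n (n + 2) - n^2) / 2 = n. *)
have nE : n%:R = \int[mu]_z (q z.2 * (q z.2 - n%:R) / 2) :> R.
  rewrite (snd_integral nu i2).
  transitivity (\int[kappa]_v (2^-1 * q v ^+ 2 - (n%:R / 2) * q v)); last first.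
    by apply: eq_Rintegral => v _; field.
  have i1 := gaussian_sqnorm_integrable kg; have i22 := gaussian_sqnorm2_integrable kg.
  rewrite RintegralB//; last 2 first.
    exact: (integrableZl measurableT _ i22).
    exact: (integrableZl measurableT _ i1).
  by rewrite !RintegralZl// (gaussian_sqnorm kg) (gaussian_sqnorm2 kg); field.
rewrite [X in _ --> X]nE.
apply: (@Rintegral_dominated _ _ _ mu _ _ (fun z => (3 + 3 * n%:R) * (1 + q z.2 ^+ 2))).
- by move=> N; exact: continuous_measurable_rV2.
- apply: continuous_measurable_rV2; apply: continuous_mul; last exact: continuous_const.
  exact: continuous_mul.
- apply: nearW => z.
  have -> : q z.2 * (q z.2 - n%:R) / 2 = ((E z - c0) - (U z.1 - c0)) * (q z.2 - n%:R).
    by rewrite /energy; field.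
  apply: cvgM; last exact: cvg_cst.
  by apply: cvgB; exact: cvg_cutN.
- apply: (@poly_integrable _ (3 + 3 * n%:R)).
    apply: continuous_measurable_rV2; apply: continuous_mul; first exact: continuous_const.
    by apply: continuous_add; [exact: continuous_const|exact: continuous_mul].
  move=> z; rewrite ger0_norm//; apply: dom_ge0; have := ler0n R n; lra.
- by apply: nearW => z N; exact: bD.
Qed.

Definition cutF N (z : S) : R := cutN N (E z) - \int[mu]_z cutN N (E z).

Lemma continuous_cutF N : continuous (cutF N).
Proof.
by apply: continuous_sub;
  [exact: (continuous_lcomp (@continuous_cutN N) cE)|exact: continuous_const].
Qed.

Lemma cutF_bound N : exists M, forall z, `|cutF N z| <= M.
Proof.
exists (N.+1%:R + `|\int[mu]_z cutN N (E z)|) => z.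
by rewrite (le_trans (ler_normB _ _))// lerD2r cutN_bound// energy_ge.
Qed.

(* [f^2 >= f phi - phi^2 / 4] with [phi = |v|^2 - n], of variance [2 n]. *)
Lemma cut_variance_ge N :
  \int[mu]_z (cutN N (E z) * (q z.2 - n%:R)) - n%:R / 2 <= \int[mu]_z (cutF N z ^+ 2).
Proof.
pose c := \int[mu]_z cutN N (E z); pose f := cutF N; rewrite -/f.
have cf : continuous f := continuous_cutF (N := N).
have cphi : continuous (fun z : S => q z.2 - n%:R).
  by apply: continuous_sub => //; exact: continuous_const.
have bg z : `|cutN N (E z)| <= N.+1%:R by apply: cutN_bound; exact: energy_ge.
have bf z : `|f z| <= N.+1%:R + `|c|.
  by rewrite (le_trans (ler_normB _ _))// lerD2r.
have phi_bound (h : S -> R) M z : `|h z| <= M -> `|h z * (q z.2 - n%:R)| <= (M * (1 + n%:R)) * (1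
  + q z.2 ^+ 2).
  move=> hM; rewrite normrM; apply: le_trans (ler_pM (normr_ge0 _) (normr_ge0 _) hM (bphi z.2)) _.
  have M0 := le_trans (normr_ge0 _) hM; rewrite -mulrA ler_wpM2l//.
  have := sqr_ge0 (q z.2 - 1); have := q0 z; have := ler0n R n; nra.
have igphi : mu.-integrable setT (EFin \o (fun z => cutN N (E z) * (q z.2 - n%:R))).
  apply: (@poly_integrable _ (N.+1%:R * (1 + n%:R))).
    apply: continuous_measurable_rV2; apply: continuous_mul => //.
    exact: (continuous_lcomp (@continuous_cutN N) cE).
  by move=> z; exact: (phi_bound (fun z => cutN N (E z))).
have iphi := snd_integrable nu integrable_phi.
have i2 := snd_integrable nu integrable_phi2.
have if2 : mu.-integrable setT (EFin \o (fun z => f z ^+ 2)).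
  apply: (@bounded_integrable _ _ _ mu (probability_setT _) _ ((N.+1%:R + `|c|) ^+ 2)).
    by apply: continuous_measurable_rV2; exact: continuous_mul.
  by move=> z; rewrite normrX ler_sqr ?nnegrE ?addr_ge0.
have i3 : mu.-integrable setT (EFin \o (fun z => c * (q z.2 - n%:R))).
  exact: (integrableZl measurableT c iphi).
have i4 : mu.-integrable setT (EFin \o (fun z => 4^-1 * (n%:R - q z.2) ^+ 2)).
  exact: (integrableZl measurableT 4^-1 i2).
have i5 : mu.-integrable setT (EFin \o (fun z => cutN N (E z) * (q z.2 - n%:R) - c * (q z.2 -
  n%:R))).
  exact: (integrableB measurableT igphi i3).
(* phi is centred, so subtracting c phi does not change the integral, and the last term contributes
   2 n / 4. *)
have -> : \int[mu]_z (cutN N (E z) * (q z.2 - n%:R)) - n%:R / 2 =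
   \int[mu]_z (cutN N (E z) * (q z.2 - n%:R) - c * (q z.2 - n%:R) - 4^-1 * (n%:R - q z.2) ^+ 2).
  rewrite RintegralB// RintegralB// !RintegralZl// integral_phi2 (snd_integral nu integrable_phi)
    integral_phi.
  by field.
apply: le_Rintegral => //; first exact: (integrableB measurableT i5 i4).
move=> z _; rewrite -mulrBl -[cutN N (E z) - c]/(f z); have := sqr_ge0 (f z - (q z.2 - n%:R) / 2).
have -> : (f z - (q z.2 - n%:R) / 2) ^+ 2 = f z ^+ 2 - (f z * (q z.2 - n%:R) - 4^-1 * (n%:R - q
  z.2) ^+ 2) by field.
by rewrite subr_ge0.
Qed.

(** As N tends to infinity the left-hand side tends to 2 n gamma^2, and the lower bound [B N] of the
    variance to n / 2. The slack [e] leaves a gap (2 gamma e + e^2 / 2) n > 0, so the inequality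
    holds for some finite [N]. *)
Lemma energy_test_function (gamma e : R) : (0 < n)%N -> 0 <= gamma -> 0 < e ->
  exists N, 0 < \int[mu]_z (cutF N z ^+ 2) /\
  gamma ^+ 2 * \int[mu]_z (cutL N z ^+ 2) <= (2 * gamma + e) ^+ 2 * \int[mu]_z (cutF N z ^+ 2).
Proof.
move=> n0 g0 e0.
pose A N := \int[mu]_z (cutL N z ^+ 2).
pose B N := \int[mu]_z (cutN N (E z) * (q z.2 - n%:R)) - n%:R / 2.
have cB : B N @[N --> \oo] --> (n%:R / 2 : R).
  have -> : n%:R / 2 = n%:R - n%:R / 2 :> R by field.
  by apply: cvgB; [exact: cvg_cut_phi|exact: cvg_cst].
have cC : (2 * gamma + e) ^+ 2 * B N - gamma ^+ 2 * A N @[N --> \oo] -->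
    (2 * gamma + e) ^+ 2 * (n%:R / 2) - gamma ^+ 2 * (2 * n%:R).
  apply: cvgB; apply: cvgM; try exact: cvg_cst; [exact: cB|exact: cvg_cutL2].
have n0' : 0 < n%:R :> R by rewrite ltr0n.
have p1 : 0 < n%:R / 2 :> R by lra.
have p2 : 0 < (2 * gamma + e) ^+ 2 * (n%:R / 2) - gamma ^+ 2 * (2 * n%:R).
  have -> : (2 * gamma + e) ^+ 2 * (n%:R / 2) - gamma ^+ 2 * (2 * n%:R) =
     (2 * gamma * e + e ^+ 2 / 2) * n%:R by field.
  by rewrite mulr_gt0// ltr_wpDl ?mulr_ge0 ?divr_gt0 ?exprn_gt0// ltW.
have near1 : \forall N \near \oo, 0 < B N by exact: (cvgr_gt _ cB _ p1).
have near2 : \forall N \near \oo, 0 < (2 * gamma + e) ^+ 2 * B N - gamma ^+ 2 * A N.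
  exact: (cvgr_gt _ cC _ p2).
have [N _ H] := filterI near1 near2.
have [/= h1 h2] := H N (leqnn N).
have h3 := cut_variance_ge N.
exists N; split; first exact: lt_le_trans h1 h3.
rewrite (@le_trans _ _ ((2 * gamma + e) ^+ 2 * B N))//.
  by rewrite -subr_ge0 ltW.
by rewrite ler_wpM2l ?sqr_ge0.
Qed.

End energy_limits.

(** * Brownian motion *)

Section law.
Context dO d (O : measurableType dO) (T : measurableType d) (R : realType).
Variables (P : {measure set O -> \bar R}) (m : {measure set T -> \bar R}) (X : O -> T).
Hypotheses (mX : measurable_fun setT X)
  (mE : forall A, measurable A -> m A = P (X @^-1` A)).
Let X_mixin := isMeasurableFun.Build _ _ _ _ _ mX.
Let X_pack : {mfun O >-> T} := HB.pack X X_mixin.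

Lemma ge0_integral_law (f : T -> \bar R) : measurable_fun setT f ->
  (forall x, 0 <= f x)%E -> (\int[m]_x f x = \int[P]_w f (X w))%E.
Proof.
move=> mf f0; rewrite (@eq_measure_integral _ _ _ setT (pushforward P X_pack)); last first.
  by move=> A mA _; rewrite mE.
by rewrite ge0_integral_pushforward.
Qed.

Lemma integral_law (f : T -> R) : measurable_fun setT f ->
  (\int[m]_x (f x)%:E = \int[P]_w (f (X w))%:E)%E.
Proof.
move=> mf; have mf' : measurable_fun setT (EFin \o f) by exact/measurable_EFinP.
rewrite integralE [RHS]integralE; congr (_ - _)%E.
- rewrite (@ge0_integral_law _ (measurable_funepos mf') (fun x => funepos_ge0 _ x)).
  by apply: eq_integral => w _; rewrite !funeposE.
- rewrite (@ge0_integral_law _ (measurable_funeneg mf') (fun x => funeneg_ge0 _ x)).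
  by apply: eq_integral => w _; rewrite !funenegE.
Qed.

Lemma Rintegral_law (f : T -> R) : measurable_fun setT f ->
  \int[m]_x f x = \int[P]_w f (X w).
Proof. by move=> mf; rewrite /Rintegral integral_law. Qed.

Lemma integrable_law (f : T -> R) : measurable_fun setT f ->
  m.-integrable setT (EFin \o f) <-> P.-integrable setT (EFin \o (f \o X)).
Proof.
move=> mf.
have E : (\int[m]_x `|(f x)%:E| = \int[P]_w `|(f (X w))%:E|)%E.
  by rewrite ge0_integral_law//; apply: measurableT_comp => //; exact/measurable_EFinP.
split=> /integrableP[_ fi]; apply/integrableP; split.
- by apply/measurable_EFinP; exact: measurableT_comp.
- by rewrite /= -E.
- exact/measurable_EFinP.
- by rewrite /= E.
Qed.

End law.

Section normal.
Variable R : realType.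
Local Notation leb1 := (@lebesgue_measure R).

(* [|x| exp (- x^2 / (2 s^2)) <= |s| exp (- x^2 / (4 s^2))], a multiple of the
   density of variance [2 s^2]. *)
Lemma normal_first_moment_integrable (s : R) : s != 0 ->
  leb1.-integrable setT (EFin \o (fun x => x * normal_pdf 0 s x)).
Proof.
move=> s0.
pose s' := Num.sqrt 2 * s.
have s'0 : s' != 0 by rewrite mulf_neq0// sqrtr_eq0 -ltNge ltr0n.
have mpdf (r : R) := measurable_normal_pdf 0 r.
pose C := `|s| * normal_peak s / normal_peak s'.
apply: (le_integrable measurableT _ _ (integrableZl measurableT C (@integrable_normal_pdf R 0 s'))).
  by apply/measurable_EFinP; apply: measurable_funM => //; exact: mpdf.
move=> x _ /=; rewrite lee_fin.
have p0 := normal_pdf_ge0 0 s' x.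
have C0 : 0 <= C by rewrite /C divr_ge0 ?mulr_ge0 ?normal_peak_ge0.
rewrite normrM (ger0_norm (normal_pdf_ge0 _ _ _)) (ger0_norm (mulr_ge0 C0 p0)).
rewrite !normal_pdfE// /C /normal_fun !subr0.
have pk := normal_peak_gt0 s'0.
rewrite [leRHS]mulrA divfK ?gt_eqF// mulrCA [`|s| * normal_peak s]mulrC -[leRHS]mulrA ler_wpM2l
  ?normal_peak_ge0//.
have -> : - x ^+ 2 / (s ^+ 2 *+ 2) = - ((x / s) ^+ 2 / 4) + - ((x / s) ^+ 2 / 4).
  by rewrite -mulr_natr; field.
have -> : - x ^+ 2 / (s' ^+ 2 *+ 2) = - ((x / s) ^+ 2 / 4).
  by rewrite -mulr_natr /s' exprMn sqr_sqrtr//; field.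
rewrite expRD mulrA ler_wpM2r ?expR_ge0//.
set y := x / s; have -> : `|x| = `|s| * `|y| by rewrite -normrM /y mulrC divfK.
rewrite -mulrA ler_piMr// expRN ler_pdivrMr ?expR_gt0// mul1r.
have h := @expR_ge1Dx _ (y ^+ 2 / 4); apply: le_trans h.
rewrite -(real_normK (num_real y)); have := sqr_ge0 (`|y| / 2 - 1); lra.
Qed.

(** The integrand is odd and Lebesgue measure is invariant under reflection, so the integral equals
    its opposite. *)
Lemma normal_first_moment (s : R) : s != 0 ->
  (\int[leb1]_x (x * normal_pdf 0 s x)%:E = 0)%E.
Proof.
move=> s0; have i := normal_first_moment_integrable s0.
have mN : measurable_fun setT (-%R : R -> R) by exact: oppr_measurable.
have E := @integral_preserving _ _ _ leb1 (-%R : R -> R) mN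
  (fun A mA => lebesgue_measureN mA) _ i.
have : (\int[leb1]_x (EFin \o (fun x => x * normal_pdf 0 s x)%R) (- x)%R =
   - \int[leb1]_x (EFin \o (fun x => x * normal_pdf 0 s x)%R) x)%E.
  rewrite -integralN; last by apply: integrable_add_def.
  by apply: eq_integral => x _ /=; rewrite !normal_pdfE// /normal_fun !subr0 sqrrN mulNr.
rewrite E; set I := integral _ _ _ => h.
have : I \is a fin_num by apply: integrable_fin_num.
by move: h; case: I => // r [h] _; congr EFin; move: h; clear; lra.
Qed.

Context dO (O : measurableType dO) (P : probability O R).

Lemma normal_law (X : O -> R) (s : R) : s != 0 -> measurable_fun setT X ->
  (forall A, measurable A -> P (X @^-1` A) = normal_prob 0 s A) ->
  P.-integrable setT (EFin \o X) /\ \int[P]_w X w = 0.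
Proof.
move=> s0 mX XE.
have mid : measurable_fun setT (idfun : R -> R) by exact: measurable_id.
have mE A (mA : measurable A) : normal_prob 0 s A = P (X @^-1` A) by rewrite XE.
pose m := normal_prob 0 s : measure _ R.
have mpdf := measurable_normal_pdf 0 s.
have E := @integrable_density _ _ _ leb1 m _ mpdf (@normal_pdf_ge0 R 0 s) (fun A mA => erefl) _ mid.
split.
  apply/(@integrable_law _ _ _ _ _ P m X mX mE idfun mid)/E; exact: normal_first_moment_integrable.
rewrite -(@Rintegral_law _ _ _ _ _ P m X mX mE idfun mid) /Rintegral.
rewrite (@integral_density _ _ _ leb1 m _ mpdf (@normal_pdf_ge0 R 0 s) (fun A mA => erefl) _ mid).
by rewrite normal_first_moment.
Qed.

End normal.

Section brownian.
Context (R : realType) dO (O : measurableType dO) (P : probability O R) (k : nat)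
  (W : R -> O -> 'rV[R]_k).
Hypothesis bW : brownian P W.

Let mW t i : 0 <= t -> measurable_fun setT (fun w => W t w ord0 i).
Proof.
case: bW => mW _ _ _ t0; exact: (measurableT_comp (@measurable_coord R k i) (mW t t0)).
Qed.

Lemma brownian_increment_law t i : 0 < t -> forall A, measurable A ->
  P ((fun w => W t w ord0 i - W 0 w ord0 i) @^-1` A) = normal_prob 0 (Num.sqrt t) A.
Proof.
move=> t0 A mA; case: bW => _ _ _ bm.
have st0 : Num.sqrt t != 0 by rewrite sqrtr_eq0 -ltNge.
(* A single interval, from 0 to t, in the sequence of times j t; only coordinate [i] is constrained,
   and the others contribute factors 1. *)
have /= := bm 1%N (fun j => j%:R * t) (fun _ l => if l == i then A else setT).
rewrite mul0r => /(_ (lexx _)).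
have h1 (j : nat) : j%:R * t < j.+1%:R * t by rewrite ltr_pM2r// ltr_nat.
move=> /(_ h1).
have h2 (j : 'I_1) (l : 'I_k) : measurable (if l == i then A else setT) by case: ifP.
move=> /(_ h2).
rewrite big_ord1 /= mul1r mul0r subr0 (bigD1 i)//= eqxx big1 ?mulr1; last first.
  move=> l /negPf ->; by rewrite (@probability_setT _ _ _ (normal_prob 0 (Num.sqrt t))).
rewrite (_ : [set w | _] = (fun w => W t w ord0 i - W 0 w ord0 i) @^-1` A); last first.
  apply/seteqP; split => w /=.
    by move=> /(_ ord0 i); rewrite eqxx mul1r mul0r.
  by move=> wA j l; case: eqP => // ->; rewrite ord1 mul1r mul0r.
move=> h; rewrite -[LHS]fineK ?h ?fineK//.
  exact: (@fin_num_measure _ _ _ (normal_prob 0 (Num.sqrt t))).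
apply: fin_num_measure; rewrite -[X in measurable X]setTI.
by exact: (measurable_funB (mW i (ltW t0)) (mW i (lexx 0))).
Qed.

(** [brownian] describes increments, so [W 0] = 0 almost surely is used to pass to values. The time
    t = 0, with its degenerate variance, is treated apart. *)
Lemma brownian_coord t i : 0 <= t ->
  P.-integrable setT (EFin \o (fun w => W t w ord0 i)) /\ \int[P]_w W t w ord0 i = 0.
Proof.
rewrite le_eqVlt => t0.
have ae0 : {ae P, forall w, W 0 w ord0 i = (fun=> 0) w}.
  by case: bW => _ h _ _; apply: filterS h => w ->; rewrite mxE.
have i0 := @integrable0 _ _ _ P setT.
have [j0 e0] := @ae_integrable _ _ _ P _ (fun=> 0) (mW i (lexx 0)) ae0 i0.
have z0 : \int[P]_w (0 : R) = 0 by rewrite /Rintegral integral0.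
have {t0} [<-|t0] := predU1P t0; first by rewrite e0.
have st0 : Num.sqrt t != 0 by rewrite sqrtr_eq0 -ltNge.
have mD : measurable_fun setT (fun w => W t w ord0 i - W 0 w ord0 i).
  by apply: measurable_funB; [exact: (mW i (ltW t0))|exact: mW].
have [i1 e1] := normal_law st0 mD (brownian_increment_law i t0).
have ae1 : {ae P, forall w, W t w ord0 i = W t w ord0 i - W 0 w ord0 i}.
  by apply: filterS ae0 => w ->; rewrite subr0.
by have [i2 ->] := ae_integrable (mW i (ltW t0)) ae1 i1.
Qed.

Lemma brownian_dotv t (c : 'rV[R]_k) : 0 <= t ->
  [/\ measurable_fun setT (fun w => dotv c (W t w)),
      P.-integrable setT (EFin \o (fun w => dotv c (W t w))) &
      \int[P]_w dotv c (W t w) = 0].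
Proof.
move=> t0.
have H i : P.-integrable setT (EFin \o (fun w => c ord0 i * W t w ord0 i)).
  exact: (integrableZl measurableT _ (brownian_coord i t0).1).
have [i1 e1] := Rintegral_sum measurableT H.
split=> //; first by have /integrableP[/measurable_EFinP] := i1.
rewrite [LHS]e1 big1// => i _.
by rewrite RintegralZl// ?(brownian_coord i t0).2 ?mulr0//; exact: (brownian_coord i t0).1.
Qed.

End brownian.

Section path_facts.
Variables (R : realType) (n : nat).
Local Notation X := 'rV[R]_n.
Local Notation S := ('rV[R]_n * 'rV[R]_n)%type.

Lemma time_integral0 (F : R -> X) : time_integral 0 F = 0.
Proof. by apply/rowP => i; rewrite !mxE set_itv1 /Rintegral integral_set1. Qed.

(** Coordinatewise integrals combine linearly only if each coordinate is integrable; the continuous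
    [G], in practice the path frozen at negative times, provides this. *)
Lemma dotv_time_integral (a : X) (F : R -> X) t :
  (forall i, exists2 G : R -> R, continuous G & forall s, 0 <= s -> F s ord0 i = G s) ->
  dotv a (time_integral t F) = \int[lebesgue_measure]_(s in `[0, t]) dotv a (F s).
Proof.
move=> cF; rewrite /dotv.
have H i : lebesgue_measure.-integrable `[0, t] (EFin \o (fun s => F s ord0 i)).
  have [G cG FG] := cF i.
  have e : {in `[0, t]%classic, (EFin \o G) =1 (EFin \o (fun s => F s ord0 i))}.
    by move=> s; rewrite inE/= in_itv/= => /andP[s0 _] /=; rewrite FG.
  have iG : lebesgue_measure.-integrable `[0, t] (EFin \o G) by exact: continuous_integrable_itv.
  by move: iG; apply: eq_integrable.
transitivity (\sum_i \int[lebesgue_measure]_(s in `[0, t]) (a ord0 i * F s ord0 i)).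
  by apply: eq_bigr => i _; rewrite mxE RintegralZl.
have H2 i : lebesgue_measure.-integrable `[0, t] (EFin \o (fun s => a ord0 i * F s ord0 i)).
  exact: (integrableZl _ _ (H i)).
have [|_ ->//] := Rintegral_sum _ H2; exact: measurable_itv.
Qed.

Lemma dotv_row_mx (a b x y : X) : dotv (row_mx a b) (row_mx x y) = dotv a x + dotv b y.
Proof.
rewrite /dotv big_split_ord/=; congr (_ + _).
  by apply: eq_bigr => i _; rewrite !row_mxEl.
by apply: eq_bigr => i _; rewrite !row_mxEr.
Qed.

Lemma dotvDr (a x y : X) : dotv a (x + y) = dotv a x + dotv a y.
Proof. by rewrite /dotv -big_split/=; apply: eq_bigr => i _; rewrite mxE mulrDr. Qed.

Lemma dotvZr (a x : X) c : dotv a (c *: x) = c * dotv a x.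
Proof. by rewrite /dotv mulr_sumr; apply: eq_bigr => i _; rewrite mxE mulrCA. Qed.

Lemma dotvNr (a x : X) : dotv a (- x) = - dotv a x.
Proof. by rewrite -scaleN1r dotvZr mulN1r. Qed.

Lemma dotvZl (a x : X) c : dotv (c *: a) x = c * dotv a x.
Proof. by rewrite /dotv mulr_sumr; apply: eq_bigr => i _; rewrite mxE mulrA. Qed.

End path_facts.

(** * The Langevin diffusion *)

Lemma continuous_Rintegral (R : realType) d (T : measurableType d)
    (mu : {measure set T -> \bar R}) (f : R -> T -> R) (h : T -> R) :
  (forall s, measurable_fun setT (f s)) -> {ae mu, forall x, continuous (f ^~ x)} ->
  mu.-integrable setT (EFin \o h) -> {ae mu, forall x, forall s, `|f s x| <= h x} ->
  continuous (fun s => \int[mu]_x f s x).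
Proof.
move=> mf cf ih dom s; apply/(@cvg_nbhsP R R^o) => u us.
apply: (Rintegral_dominated _ _ _ ih) => //.
- by apply: filterS cf => x cx; exact: (cvg_comp _ _ us (cx s)).
- by apply: filterS dom => x H n; exact: H.
Qed.

Section diffusion.
Variables (R : realType) (n : nat).
Local Notation X := 'rV[R]_n.
Local Notation S := ('rV[R]_n * 'rV[R]_n)%type.
Variables (U : X -> R) (alpha gamma : R) (mu : probability S R).
Context (dO : measure_display) (O : measurableType dO) (P : probability O R).
Variables (B W : R -> O -> X) (Z : S -> R -> O -> S) (p : R -> R.-pker S ~> S).
Hypothesis lang : perturbed_langevin U alpha gamma mu P B W Z p.

Local Notation Pt := (transition_semigroup p).

Lemma measurable_state z t : 0 <= t -> measurable_fun setT (Z z t).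
Proof. by case: (langevin_sde lang z) => + _ _ _; exact. Qed.

Let law z t (t0 : 0 <= t) : forall A, measurable A -> p t z A = P (Z z t @^-1` A) :=
  fun A mA => langevin_transition lang t0 z mA.

Lemma semigroup_expectation z t (f : S -> R) : 0 <= t -> measurable_fun setT f ->
  Pt t f z = \int[P]_w f (Z z t w).
Proof. by move=> t0 mf; exact: (Rintegral_law (measurable_state z t0) (law z t0) mf). Qed.

Lemma kernel_integrable z t (f : S -> R) : 0 <= t -> measurable_fun setT f ->
  (p t z).-integrable setT (EFin \o f) <-> P.-integrable setT (EFin \o (f \o Z z t)).
Proof. by move=> t0 mf; exact: (integrable_law (measurable_state z t0) (law z t0) mf). Qed.

Lemma continuous_path z : {ae P, forall w, continuous (fun s : R => Z z (Num.max 0 s) w)}.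
Proof.
case: (langevin_sde lang z) => _ cZ _ _; apply: filterS cZ => w.
exact: continuous_clamp0.
Qed.

Lemma start_state z : {ae P, forall w, Z z 0 w = z}.
Proof.
case: (langevin_sde lang z) => _ _ eX eV; case: (langevin_noise lang) => _ bw0 _ _.
apply: filterS3 eX eV bw0 => w /(_ 0 (lexx 0)) eX /(_ 0 (lexx 0)) eV bw0.
have /eq_row_mx[B0 W0] : row_mx (B 0 w) (W 0 w) = row_mx 0 0 by rewrite bw0 row_mx0.
move: eX eV; rewrite !time_integral0 B0 W0 !scaler0 !subr0 !addr0.
by case: (Z z 0 w) => x v /= -> ->; case: z.
Qed.

(** At time 0 only the starting point remains in the integral equation, almost surely; that the
    semigroup starts at the identity is thus a consequence of the equation. *)
Lemma kernel_start z A : measurable A -> p 0 z A = dirac z A.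
Proof.
move=> mA; rewrite law//.
have mZA : measurable (Z z 0 @^-1` A).
  by rewrite -[X in measurable X]setTI; exact: (measurable_state z (lexx 0)).
have <- : (\int[P]_w (\1_A (Z z 0 w))%:E = P (Z z 0 @^-1` A))%E.
  transitivity (\int[P]_w (\1_(Z z 0 @^-1` A) w)%:E)%E; last by rewrite integral_indic// setIT.
  by apply: eq_integral => w _; rewrite !indicE; congr (_%:R%:E); apply/idP/idP; rewrite !inE.
rewrite (@ae_eq_integral _ _ _ P setT (fun=> (\1_A z)%:E))//.
- by rewrite (@integral_cst_prob _ _ _ P (probability_setT _)).
- apply/measurable_EFinP; have mi : measurable_fun setT (\1_A : S -> R) by exact: measurable_indic.
  exact: (measurableT_comp mi (measurable_state z (lexx 0))).
- by apply: filterS (start_state z) => w /= -> _.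
Qed.

(** Path continuity and dominated convergence. It provides the continuity in time required for
    averaging in the case of the truncated energy. *)
Lemma continuous_semigroup (z : S) (f : S -> R) (M : R) : continuous f -> (forall y, `|f y| <= M) ->
  continuous (fun s : R => Pt (Num.max 0 s) f z).
Proof.
move=> cf bf.
have mf : measurable_fun setT f by exact: continuous_measurable_rV2.
have -> : (fun s => Pt (Num.max 0 s) f z) = (fun s => \int[P]_w f (Z z (Num.max 0 s) w)).
  by apply/funext => s; rewrite semigroup_expectation// le_max lexx.
apply: (@continuous_Rintegral _ _ _ P (fun s w => f (Z z (Num.max 0 s) w)) (fun=> M)).
- move=> s; apply: (measurableT_comp mf); apply: measurable_state; by rewrite le_max lexx.
- apply: filterS (continuous_path z) => w cw s.
  by apply: continuous_comp; [exact: cw|exact: cf].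
- by apply: (@bounded_integrable _ _ _ P (probability_setT _) _ `|M|).
- by apply: nearW => w s; exact: bf.
Qed.

End diffusion.

(** * From increments of the semigroup to relaxation times *)

Section relaxation.
Context d (T : measurableType d) (R : realType).
Variables (mu : probability T R) (P : R -> R.-pker T ~> T).
Hypotheses (inv : invariant_measure mu P) (CK : chapman_kolmogorov P)
  (P0 : forall z A, measurable A -> P 0 z A = dirac z A).
Local Notation Pt := (transition_semigroup P).
Variables (f : T -> R) (c : R).
Hypotheses (c_gt0 : 0 < c) (f0 : L02 mu f) (f1 : L2norm mu f = 1%E)
  (fc : forall s, 0 <= s -> (L2norm mu (fun z => Pt s f z - f z)%R <= (s * c)%:E)%E).

Lemma trel_lower_bound : (((1 - expR (-1)) / c)%:E <= trel mu P)%E.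
Proof.
apply: le_ereal_inf_tmp => _ [t [t0 ht] <-]; rewrite lee_fin ler_pdivrMr//.
exact: (trel_ge f0 f1 t0 (fc t0) ht).
Qed.

Lemma trel_bar_lower_bound :
  (forall t, 0 <= t -> {ae mu, forall z, exists2 phi : R -> R, continuous phi &
     forall s, 0 <= s <= t -> phi s = Pt s f z}) ->
  ((2 * (1 - expR (-1)) / c)%:E <= trel_bar mu P)%E.
Proof.
move=> cont; apply: le_ereal_inf_tmp => _ [t [t0 ht] <-]; rewrite lee_fin.
have mf : measurable_fun setT f by case: f0 => /Lfun2P[].
(* The admissible [t] may be 0, where [averaged_semigroup] is 0 by convention. The estimate is
   applied at later times s > t, which then decrease to t. *)
have H s : t < s -> 2 * (1 - expR (-1)) / c <= s.
  move=> ts; have s0 : 0 < s by exact: le_lt_trans ts.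
  have [h [mh hE hn]] := averaged_semigroup_bound (ltW c_gt0) s0 mf
    (fun r rs => fc (andP rs).1) (cont s (ltW s0)).
  have := trel_bar_ge f0 f1 mh hE hn (ht s (ltW ts)).
  rewrite ler_pdivrMr//; lra.
apply/ler_addgt0Pr => e e0; apply: H; by rewrite ltrDl.
Qed.

End relaxation.

Section hypoelliptic.
Variables (R : realType) (n : nat).
Local Notation X := 'rV[R]_n.
Local Notation S := ('rV[R]_n * 'rV[R]_n)%type.
Variables (U : X -> R) (nu kappa : probability X R) (gamma : R).
Hypotheses (n_gt0 : (0 < n)%N) (U_C2 : Ck 2 U)
  (U_infty : forall M : R, exists r : R, forall x, r < enorm x -> M < U x)
  (kg : std_gaussian kappa) (gamma_ge0 : 0 <= gamma).
Context (dO : measure_display) (O : measurableType dO) (P : probability O R).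
Variables (B W : R -> O -> X) (Z : S -> R -> O -> S) (p : R -> R.-pker S ~> S).
Hypothesis lang : perturbed_langevin U 0 gamma (nu \x kappa)%E P B W Z p.
Local Notation mu := (nu \x kappa)%E.

Lemma energy_generator (e : R) : 0 < e -> exists (f g : S -> R) (M : R),
  [/\ continuous f, (forall z, `|f z| <= M), L02 mu f, L2norm mu f = 1%E &
    L2_generator mu p f g] /\ (L2norm mu g <= (2 * gamma + e)%:E)%E.
Proof.
move=> e0.
have [c0 Uc0] := potential_lower_bound U_C2 U_infty.
have [N [V0 HV]] := energy_test_function nu U_C2 Uc0 kg n_gt0 gamma_ge0 e0.
set V := \int[mu]_z _ in V0 HV.
set A := \int[mu]_z _ in HV.
pose k := (Num.sqrt V)^-1.
have k0 : 0 < k by rewrite invr_gt0 sqrtr_gt0.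
have kV : k ^+ 2 * V = 1 by rewrite exprVn sqr_sqrtr ?(ltW V0)// mulVf// gt_eqF.
pose c := \int[mu]_z cutN c0 N (energy U z).
(* [f0] has compact support, so its image under the generator is given; [f] is its centred version,
   with the same image because the kernels fix constants. The factor [k] gives [f] norm 1. *)
pose f0 (z : S) := k * cutN c0 N (energy U z).
pose f z := f0 z - k * c.
pose g z := gamma * (k * cutL U c0 N z).
have fE z : f z = k * cutF U nu kappa c0 N z by rewrite /f /f0 /cutF mulrBr.
have dk (h h' : R -> R) (dh : forall s : R, is_derive s (1:R) h (h' s)) (s : R) :
    is_derive s (1 : R) (fun s => k * h s) (k * h' s).
  have H := is_derive_mul (is_derive_cst k s (1:R)) (dh s).
  by apply: (@is_derive_eq _ _ _ _ _ _ _ _ H); rewrite /cst/= mul0r add0r.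
have d1 := dk _ _ (is_derive_cutN c0 N).
have d2 := dk _ _ (is_derive_cutN1 c0 N).
have cd2 : continuous (fun s : R => k * cutN2 c0 N s).
  by apply: continuous_mul; [exact: continuous_const|exact: continuous_cutN2].
have C2 : Ck 2 f0 := Ck2_energy U_C2 d1 d2 cd2.
have cs : compact_support f0.
  apply: (@compact_support_energy _ _ _ U_C2 (fun s => k * cutN c0 N s) U_infty (c0 + N.+1%:R)).
  by move=> s hs; rewrite cutN_support ?mulr0.
have cF := @continuous_cutF R n U nu kappa c0 U_C2 N.
have cf : continuous f.
  rewrite (_ : f = fun z => k * cutF U nu kappa c0 N z); last exact/funext.
  by apply: continuous_mul => //; exact: continuous_const.
have cf0 : continuous f0 := Ck_continuous C2.
have mf := continuous_measurable_rV2 cf; have mf0 := continuous_measurable_rV2 cf0.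
have [M0 HM0] := @cutF_bound R n U nu kappa c0 Uc0 N.
have bf z : `|f z| <= k * M0 by rewrite fE normrM gtr0_norm// ler_pM2l.
have bf0 z : `|f0 z| <= k * M0 + `|k * c|.
  have -> : f0 z = f z + k * c by rewrite /f subrK.
  by rewrite (le_trans (ler_normD _ _))// lerD2r.
have fin2 (h : S -> R) : measurable_fun setT h -> mu.-integrable setT (EFin \o (fun z => h z ^+
  2)) ->
    (\int[mu]_z (h z ^+ 2)%:E = (\int[mu]_z (h z ^+ 2))%:E)%E.
  move=> mh ih; rewrite /Rintegral fineK//; exact: integrable_fin_num.
have if2 : mu.-integrable setT (EFin \o (fun z => f z ^+ 2)).
  apply: (@bounded_integrable _ _ _ mu (probability_setT _) _ ((k * M0) ^+ 2)).
    by apply: measurable_funX.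
  move=> z; rewrite normrX ler_sqr ?nnegrE//.
  exact: le_trans (normr_ge0 _) (bf z).
have iF2 : mu.-integrable setT (EFin \o (fun z => cutF U nu kappa c0 N z ^+ 2)).
  apply: (@bounded_integrable _ _ _ mu (probability_setT _) _ (M0 ^+ 2)).
    by apply: measurable_funX; exact: continuous_measurable_rV2.
  move=> z; rewrite normrX ler_sqr ?nnegrE//.
  exact: le_trans (normr_ge0 _) (HM0 z).
have iF : mu.-integrable setT (EFin \o cutF U nu kappa c0 N).
  apply: (@bounded_integrable _ _ _ mu (probability_setT _) _ M0) => //.
  exact: continuous_measurable_rV2.
have cL := @continuous_cutL R n U c0 U_C2 N.
have iL2 : mu.-integrable setT (EFin \o (fun z => cutL U c0 N z ^+ 2)).
  apply: (poly_integrable nu kg _ (@cutL_bound R n U c0 Uc0 N)).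
  by apply: measurable_funX; exact: continuous_measurable_rV2.
have cg : continuous (fun z : S => cutN c0 N (energy U z)).
  by apply: (continuous_lcomp _ (continuous_energy U_C2)); exact: continuous_cutN.
have f1 : L2norm mu f = 1%E.
  rewrite L2normE fin2//.
  rewrite (_ : \int[mu]_z (f z ^+ 2) = 1); first by rewrite /= sqrtr1.
  transitivity (\int[mu]_z (k ^+ 2 * cutF U nu kappa c0 N z ^+ 2)).
    by apply: eq_Rintegral => z _; rewrite fE exprMn.
  by rewrite RintegralZl.
have f00 : \int[mu]_z f z = 0.
  transitivity (\int[mu]_z (k * cutF U nu kappa c0 N z)).
    by apply: eq_Rintegral => z _; rewrite fE.
  rewrite RintegralZl// (_ : \int[mu]_z cutF U nu kappa c0 N z = 0) ?mulr0//.
  rewrite /cutF RintegralB//.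
  - by rewrite (Rintegral_cst mu measurableT)/= probability_setT/= mulr1 subrr.
  - apply: (@bounded_integrable _ _ _ mu (probability_setT _) _ N.+1%:R).
      exact: continuous_measurable_rV2.
    by move=> z; apply: cutN_bound; exact: energy_ge.
  - by apply: (@bounded_integrable _ _ _ mu (probability_setT _) _ `|c|).
have Lf : f \in Lfun mu 2%:E by apply/Lfun2P; split => //; rewrite f1 ltry.
have gE : langevin_op U 0 gamma f0 = g.
  apply/funext => z; rewrite (langevin_op_energy U_C2 d1 d2) /g /cutL; ring.
have [_ Lg gen] := langevin_generator lang C2 cs.
rewrite gE in Lg gen.
exists f, g, (k * M0); split.
  split=> //; split=> //.
  apply: cvg_trans gen; apply: near_eq_cvg; apply: nearW => t; congr L2norm; apply/funext => z.
  have -> : transition_semigroup p t f z = transition_semigroup p t f0 z - k * c.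
    have := semigroupB p t mf0 (measurable_cst (k * c)) bf0 (fun=> lexx `|k * c|).
    by move=> /(congr1 (@^~ z)) ->; rewrite semigroup_cst.
  by rewrite /f; congr (_ * _ - _); ring.
have mL : measurable_fun setT (cutL U c0 N) by exact: continuous_measurable_rV2.
have ge : 0 <= 2 * gamma + e by rewrite addr_ge0 ?mulr_ge0 ?(ltW e0).
rewrite L2norm_le_fin//.
have ig2 : mu.-integrable setT (EFin \o (fun z => (gamma * k) ^+ 2 * cutL U c0 N z ^+ 2)).
  exact: (integrableZl measurableT _ iL2).
rewrite (_ : \int[mu]_z _ = (\int[mu]_z ((gamma * k) ^+ 2 * cutL U c0 N z ^+ 2))%:E)%E; last first.
  rewrite /Rintegral fineK; last exact: integrable_fin_num.
  by apply: eq_integral => z _; rewrite /g mulrA exprMn.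
rewrite lee_fin RintegralZl// -/A.
have -> : (gamma * k) ^+ 2 * A = k ^+ 2 * (gamma ^+ 2 * A) by ring.
apply: le_trans (ler_wpM2l (sqr_ge0 k) HV) _.
have -> : k ^+ 2 * ((2 * gamma + e) ^+ 2 * V) = (2 * gamma + e) ^+ 2 * (k ^+ 2 * V) by ring.
by rewrite kV mulr1.
Qed.

End hypoelliptic.

(** * Affine observables along the diffusion *)

Section affine_observable.
Variables (R : realType) (n : nat).
Local Notation X := 'rV[R]_n.
Local Notation S := ('rV[R]_n * 'rV[R]_n)%type.
Variables (U : X -> R) (alpha gamma : R) (mu : probability S R).
Hypotheses (U_C2 : Ck 2 U) (gamma_gt0 : 0 < gamma).
Context (dO : measure_display) (O : measurableType dO) (P : probability O R).
Variables (B W : R -> O -> X) (Z : S -> R -> O -> S) (p : R -> R.-pker S ~> S).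
Hypothesis lang : perturbed_langevin U alpha gamma mu P B W Z p.
Local Notation Pt := (transition_semigroup p).
Variables (a : X) (b : R).

(* The term in [v] is chosen so that the drift of [lifted_affine] along the
   diffusion is [lifted_drift], a function of the position only. *)
Definition lifted_affine (z : S) : R := dotv a z.1 + b + gamma^-1 * dotv a z.2.
Definition lifted_drift (z : S) : R := - (alpha + gamma^-1) * 'D_a U z.1.
Local Notation F := lifted_affine.
Local Notation g := lifted_drift.

(** The combination sqrt(2 alpha) a.B + gamma^-1 sqrt(2 gamma) a.W, written as one linear form of
    the joint Brownian motion so that it is seen to be centred. *)
Let noise (t : R) (w : O) : R :=
  dotv (row_mx (Num.sqrt (2 * alpha) *: a) ((gamma^-1 * Num.sqrt (2 * gamma)) *: a))
    (row_mx (B t w) (W t w)).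

Definition drift_part (z : S) (t : R) (w : O) : R := F (Z z t w) - F z - noise t w.

Lemma continuous_lifted_affine : continuous F.
Proof.
apply: continuous_add.
  apply: continuous_add; last exact: continuous_const.
  by apply: continuous_fst_comp; exact: continuous_dotv.
apply: continuous_mul; first exact: continuous_const.
by apply: continuous_snd_comp; exact: continuous_dotv.
Qed.

Lemma continuous_lifted_drift : continuous g.
Proof.
apply: continuous_mul; first exact: continuous_const.
by apply: (continuous_fst_comp (f := fun x => 'D_a U x)); exact: continuous_derive_U.
Qed.

Let mF : measurable_fun setT F := continuous_measurable_rV2 continuous_lifted_affine.

Let noise_fact t (t0 : 0 <= t) := brownian_dotv (langevin_noise lang)
  (row_mx (Num.sqrt (2 * alpha) *: a) ((gamma^-1 * Num.sqrt (2 * gamma)) *: a)) t0.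

Lemma measurable_drift_part z t : 0 <= t -> measurable_fun setT (drift_part z t).
Proof.
move=> t0; apply: measurable_funB; last by case: (noise_fact t0).
apply: measurable_funB => //.
exact: (measurableT_comp mF (measurable_state lang z t0)).
Qed.

Lemma continuous_drift_part z : {ae P, forall w, continuous (fun s : R => drift_part z (Num.max 0
  s) w)}.
Proof.
case: (langevin_noise lang) => _ _ cn _.
apply: filterS2 (continuous_path lang z) cn => w cZ cBW.
apply: continuous_sub.
  apply: continuous_sub; last exact: continuous_const.
  by move=> s; apply: continuous_comp; [exact: cZ|exact: continuous_lifted_affine].
move=> s; apply: (continuous_comp (f := fun s : R => row_mx (B (Num.max 0 s) w) (W (Num.max 0 s)
  w))).
  exact: (continuous_clamp0 cBW).
exact: continuous_dotv.
Qed.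

Let path_integrable z w (psi : S -> R) t : continuous (fun s : R => Z z (Num.max 0 s) w) ->
  continuous psi -> lebesgue_measure.-integrable `[0, t] (EFin \o (fun s => psi (Z z s w))).
Proof.
move=> cZ cp.
have c : continuous (fun s : R => psi (Z z (Num.max 0 s) w)).
  by move=> s; apply: continuous_comp; [exact: cZ|exact: cp].
have e : {in `[0, t]%classic, (EFin \o (fun s => psi (Z z (Num.max 0 s) w))) =1
    (EFin \o (fun s => psi (Z z s w)))}.
  by move=> s; rewrite inE/= in_itv/= => /andP[s0 _] /=; rewrite max_r.
have i := continuous_integrable_itv 0 t true false c.
by move: i; apply: eq_integrable.
Qed.

Let path_riemann z w (psi : S -> R) t : continuous (fun s : R => Z z (Num.max 0 s) w) ->
  continuous psi -> 0 <= t ->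
  t / N.+1%:R * \sum_(k < N.+1) psi (Z z (k%:R * (t / N.+1%:R)) w) @[N --> \oo] -->
  \int[lebesgue_measure]_(s in `[0, t]) psi (Z z s w).
Proof.
move=> cZ cp t0.
have c : continuous (fun s : R => psi (Z z (Num.max 0 s) w)).
  by move=> s; apply: continuous_comp; [exact: cZ|exact: cp].
have := riemann_sum_cvg c t0.
have -> : \int[lebesgue_measure]_(s in `[0, t]) psi (Z z (Num.max 0 s) w) =
    \int[lebesgue_measure]_(s in `[0, t]) psi (Z z s w).
  by apply: eq_Rintegral => s; rewrite inE/= in_itv/= => /andP[s0 _]; rewrite max_r.
apply: cvg_trans; apply: near_eq_cvg; apply: nearW => N; congr (_ * _).
by apply: eq_bigr => k _; rewrite max_r// mulr_ge0// divr_ge0.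
Qed.

(** The position equation contributes the time integral of a.V, and gamma^-1 times the friction term
    contributes its opposite. What remains is the integral of a.grad U, with factor - alpha from the
    position and - gamma^-1 from the velocity. *)
Lemma drift_part_integral z : {ae P, forall w, forall t, 0 <= t ->
  drift_part z t w = \int[lebesgue_measure]_(s in `[0, t]) g (Z z s w)}.
Proof.
case: (langevin_sde lang z) => _ _ eX eV.
apply: filterS3 (continuous_path lang z) eX eV => w cZ eX eV t t0.
have U1 : Ck 1 U.
  case: U_C2 => cU H; split => // v; have [h1 [h2 _]] := H v; by split.
have cpU i : continuous (fun x => grad U x ord0 i).
  rewrite (_ : (fun x => _) = fun x => 'D_(delta_mx ord0 i) U x).
    exact: continuous_derive_U.
  by apply/funext => x; rewrite mxE.
have TU : dotv a (time_integral t (fun s => grad U (Z z s w).1)) =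
    \int[lebesgue_measure]_(s in `[0, t]) 'D_a U (Z z s w).1.
  rewrite dotv_time_integral.
    by apply: eq_Rintegral => s _; rewrite (derive_dotv_sum a _ U1).
  move=> i; exists (fun s => grad U (Z z (Num.max 0 s) w).1 ord0 i).
    have c2 := continuous_fst_comp (cpU i).
    by move=> s; exact: (cvg_comp _ _ (cZ s) (c2 _)).
  by move=> s s0; rewrite max_r.
rewrite /drift_part /F /noise dotv_row_mx !dotvZl eX// eV//.
rewrite !(dotvDr, dotvNr, dotvZr) TU.
have -> : \int[lebesgue_measure]_(s in `[0, t]) g (Z z s w) =
    - (alpha + gamma^-1) * \int[lebesgue_measure]_(s in `[0, t]) 'D_a U (Z z s w).1.
  rewrite -RintegralZl//.
  apply: (@path_integrable z w (fun z => 'D_a U z.1)) => //.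
  by apply: (continuous_fst_comp (f := fun x => 'D_a U x)); exact: continuous_derive_U.
by field; exact: lt0r_neq0.
Qed.

(* Almost surely the time integral of [psi] along the path; as a lower limit of
   Riemann sums it is measurable without joint measurability of [Z]. *)
Definition path_average (psi : S -> R) (z : S) (t : R) (w : O) : \bar R :=
  limn_einf (fun N => (t / N.+1%:R * \sum_(k < N.+1) psi (Z z (k%:R * (t / N.+1%:R)) w))%:E).

Let grid_ge0 (t : R) N (k : 'I_N.+1) : 0 <= t -> 0 <= k%:R * (t / N.+1%:R).
Proof. by move=> t0; rewrite mulr_ge0// divr_ge0. Qed.

Lemma path_averageE (psi : S -> R) z t : continuous psi -> 0 <= t ->
  {ae P, forall w, path_average psi z t w =
    (\int[lebesgue_measure]_(s in `[0, t]) psi (Z z s w))%:E}.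
Proof.
move=> cp t0; apply: filterS (continuous_path lang z) => w cZ.
apply: (cvg_limn_einf_sup _).1; apply: cvg_EFin; first exact: nearW.
exact: path_riemann.
Qed.

Let measurable_sum (psi : S -> R) z t N : measurable_fun setT psi -> 0 <= t ->
  measurable_fun setT (fun w => (t / N.+1%:R * \sum_(k < N.+1) psi (Z z (k%:R * (t / N.+1%:R))
    w))%:E).
Proof.
move=> mp t0; apply/measurable_EFinP; apply: measurable_funM => //.
apply: measurable_sum => k.
exact: (measurableT_comp mp (measurable_state lang z (grid_ge0 k t0))).
Qed.

Lemma measurable_path_average (psi : S -> R) z t : measurable_fun setT psi -> 0 <= t ->
  measurable_fun setT (path_average psi z t).
Proof. by move=> mp t0; apply: measurable_limn_einf => N; exact: measurable_sum. Qed.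

Lemma path_average_ge0 (psi : S -> R) z t w : 0 <= t -> (forall y, 0 <= psi y) ->
  (0 <= path_average psi z t w)%E.
Proof.
move=> t0 p0; apply: limn_einf_ge0 => N; rewrite lee_fin mulr_ge0 ?divr_ge0//.
by apply: sumr_ge0.
Qed.

Definition riemann_semigroup (psi : S -> R) (z : S) (t : R) (N : nat) : R :=
  t / N.+1%:R * \sum_(k < N.+1) Pt (k%:R * (t / N.+1%:R)) psi z.

(** Fatou's lemma in place of Fubini: the expectation of each Riemann sum along the path is a
    Riemann sum of semigroup values. *)
Lemma path_average_le (psi : S -> R) z t : continuous psi -> (forall y, 0 <= psi y) -> 0 <= t ->
  (forall N (k : 'I_N.+1), (p (k%:R * (t / N.+1%:R)) z).-integrable setT (EFin \o psi)) ->
  (\int[P]_w path_average psi z t w <=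
    limn_einf (fun N => (riemann_semigroup psi z t N)%:E))%E.
Proof.
move=> cp p0 t0 ip.
have mp : measurable_fun setT psi := continuous_measurable_rV2 cp.
apply: le_trans (@fatou _ _ _ P setT measurableT _ _ _) _.
- by move=> N; exact: measurable_sum.
- by move=> N w _; rewrite lee_fin mulr_ge0 ?divr_ge0// sumr_ge0.
rewrite le_eqVlt; apply/orP; left; apply/eqP; congr limn_einf; apply/funext => N.
have ik (k : 'I_N.+1) : P.-integrable setT (EFin \o (fun w => psi (Z z (k%:R * (t / N.+1%:R)) w))).
  exact: (kernel_integrable lang z (grid_ge0 k t0) mp).1 (ip N k).
have [i1 e1] := Rintegral_sum measurableT ik.
have i2 := integrableZl measurableT (t / N.+1%:R) i1.
transitivity (\int[P]_w (t / N.+1%:R * \sum_(k < N.+1) psi (Z z (k%:R * (t / N.+1%:R)) w)))%:E.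
  by rewrite /Rintegral fineK//; exact: integrable_fin_num i2.
rewrite RintegralZl// [X in _ * X]e1; congr (_ * _)%:E; apply: eq_bigr => k _.
by rewrite (semigroup_expectation lang z (grid_ge0 k t0) mp).
Qed.

Lemma semigroup_drift z t : 0 <= t -> P.-integrable setT (EFin \o drift_part z t) ->
  Pt t F z = F z + \int[P]_w drift_part z t w.
Proof.
move=> t0 iD; rewrite (semigroup_expectation lang z t0 mF).
have [mn i_n n0] := noise_fact t0.
have ic : P.-integrable setT (EFin \o (fun=> F z)).
  by apply: (@bounded_integrable _ _ _ P (probability_setT _) _ `|F z|).
have i1 := integrableD measurableT ic iD.
transitivity (\int[P]_w (F z + drift_part z t w + noise t w)).
  by apply: eq_Rintegral => w _; rewrite /drift_part; ring.
rewrite (RintegralD measurableT i1 i_n) [X in _ + X]n0 addr0 (RintegralD measurableT ic iD).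
by rewrite (Rintegral_cst P measurableT)/= probability_setT/= mulr1.
Qed.

Lemma drift_part_bound z t (k0 : R) : 0 <= t ->
  {ae P, forall w, (`|drift_part z t w - t * k0|%:E <=
    path_average (fun y => `|g y - k0|)%R z t w)%E}.
Proof.
move=> t0.
have cg0 : continuous (fun y => g y - k0).
  by apply: continuous_sub; [exact: continuous_lifted_drift|exact: continuous_const].
have cpsi : continuous (fun y => `|g y - k0|) by move=> y; apply: cvg_norm; exact: cg0.
apply: filterS3 (continuous_path lang z) (drift_part_integral z) (path_averageE z cpsi t0).
move=> w cZ -> // ->; rewrite lee_fin.
have i1 := path_integrable t cZ continuous_lifted_drift.
have i2 := path_integrable t cZ cg0.
have ic := path_integrable t cZ (@continuous_const R S k0).
have -> : t * k0 = \int[lebesgue_measure]_(s in `[0, t]) k0.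
  have fin : fine (@lebesgue_measure R `[0, t]%classic) = t.
    rewrite lebesgue_measure_itv/= lte_fin; have [t1|t1] := ltP 0 t; first by rewrite /= subr0.
    by apply/eqP; rewrite eq_le t0 t1.
  by rewrite Rintegral_cst// fin mulrC.
rewrite -RintegralB//.
by apply: le_normr_Rintegral.
Qed.

(** One majorant for all times up to [t], needed for dominated convergence when [s] varies. The
    shape [g y - 0] matches the general estimates at [k0 = 0]. *)
Lemma drift_part_dominated z t : 0 <= t ->
  {ae P, forall w, forall s, 0 <= s <= t -> (`|drift_part z s w|%:E <=
    path_average (fun y => `|g y - 0|)%R z t w)%E}.
Proof.
move=> t0.
have cpsi : continuous (fun y => `|g y - 0|).
  by move=> y; apply: cvg_norm; apply: cvgB; [exact: continuous_lifted_drift|exact: cvg_cst].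
apply: filterS3 (continuous_path lang z) (drift_part_integral z) (path_averageE z cpsi t0).
move=> w cZ dE -> s /andP[s0 st]; rewrite dE// lee_fin.
have i1 := path_integrable s cZ continuous_lifted_drift.
have i2 := path_integrable s cZ cpsi.
have i3 := path_integrable t cZ cpsi.
apply: (@le_trans _ _ (\int[lebesgue_measure]_(r in `[0, s]) `|g (Z z r w) - 0|)).
  under [leRHS]eq_Rintegral do rewrite subr0.
  exact: le_normr_Rintegral.
have [m1 _] := integrableP _ _ _ i3.
apply: fine_le; [exact: integrable_fin_num i2|exact: integrable_fin_num i3|].
apply: ge0_subset_integral => //.
by apply: subset_itvl; rewrite bnd_simp.
Qed.

Let kernel_norm_integrable s z (k0 : R) : (p s z).-integrable setT (EFin \o g) ->
  (p s z).-integrable setT (EFin \o (fun y => `|g y - k0|)).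
Proof.
move=> ig; have ic : (p s z).-integrable setT (EFin \o (fun=> k0)).
  by apply: (@bounded_integrable _ _ _ (p s z) (pker1 _ _ _) _ `|k0|).
exact: integrable_norm (integrableB measurableT ig ic).
Qed.

(** At a fixed time, integrability holds for [mu]-almost every starting point; the grids involve
    countably many times, so the exceptional set stays null. *)
Definition grid_integrable (t : R) (z : S) :=
  forall N (k : 'I_N.+1), (p (k%:R * (t / N.+1%:R)) z).-integrable setT (EFin \o g).

Lemma drift_part_le z t (k0 : R) : 0 <= t -> grid_integrable t z ->
  (\int[P]_w `|drift_part z t w - t * k0|%:E <=
    limn_einf (fun N => (riemann_semigroup (fun y => `|g y - k0|)%R z t N)%:E))%E.
Proof.
move=> t0 gi.
have cpsi : continuous (fun y => `|g y - k0|).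
  move=> y; apply: cvg_norm; apply: continuous_sub;
    [exact: continuous_lifted_drift|exact: continuous_const].
apply: le_trans (path_average_le cpsi _ t0 _) => //.
- apply: ae_le_integral_nomeas => //.
  + by apply: measurable_path_average => //; exact: continuous_measurable_rV2.
  + by move=> w; exact: path_average_ge0.
  + exact: drift_part_bound.
- by move=> N k; apply: kernel_norm_integrable; exact: gi.
Qed.

Lemma drift_part_integrable z t (k0 : R) : 0 <= t -> grid_integrable t z ->
  (limn_einf (fun N => (riemann_semigroup (fun y => `|g y - k0|)%R z t N)%:E) < +oo)%E ->
  P.-integrable setT (EFin \o drift_part z t).
Proof.
move=> t0 gi h.
have mD : measurable_fun setT (fun w => drift_part z t w - t * k0).
  by apply: measurable_funB => //; exact: measurable_drift_part.
have iD : P.-integrable setT (EFin \o (fun w => drift_part z t w - t * k0)).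
  apply/integrableP; split; first exact/measurable_EFinP.
  exact: le_lt_trans (drift_part_le k0 t0 gi) h.
have ic : P.-integrable setT (EFin \o (fun=> t * k0)).
  by apply: (@bounded_integrable _ _ _ P (probability_setT _) _ `|t * k0|).
have := integrableD measurableT iD ic.
by apply: eq_integrable => // w _ /=; rewrite -EFinD subrK.
Qed.

(** The noise is centred, so only the drift part counts. [k0 = 0] yields the bound on |P_t F - F|,
    and [k0 = g z] the derivative at time 0. If the lower limit is infinite the inequality is
    trivial; otherwise it makes the drift part integrable. *)
Lemma semigroup_increment z t (k0 : R) : 0 <= t -> grid_integrable t z ->
  (`|Pt t F z - F z - t * k0|%:E <=
    limn_einf (fun N => (riemann_semigroup (fun y => `|g y - k0|)%R z t N)%:E))%E.
Proof.
move=> t0 gi.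
have [h|] := ltP (limn_einf (fun N => (riemann_semigroup (fun y => `|g y - k0|)%R z t N)%:E))
  +oo%E; last first.
  by move=> h; apply: le_trans h; exact: leey.
have iD := drift_part_integrable t0 gi h.
apply: le_trans (drift_part_le k0 t0 gi).
have ic : P.-integrable setT (EFin \o (fun=> t * k0)).
  by apply: (@bounded_integrable _ _ _ P (probability_setT _) _ `|t * k0|).
have -> : Pt t F z - F z - t * k0 = \int[P]_w (drift_part z t w - t * k0).
  rewrite RintegralB// (semigroup_drift t0 iD) (Rintegral_cst P measurableT)/= probability_setT/=
    mulr1.
  ring.
have iB := integrableB measurableT iD ic.
apply: (@le_trans _ _ (\int[P]_w `|drift_part z t w - t * k0|)%:E).
  rewrite lee_fin; apply: le_normr_Rintegral => //.
rewrite /Rintegral fineK//; apply: integrable_fin_num => //.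
exact: integrable_norm iB.
Qed.

End affine_observable.

(** * Short-time oscillation along the diffusion *)

Lemma truncation (R : realDomainType) (x m : R) : 0 <= m ->
  let y := Num.max (- m) (Num.min x m) in
  [/\ `|y| <= m, `|x - y| <= `|x| & `|x| <= m -> y = x].
Proof.
move=> m0 /=; have [h1|h1] := leP x m.
  have [h2|h2] := leP (- m) x; first by rewrite subrr normr0 ler_norml h2.
  split; first by rewrite normrN ger0_norm.
    have x0 : x <= 0 by lra.
    rewrite (ler0_norm x0) opprK ler_norml; apply/andP; split; lra.
  by rewrite ler_norml => /andP[h3 h4]; lra.
have m1 : - m <= m by lra.
rewrite max_r//; split; first by rewrite ger0_norm.
  have x0 : 0 <= x by lra.
  rewrite (ger0_norm x0) ler_norml; apply/andP; split; lra.
by rewrite ler_norml => /andP[h3 h4]; lra.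
Qed.

Section oscillation.
Variables (R : realType) (n : nat).
Local Notation X := 'rV[R]_n.
Local Notation S := ('rV[R]_n * 'rV[R]_n)%type.
Variables (U : X -> R) (alpha gamma : R) (mu : probability S R).
Context (dO : measure_display) (O : measurableType dO) (P : probability O R).
Variables (B W : R -> O -> X) (Z : S -> R -> O -> S) (p : R -> R.-pker S ~> S).
Hypothesis lang : perturbed_langevin U alpha gamma mu P B W Z p.
Local Notation Pt := (transition_semigroup p).
Let inv : invariant_measure mu p := langevin_invariant lang.

(** By invariance the [mu]-integral of the kernel integrals of |f| is that of |f|, which is
    finite. *)
Lemma ae_kernel_integrable s (f : S -> R) : 0 <= s -> mu.-integrable setT (EFin \o f) ->
  {ae mu, forall z, (p s z).-integrable setT (EFin \o f)}.
Proof.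
move=> s0 /integrableP[mf fi].
have mf1 : measurable_fun setT (fun y => `|(EFin \o f) y|%E) by exact: measurableT_comp.
have fi2 : (\int[mu]_z \int[p s z]_y `|(EFin \o f) y| < +oo)%E.
  by rewrite (ge0_integral_invariant inv s0 mf1).
have mk : measurable_fun setT (fun z => \int[p s z]_y `|(EFin \o f) y|)%E.
  apply: (@measurable_fun_integral_finite_kernel _ _ _ _ _ (fun xy => `|(EFin \o f) xy.2|)%E (p
    s)) => //.
  exact: (measurableT_comp mf1 measurable_snd).
have i2 : mu.-integrable setT (fun z => \int[p s z]_y `|(EFin \o f) y|)%E.
  apply/integrableP; split => //.
  by under eq_integral do rewrite gee0_abs ?integral_ge0//.
apply: filterS (integrable_ae measurableT i2) => z /(_ I) h.
by apply/integrableP; split => //; rewrite ltey_eq h.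
Qed.

Definition oscillation (h : S -> R) (s : R) (z : S) : R := Pt s (fun y => `|h y - h z|) z.

Lemma measurable_oscillation h s : measurable_fun setT h -> measurable_fun setT (oscillation h s).
Proof.
move=> mh; apply: (measurableT_comp (f := fine)) => //.
apply: (@measurable_fun_integral_finite_kernel _ _ _ _ _ (fun xy => `|h xy.2 - h xy.1|%:E)%E (p
  s)) => //.
apply/measurable_EFinP; apply: (measurableT_comp (@normr_measurable R setT));
  apply: measurable_funB.
  exact: (measurableT_comp mh measurable_snd).
exact: (measurableT_comp mh measurable_fst).
Qed.

Lemma oscillation_ge0 h s z : 0 <= oscillation h s z.
Proof. by apply: fine_ge0; apply: integral_ge0 => y _; rewrite lee_fin. Qed.

(** The oscillation is continuous in time by path continuity, bounded, and 0 at time 0; dominated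
    convergence transfers this to its L^2 norm. *)
Lemma bounded_oscillation_small h (M e : R) : continuous h -> (forall y, `|h y| <= M) -> 0 < e ->
  exists2 d : R, 0 < d & forall s, 0 <= s < d -> (L2norm mu (oscillation h s) <= e%:E)%E.
Proof.
move=> ch bh e0.
have mh : measurable_fun setT h := continuous_measurable_rV2 ch.
have max0 (s : R) : 0 <= Num.max 0 s by rewrite le_max lexx.
have bd y z : `|h y - h z| <= M + M by rewrite (le_trans (ler_normB _ _))// lerD.
have mb z : measurable_fun setT (fun y => `|h y - h z|).
  by apply: (measurableT_comp (@normr_measurable R setT)); exact: measurable_funB.
have bosc s z : `|oscillation h s z| <= M + M.
  by apply: semigroup_bounded => // y; rewrite normr_id.
have cosc z : continuous (fun s : R => oscillation h (Num.max 0 s) z).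
  apply: (continuous_semigroup lang (M := M + M)); last by move=> y; rewrite normr_id.
  by move=> y; apply: cvg_norm; apply: cvgB; [exact: ch|exact: cvg_cst].
have M0 : 0 <= M + M by exact: le_trans (normr_ge0 _) (bosc 0 (0, 0)).
have cI : continuous (fun s : R => \int[mu]_z (oscillation h (Num.max 0 s) z ^+ 2)).
  apply: (@continuous_Rintegral _ _ _ mu (fun s z => oscillation h (Num.max 0 s) z ^+ 2) (fun=>
    (M + M) ^+ 2)).
  - by move=> s; apply: measurable_funX; exact: measurable_oscillation.
  - by apply: nearW => z; apply: continuous_mul; exact: cosc.
  - by apply: (@bounded_integrable _ _ _ mu (probability_setT _) _ ((M + M) ^+ 2)) => // z;
      rewrite ger0_norm// exprn_ge0.
  - by apply: nearW => z s; rewrite normrX ler_sqr ?nnegrE.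
have I0 : \int[mu]_z (oscillation h (Num.max 0 0) z ^+ 2) = 0.
  transitivity (\int[mu]_z (0 : R)); last by rewrite /Rintegral integral0.
  apply: eq_Rintegral => z _; rewrite maxxx /oscillation.
  by rewrite (semigroup0 (kernel_start lang))// subrr normr0 expr0n.
have /cvgrPdist_le /(_ (e ^+ 2)) := cI 0.
rewrite I0 exprn_gt0// => /(_ isT)[d /= d0 Hd].
exists d => // s /andP[s0 sd].
have := Hd s; rewrite /= sub0r normrN ger0_norm// => /(_ sd).
rewrite sub0r normrN max_r// => h1.
rewrite L2norm_le_fin ?(ltW e0)//.
have i2 : mu.-integrable setT (EFin \o (fun z => oscillation h s z ^+ 2)).
  apply: (@bounded_integrable _ _ _ mu (probability_setT _) _ ((M + M) ^+ 2)).
    by apply: measurable_funX; exact: measurable_oscillation.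
  by move=> z; rewrite normrX ler_sqr ?nnegrE.
rewrite -[leLHS]fineK ?lee_fin; first exact: le_trans (ler_norm _) h1.
exact: integrable_fin_num i2.
Qed.

Lemma L2norm_truncation (g : S -> R) (e : R) : continuous g -> (L2norm mu g < +oo)%E -> 0 < e ->
  exists (h : S -> R) (M : R), [/\ continuous h, (forall y, `|h y| <= M) &
    (L2norm mu (fun y => `|g y - h y|)%R <= e%:E)%E].
Proof.
move=> cg gfin e0.
have mg : measurable_fun setT g := continuous_measurable_rV2 cg.
pose h (M : nat) y := Num.max (- M%:R) (Num.min (g y) M%:R).
have ch M : continuous (h M).
  move=> y; apply: (@continuous_max R _ (fun=> - M%:R) (fun y => Num.min (g y) M%:R)).
    exact: cvg_cst.
  by apply: (@continuous_min R _ g (fun=> M%:R)); [exact: cg|exact: cvg_cst].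
have bh M y : `|h M y| <= M%:R by case: (truncation (g y) (ler0n R M)).
have dh M y : `|g y - h M y| <= `|g y| by case: (truncation (g y) (ler0n R M)).
have eh y (M : nat) : `|g y| <= M%:R -> h M y = g y.
  by case: (truncation (g y) (ler0n R M)).
have ig2 := L2_sqr_integrable mg gfin.
have md M : measurable_fun setT (fun y => g y - h M y).
  by apply: measurable_funB => //; exact: continuous_measurable_rV2.
have cv : \int[mu]_y ((g y - h M y) ^+ 2) @[M --> \oo] --> \int[mu]_y (0 : R).
  apply: (Rintegral_dominated _ _ _ ig2).
  - by move=> M; apply: measurable_funX.
  - exact: measurable_cst.
  - apply: nearW => y; apply: cvg_near_cst; exists (Num.bound `|g y|) => // M /= KM.
    rewrite eh ?subrr ?expr0n//; apply: ltW.
    by rewrite (lt_le_trans (archi_boundP (normr_ge0 _)))// ler_nat.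
  - by apply: nearW => y M; rewrite -[g y ^+ 2]real_normK ?num_real// normrX ler_sqr ?nnegrE.
have z0 : \int[mu]_y (0 : R) = 0 by rewrite /Rintegral integral0.
move: cv; rewrite z0 => /cvgrPdist_le /(_ (e ^+ 2)).
rewrite exprn_gt0// => /(_ isT)[M _ /(_ M (leqnn M))]; rewrite /= sub0r normrN => hM.
exists (h M), M%:R; split=> //.
rewrite L2norm_le_fin ?(ltW e0)//.
have i2 : mu.-integrable setT (EFin \o (fun y => (g y - h M y) ^+ 2)).
  apply: (le_integrable measurableT _ _ ig2).
    by apply/measurable_EFinP; apply: measurable_funX.
  by move=> y _ /=; rewrite lee_fin !normrX ler_sqr ?nnegrE.
under eq_integral do rewrite real_normK ?num_real//.
rewrite -[leLHS]fineK ?lee_fin; first exact: le_trans (ler_norm _) hM.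
exact: integrable_fin_num i2.
Qed.

(** Let [h] be a truncation of [g]. Pointwise, the oscillation of [g] is at most P_s |g - h| plus
    the oscillation of [h] plus |g - h|. Contractivity bounds the first term by |g - h| in norm, and
    each term takes e / 3. *)
Lemma oscillation_small (g : S -> R) (e : R) : continuous g -> (L2norm mu g < +oo)%E -> 0 < e ->
  exists2 d : R, 0 < d & forall s, 0 <= s < d -> (L2norm mu (oscillation g s) <= e%:E)%E.
Proof.
move=> cg gfin e0; have e3 : 0 < e / 3 by rewrite divr_gt0.
have mg : measurable_fun setT g := continuous_measurable_rV2 cg.
have [h [M [ch bh gh]]] := L2norm_truncation cg gfin e3.
have mh : measurable_fun setT h := continuous_measurable_rV2 ch.
have [d d0 Hd] := bounded_oscillation_small ch bh e3.
exists d => // s sd; have s0 : 0 <= s by case/andP: sd.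
have mgh : measurable_fun setT (fun y => `|g y - h y|).
  by apply: (measurableT_comp (@normr_measurable R setT)); exact: measurable_funB.
have m1 := measurable_semigroup p s mgh.
have m2 := @measurable_oscillation h s mh.
have m12 : measurable_fun setT (fun z => Pt s (fun y => `|g y - h y|) z + oscillation h s z).
  exact: measurable_funD.
apply: (@le_trans _ _ (L2norm mu (fun z => Pt s (fun y => `|g y - h y|) z + oscillation h s z +
  `|g z - h z|)%R)).
  apply: ae_le_L2norm; first exact: measurable_funD.
  have ig := L2_integrable (probability_setT mu) mg (etrans (esym (L2norm_lty mu g)) gfin).
  apply: filterS (ae_kernel_integrable s0 ig) => z iz.
  have p1 : p s z setT = 1%E := pker1 p s z.
  have bi (f : S -> R) (K : R) : measurable_fun setT f -> (forall y, `|f y| <= K) ->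
    (p s z).-integrable setT (EFin \o f) by exact: bounded_integrable.
  have ih : (p s z).-integrable setT (EFin \o h) := bi _ _ mh bh.
  have icg : (p s z).-integrable setT (EFin \o (fun=> g z)) by exact: (bi _ `|g z|).
  have ich : (p s z).-integrable setT (EFin \o (fun=> h z)) by exact: (bi _ `|h z|).
  have icgh : (p s z).-integrable setT (EFin \o (fun=> `|g z - h z|)) by apply: (bi _ `|g z - h
    z|) => // y; rewrite normr_id.
  have i1 : (p s z).-integrable setT (EFin \o (fun y => `|g y - h y|)).
    exact: integrable_norm (integrableB measurableT iz ih).
  have i2 : (p s z).-integrable setT (EFin \o (fun y => `|h y - h z|)).
    exact: integrable_norm (integrableB measurableT ih ich).
  have i3 : (p s z).-integrable setT (EFin \o (fun y => `|g y - g z|)).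
    exact: integrable_norm (integrableB measurableT iz icg).
  have i12 : (p s z).-integrable setT (EFin \o (fun y => `|g y - h y| + `|h y - h z|)).
    exact: (integrableD measurableT i1 i2).
  have i123 : (p s z).-integrable setT (EFin \o (fun y => `|g y - h y| + `|h y - h z| + `|g z - h
    z|)).
    exact: (integrableD measurableT i12 icgh).
  have sum0 : 0 <= Pt s (fun y => `|g y - h y|) z + oscillation h s z + `|g z - h z|.
    rewrite !addr_ge0 ?oscillation_ge0//; apply: fine_ge0; apply: integral_ge0 => y _;
      by rewrite lee_fin.
  rewrite ger0_norm ?oscillation_ge0// (ger0_norm sum0).
  have -> : Pt s (fun y => `|g y - h y|) z + oscillation h s z + `|g z - h z| =
     \int[p s z]_y (`|g y - h y| + `|h y - h z| + `|g z - h z|).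
    rewrite (RintegralD measurableT i12 icgh) (RintegralD measurableT i1 i2).
    by rewrite (Rintegral_cst (p s z) measurableT)/= p1/= mulr1.
  apply: le_Rintegral => // y _.
  have -> : g y - g z = (g y - h y) + (h y - h z) + - (g z - h z) by ring.
  rewrite (le_trans (ler_normD _ _))// normrN lerD2r; exact: ler_normD.
apply: le_trans (@L2norm_triangle _ _ _ mu _ _ m12 mgh) _.
apply: (@le_trans _ _ ((e / 3)%:E + (e / 3)%:E + (e / 3)%:E)%E); last first.
  by rewrite -!EFinD lee_fin; lra.
apply: leeD => //.
apply: le_trans (@L2norm_triangle _ _ _ mu _ _ m1 m2) _.
apply: leeD; last exact: Hd.
exact: le_trans (semigroup_contraction inv s0 mgh) gh.
Qed.

End oscillation.

(** * Lifted affine functions in the domain of the generator *)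

Section lifted_affine_L2.
Variables (R : realType) (n : nat).
Local Notation X := 'rV[R]_n.
Local Notation S := ('rV[R]_n * 'rV[R]_n)%type.
Variables (U : X -> R) (alpha gamma : R) (mu : probability S R).
Hypotheses (U_C2 : Ck 2 U) (gamma_gt0 : 0 < gamma).
Context (dO : measure_display) (O : measurableType dO) (P : probability O R).
Variables (B W : R -> O -> X) (Z : S -> R -> O -> S) (p : R -> R.-pker S ~> S).
Hypothesis lang : perturbed_langevin U alpha gamma mu P B W Z p.
Local Notation Pt := (transition_semigroup p).
Variables (a : X) (b : R).
Local Notation F := (lifted_affine gamma a b).
Local Notation g := (lifted_drift U alpha gamma a).
Hypotheses (F_L2 : F \in Lfun mu 2%:E) (g_L2 : g \in Lfun mu 2%:E).

Let inv : invariant_measure mu p := langevin_invariant lang.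
Let cF : continuous F := @continuous_lifted_affine R n gamma a b.
Let cg : continuous g := continuous_lifted_drift U_C2 (alpha := alpha) (gamma := gamma) (a := a).
Let mF : measurable_fun setT F := continuous_measurable_rV2 cF.
Let mg : measurable_fun setT g := continuous_measurable_rV2 cg.
Let gfin : (L2norm mu g < +oo)%E.
Proof. by case/Lfun2P : g_L2. Qed.

Let ae_grid t : 0 <= t -> {ae mu, forall z, grid_integrable U alpha gamma p a t z}.
Proof.
move=> t0.
have ig := L2_integrable (probability_setT mu) mg (etrans (esym (L2norm_lty mu g)) gfin).
apply/ae_foralln => N.
have : {ae mu, forall z, forall k, (p (k%:R * (t / N.+1%:R)) z).-integrable setT (EFin \o g)}.
  apply/ae_foralln => k; apply: (ae_kernel_integrable lang) => //.
  by rewrite mulr_ge0// divr_ge0.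
by apply: filterS => z H k; exact: H.
Qed.

Let average_bound (G : nat -> S -> R) (t e : R) N : 0 <= t -> 0 <= e ->
  (forall k, measurable_fun setT (G k)) -> (forall k : 'I_N.+1, (L2norm mu (G k) <= e%:E)%E) ->
  (L2norm mu (fun z => t / N.+1%:R * \sum_(k < N.+1) G k z)%R <= (t * e)%:E)%E.
Proof.
move=> t0 e0 mG hG.
have mS : measurable_fun setT (fun z => \sum_(k < N.+1) G k z) by apply: measurable_sum => k.
rewrite L2normZ//.
have tN : 0 <= t / N.+1%:R by rewrite divr_ge0.
apply: (@le_trans _ _ (`|t / N.+1%:R|%:E * (N.+1%:R * e)%:E)%E).
  apply: lee_pmul => //; first by rewrite L2norm_ge0.
  apply: le_trans (@L2norm_sum _ _ _ mu _ (fun k : 'I_N.+1 => G k) _) _ => //.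
  apply: (@le_trans _ _ (\sum_(k < N.+1) e%:E)%E); first exact: lee_sum.
  by rewrite sumEFin sumr_const card_ord mulr_natl.
by rewrite -EFinM lee_fin ger0_norm// mulrA divfK ?pnatr_eq0.
Qed.

Lemma lifted_affine_increment t (c : R) : 0 <= t -> 0 <= c -> (L2norm mu g <= c%:E)%E ->
  (L2norm mu (fun z => Pt t F z - F z)%R <= (t * c)%:E)%E.
Proof.
move=> t0 c0 gc.
have mab : measurable_fun setT (fun y => `|g y - 0|).
  by apply: (measurableT_comp (@normr_measurable R setT)); exact: measurable_funB.
apply: (@L2norm_fatou_le _ _ _ mu
  (fun N z => riemann_semigroup p (fun y => `|g y - 0|) z t N) _ _ (mulr_ge0 t0 c0)).
- move=> N; apply: measurable_funM => //; apply: measurable_sum => k.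
  exact: measurable_semigroup.
- move=> N z; rewrite mulr_ge0 ?divr_ge0// sumr_ge0// => k _.
  by apply: fine_ge0; apply: integral_ge0 => y _; rewrite lee_fin.
- move=> N;
  apply: (@average_bound (fun k => Pt (k%:R * (t / N.+1%:R)) (fun y => `|g y - 0|))) => //.
    by move=> k; exact: measurable_semigroup.
  move=> k; have s0 : 0 <= k%:R * (t / N.+1%:R) by rewrite mulr_ge0// divr_ge0.
  apply: le_trans (semigroup_contraction inv s0 mab) _.
  apply: le_trans gc; apply: le_L2norm => y; by rewrite subr0 normr_id.
- apply: filterS (ae_grid t0) => z gi.
  have := semigroup_increment U_C2 gamma_gt0 lang b 0 t0 gi.
  by rewrite mulr0 subr0.
Qed.

Let increment_expansion t e : 0 < t -> 0 <= e ->
  (forall s, 0 <= s <= t -> (L2norm mu (oscillation p g s) <= e%:E)%E) ->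
  (L2norm mu (fun z => Pt t F z - F z - t * g z)%R <= (t * e)%:E)%E.
Proof.
move=> t0 e0 he.
apply: (@L2norm_fatou_le _ _ _ mu
  (fun N z => t / N.+1%:R * \sum_(k < N.+1) oscillation p g (k%:R * (t / N.+1%:R)) z)
  _ _ (mulr_ge0 (ltW t0) e0)).
- move=> N; apply: measurable_funM => //; apply: measurable_sum => k.
  exact: measurable_oscillation.
- move=> N z; rewrite mulr_ge0 ?divr_ge0 ?(ltW t0)// sumr_ge0// => k _.
  exact: oscillation_ge0.
- move=> N; apply: (@average_bound (fun k => oscillation p g (k%:R * (t / N.+1%:R)))) => //.
  + exact: ltW.
  + by move=> k; exact: measurable_oscillation.
  + move=> k; apply: he; rewrite mulr_ge0 ?divr_ge0 ?(ltW t0)//=.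
    rewrite mulrCA ler_piMr ?(ltW t0)// ler_pdivrMr// mul1r ler_nat; exact: ltnW.
- apply: filterS (ae_grid (ltW t0)) => z gi.
  exact: (semigroup_increment U_C2 gamma_gt0 lang b (g z) (ltW t0) gi).
Qed.

(** [F] is unbounded, beyond the functions on which the generator is prescribed, so the limit of the
    difference quotients is computed directly: their error is at most the largest oscillation of [g]
    over times up to t. *)
Lemma lifted_affine_generator : L2_generator mu p F g.
Proof.
split=> //.
have key e : 0 < e -> \forall t \near (0 : R)^'+,
    (L2norm mu (fun z => t^-1 * (Pt t F z - F z) - g z)%R <= e%:E)%E.
  move=> e0; have [d d0 Hd] := oscillation_small lang cg gfin e0.
  near=> t.
  have t0 : 0 < t by near: t; exact: nbhs_right_gt.
  have td : t < d by near: t; exact: nbhs_right_lt.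
  have mD : measurable_fun setT (fun z => Pt t F z - F z - t * g z).
    apply: measurable_funB; last exact: measurable_funM.
    by apply: measurable_funB => //; exact: measurable_semigroup.
  rewrite (_ : (fun z => _) = (fun z => t^-1 * (Pt t F z - F z - t * g z))); last first.
    by apply/funext => z; rewrite [in RHS]mulrBr mulKf// gt_eqF.
  rewrite L2normZ//.
  apply: (@le_trans _ _ (`|t^-1|%:E * (t * e)%:E)%E).
    apply: lee_pmul => //; first exact: L2norm_ge0.
    apply: (increment_expansion t0 (ltW e0)) => s /andP[s0 st].
    by apply: Hd; rewrite s0/= (le_lt_trans st).
  by rewrite -EFinM lee_fin gtr0_norm ?invr_gt0// mulKf// gt_eqF.
apply/fine_cvgP; split.
  apply: filterS (key 1 ltr01) => t h.
  by rewrite ge0_fin_numE ?L2norm_ge0//; exact: le_lt_trans h (ltry _).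
apply/cvgrPdist_le => e e0; apply: filterS (key e e0) => t h /=.
have fin : (L2norm mu (fun z => t^-1 * (Pt t F z - F z) - g z)%R \is a fin_num)%E.
  by rewrite ge0_fin_numE ?L2norm_ge0//; exact: le_lt_trans h (ltry _).
by rewrite sub0r normrN ger0_norm ?fine_ge0 ?L2norm_ge0// -lee_fin fineK.
Unshelve. all: by end_near. Qed.

(** P_s F z is [F z] plus the mean of the drift part, and dominated convergence over [O] gives
    continuity in [s]. The majorant is the path average of |g| up to [t]; it is integrable for
    almost every [z], since the lower limit of the Riemann sums of P_s |g| has finite
    [mu]-integral. *)
Lemma lifted_affine_continuity t : 0 <= t -> {ae mu, forall z, exists2 phi : R -> R,
  continuous phi & forall s, 0 <= s <= t -> phi s = Pt s F z}.
Proof.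
move=> t0.
pose q N z := riemann_semigroup p (fun y => `|g y - 0|) z t N.
have cab : continuous (fun y => `|g y - 0|).
  by move=> y; apply: cvg_norm; apply: cvgB; [exact: cg|exact: cvg_cst].
have mab : measurable_fun setT (fun y => `|g y - 0|) := continuous_measurable_rV2 cab.
have ab0 (y : S) : 0 <= `|g y - 0| by [].
have gfn : (L2norm mu g \is a fin_num)%E by rewrite ge0_fin_numE ?L2norm_ge0.
pose c := fine (L2norm mu g).
have c0 : 0 <= c by rewrite fine_ge0 ?L2norm_ge0.
have mq N : measurable_fun setT (q N).
  by apply: measurable_funM => //; apply: measurable_sum => k; exact: measurable_semigroup.
have q0 N z : 0 <= q N z.
  rewrite mulr_ge0 ?divr_ge0// sumr_ge0// => k _.
  by apply: fine_ge0; apply: integral_ge0 => y _; rewrite lee_fin.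
have qn N : (L2norm mu (q N) <= (t * c)%:E)%E.
  apply: (@average_bound (fun k => Pt (k%:R * (t / N.+1%:R)) (fun y => `|g y - 0|))) => //.
    by move=> k; exact: measurable_semigroup.
  move=> k; have s0 : 0 <= k%:R * (t / N.+1%:R) by rewrite mulr_ge0// divr_ge0.
  apply: le_trans (semigroup_contraction inv s0 mab) _.
  by rewrite /c fineK//; apply: le_L2norm => y; rewrite subr0 normr_id.
have fin : {ae mu, forall z, limn_einf (fun N => (q N z)%:E) < +oo}%E.
  have mL : measurable_fun setT (fun z => limn_einf (fun N => (q N z)%:E)).
    by apply: measurable_limn_einf => N; exact/measurable_EFinP.
  have L0 z : (0 <= limn_einf (fun N => (q N z)%:E))%E.
    by apply: limn_einf_ge0 => N; rewrite lee_fin.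
  have iL : mu.-integrable setT (fun z => limn_einf (fun N => (q N z)%:E)).
    apply/integrableP; split => //.
    under eq_integral do rewrite gee0_abs//.
    apply: (@le_lt_trans _ _ (1 + (t * c) ^+ 2)%:E); last exact: ltry.
    apply: le_trans (@fatou _ _ _ mu setT measurableT (fun N z => (q N z)%:E) _ _) _.
    - by move=> N; exact/measurable_EFinP.
    - by move=> N z _; rewrite lee_fin.
    apply: limn_einf_le => N.
    (* x <= 1 + x^2 turns the uniform L^2 bound on the Riemann sums into an L^1 bound. *)
    apply: (@le_trans _ _ (\int[mu]_z (1%:E + (q N z ^+ 2)%:E))%E).
      apply: ge0_le_integral_nomeas => z; first by rewrite lee_fin.
      rewrite -EFinD lee_fin; have := sqr_ge0 (q N z - 1); nra.
    rewrite ge0_integralD//; last 2 first.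
    - by move=> z _; rewrite lee_fin sqr_ge0.
    - exact: measurable_sqr.
    rewrite (integral_cst_prob (probability_setT mu)) EFinD leeD2l//.
    by rewrite -L2norm_le_fin ?qn// mulr_ge0.
  apply: filterS (integrable_ae measurableT iL) => z /(_ I) h.
  by rewrite ltey_eq h.
apply: filterS2 (ae_grid t0) fin => z gi hfin.
(* The majorant covers times in [0, t] only, so [s] is confined to this interval to obtain a
   function on all of R. *)
pose clamp s : R := Num.min (Num.max 0 s) t.
have cl0 s : 0 <= clamp s by rewrite /clamp le_min t0 andbT le_max lexx.
have clt s : clamp s <= t by rewrite /clamp ge_min lexx orbT.
have cclamp : continuous clamp.
  move=> s; apply: (@continuous_min R _ (fun s : R => Num.max 0 s) (fun=> t)); last exact: cvg_cst.
  by apply: (@continuous_max R _ (fun=> 0) idfun); [exact: cvg_cst|exact: cvg_id].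
pose D s w := drift_part alpha gamma B W Z a b z s w.
pose G w := path_average Z (fun y => `|g y - 0|) z t w.
have mG : measurable_fun setT G by exact: (measurable_path_average lang z mab t0).
have G0 w : (0 <= G w)%E by exact: path_average_ge0.
have iG : P.-integrable setT G.
  apply/integrableP; split => //.
  under eq_integral do rewrite gee0_abs//.
  apply: le_lt_trans hfin; apply: (path_average_le lang cab ab0 t0) => N k.
  have := integrable_norm (gi N k); apply: eq_integrable => // y _ /=.
  by rewrite subr0.
have mfG : measurable_fun setT (fun w => fine (G w)) by apply: measurableT_comp mG;
  exact: fine_measurable.
have ifG : P.-integrable setT (EFin \o (fun w => fine (G w))).
  apply: (le_integrable measurableT _ _ iG); first exact/measurable_EFinP.
  by move=> w _ /=; case: (G w) => //=; rewrite normr0 leey.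
have dom : {ae P, forall w, forall s, 0 <= s <= t -> `|D s w| <= fine (G w)}.
  have /= H := drift_part_dominated U_C2 gamma_gt0 lang a b z t0.
  have Gf : {ae P, forall w, G w \is a fin_num}.
    by apply: filterS (integrable_ae measurableT iG) => w /(_ I).
  apply: filterS2 H Gf => w H Gw s st.
  by rewrite -lee_fin fineK//; exact: H.
exists (fun s => F z + \int[P]_w D (clamp s) w).
  apply: continuous_add; first exact: continuous_const.
  apply: (@continuous_Rintegral _ _ _ P (fun s w => D (clamp s) w) (fun w => fine (G w))) => //.
  - by move=> s; exact: (measurable_drift_part lang a b z (cl0 s)).
  - apply: filterS (continuous_drift_part lang a b z) => w cw s.
    have := cvg_comp _ _ (cclamp s) (cw (clamp s)).
    rewrite (max_r (cl0 s)); apply: cvg_trans; apply: near_eq_cvg; apply: nearW => r /=.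
    by rewrite (max_r (cl0 r)).
  - by apply: filterS dom => w H s; apply: H; rewrite cl0 clt.
move=> s /andP[s0 st].
have iD : P.-integrable setT (EFin \o D s).
  have mD : measurable_fun setT (D s) by exact: (measurable_drift_part lang).
  apply/integrableP; split; first exact/measurable_EFinP.
  have /integrableP[_ fG] := ifG; apply: le_lt_trans fG.
  apply: ae_le_integral_nomeas => //.
  - by apply: measurableT_comp => //; exact/measurable_EFinP.
  - apply: filterS dom => w H /=; rewrite lee_fin [leRHS]ger0_norm ?fine_ge0//.
    by apply: H; rewrite s0.
rewrite (semigroup_drift lang s0 iD) /clamp max_r// min_l//.
Qed.

End lifted_affine_L2.

(** * Bounds on the gap and on the relaxation times *)

(** Removes the slack [e] from the time bounds, including r = 0, where the left-hand side is +oo and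
    [T] must be infinite. *)
Lemma lee_div_limit (R : realType) (K r : R) (T : \bar R) : 0 < K -> 0 <= r ->
  (forall e, 0 < e -> ((K / (r + e))%:E <= T)%E) -> (K%:E / r%:E <= T)%E.
Proof.
move=> K0 r0 H; case: T H => [t| |] H; last 2 first.
- by rewrite leey.
- by have := H 1 ltr01; rewrite leeNy_eq.
have t0 : 0 < t by rewrite -lte_fin; apply: lt_le_trans (H 1 ltr01);
  rewrite lte_fin divr_gt0// ltr_wpDl.
rewrite inver; case: ifPn => [/eqP r_eq0|rn0].
  (* If [T] were a finite t > 0 while r = 0, this choice of [e] would give 2 t <= t. *)
  have e0 : 0 < K / (2 * t) by rewrite divr_gt0// mulr_gt0.
  have := H _ e0; rewrite r_eq0 add0r invf_div mulrCA divff ?gt_eqF// mulr1 lee_fin.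
  by move=> h; exfalso; move: h t0; lra.
have r0' : 0 < r by rewrite lt_def rn0.
rewrite -EFinM lee_fin ler_pdivrMr//; apply/ler_addgt0Pr => e e0.
have e1 : 0 < e / t by rewrite divr_gt0.
have := H _ e1; rewrite lee_fin ler_pdivrMr ?addr_gt0// mulrDr.
by rewrite mulrCA divff ?gt_eqF// mulr1.
Qed.

Section gap.
Context d (T : measurableType d) (R : realType).
Variables (mu : probability T R) (P : R -> R.-pker T ~> T).

Lemma singular_gap_le (f g : T -> R) (c : \bar R) : L02 mu f -> L2norm mu f = 1%E ->
  L2_generator mu P f g -> (L2norm mu g <= c)%E ->
  (singular_gap mu (L2_generator mu P) <= c)%E.
Proof.
move=> f0 f1 G gc; apply: ge_ereal_inf; exists (L2norm mu g) => //.
by exists f, g; split; rewrite // f1 ?inve1 ?mule1// oner_eq0.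
Qed.

Lemma trel_ge0 : (0 <= trel mu P)%E.
Proof. by apply: le_ereal_inf_tmp => _ [t [t0 _] <-]; rewrite lee_fin. Qed.

Lemma trel_bar_ge0 : (0 <= trel_bar mu P)%E.
Proof. by apply: le_ereal_inf_tmp => _ [t [t0 _] <-]; rewrite lee_fin. Qed.

End gap.

Section affine_test.
Variables (R : realType) (n : nat).
Local Notation X := 'rV[R]_n.
Local Notation S := ('rV[R]_n * 'rV[R]_n)%type.
Variables (U : X -> R) (alpha gamma : R) (nu kappa : probability X R).
Hypotheses (U_C2 : Ck 2 U) (kg : std_gaussian kappa) (alpha_ge0 : 0 <= alpha)
  (gamma_gt0 : 0 < gamma).
Local Notation mu := (nu \x kappa)%E.

(** The velocity part is centred under [kappa] and independent of the position, so the cross term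
    vanishes and the squared norm of the lift is that of [f] plus that of the velocity part. *)
Lemma lifted_affine_L02 (a : X) (b : R) : L02 nu (fun x => dotv a x + b) ->
  L02 mu (lifted_affine gamma a b) /\
  (L2norm nu (fun x => dotv a x + b)%R <= L2norm mu (lifted_affine gamma a b))%E.
Proof.
pose f (x : X) := dotv a x + b; pose w (v : X) := gamma^-1 * dotv a v.
rewrite -[fun x => dotv a x + b]/f => -[/Lfun2P[mf ffin] f0].
have if1 := L2_integrable (probability_setT nu) mf (etrans (esym (L2norm_lty nu f)) ffin).
have if2 := L2_sqr_integrable mf ffin.
have cw : continuous w.
  by apply: continuous_mul; [exact: continuous_const|exact: continuous_dotv].
have mw := continuous_measurable_rV cw.
have d0 : kappa.-integrable setT (EFin \o dotv a).
  apply: (gaussian_integrable kg (C := 1 + dotv a a)).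
    by apply: continuous_measurable_rV; exact: continuous_dotv.
  move=> v; apply: le_trans (abs_dotv_le a v) _.
  have := sqnorm_ge0 a; have := sqnorm_ge0 v; have := sqr_ge0 (dotv v v - 1).
  set A := dotv a a; set q := dotv v v => *; nra.
have iw : kappa.-integrable setT (EFin \o w) := integrableZl measurableT _ d0.
have w0 : \int[kappa]_v w v = 0 by rewrite RintegralZl// (gaussian_mean kg) mulr0.
have iw2 : kappa.-integrable setT (EFin \o (fun v => w v ^+ 2)).
  apply: (gaussian_integrable kg (C := gamma^-1 ^+ 2 * dotv a a)).
    exact: measurable_funX.
  move=> v; rewrite ger0_norm; last exact: sqr_ge0.
  have -> : w v ^+ 2 = gamma^-1 ^+ 2 * dotv a v ^+ 2 by rewrite /w exprMn.
  rewrite -[leRHS]mulrA; apply: ler_wpM2l; first exact: sqr_ge0.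
  apply: le_trans (sqr_dotv_le a v) _; apply: ler_wpM2l; first exact: sqnorm_ge0.
  have := sqnorm_ge0 v; have := sqr_ge0 (dotv v v - 1); nra.
pose F := lifted_affine gamma a b.
have mF : measurable_fun setT F.
  exact: continuous_measurable_rV2 (@continuous_lifted_affine R n gamma a b).
have j1 := fst_integrable kappa if1; have j2 := snd_integrable nu iw.
have F0 : \int[mu]_z F z = 0.
  transitivity (\int[mu]_z (f z.1 + w z.2)) => //.
  by rewrite RintegralD// (fst_integral kappa if1) (snd_integral nu iw) w0 f0 addr0.
have k1 := fst_integrable kappa if2; have k2 := snd_integrable nu iw2.
have k3 := product_integrable if1 iw.
have k3' : mu.-integrable setT (EFin \o (fun z => 2 * (f z.1 * w z.2))).
  exact: (integrableZl measurableT 2 k3).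
have k13 := integrableD measurableT k1 k3'.
have k123 := integrableD measurableT k13 k2.
have FE z : F z ^+ 2 = f z.1 ^+ 2 + 2 * (f z.1 * w z.2) + w z.2 ^+ 2.
  by rewrite /F /lifted_affine -/(f z.1) -/(w z.2); ring.
have iF2 : mu.-integrable setT (EFin \o (fun z => F z ^+ 2)).
  by move: k123; apply: eq_integrable => // z _ /=; rewrite FE.
have EF2 : \int[mu]_z (F z ^+ 2) = \int[nu]_x (f x ^+ 2) + \int[kappa]_v (w v ^+ 2).
  transitivity (\int[mu]_z (f z.1 ^+ 2 + 2 * (f z.1 * w z.2) + w z.2 ^+ 2)).
    by apply: eq_Rintegral => z _; exact: FE.
  rewrite (RintegralD measurableT k13 k2) (RintegralD measurableT k1 k3').
  rewrite (fst_integral kappa if2) (snd_integral nu iw2) RintegralZl//.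
  by rewrite (product_integral if1 iw) w0 !mulr0 addr0.
have Ffin : (L2norm mu F < +oo)%E.
  by rewrite L2norm_lty -ge0_fin_numE ?integral_sqr_ge0//; exact: integrable_fin_num iF2.
split.
  by split=> //; apply/Lfun2P; split.
rewrite (L2normE_fin mf ffin) (L2normE_fin mF Ffin) lee_fin ler_wsqrtr// EF2 lerDl.
by apply: Rintegral_ge0 => v _; exact: sqr_ge0.
Qed.

Lemma lifted_drift_norm (a : X) (b : R) :
  L2norm mu (lifted_drift U alpha gamma a) =
  ((alpha + gamma^-1)%:E * L2norm nu (Lx U (fun x => dotv a x + b)%R))%E.
Proof.
have cD : continuous (fun x => 'D_a U x) by exact: continuous_derive_U.
have mD := continuous_measurable_rV cD.
have mD2 : measurable_fun setT (fun z : S => 'D_a U z.1).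
  exact: (measurableT_comp mD measurable_fst).
have c0 : 0 <= alpha + gamma^-1 by rewrite addr_ge0// invr_ge0 ltW.
rewrite (_ : lifted_drift U alpha gamma a = (fun z => - (alpha + gamma^-1) * 'D_a U z.1))//.
rewrite L2normZ// normrN (ger0_norm c0); congr (_ * _)%E.
have -> : Lx U (fun x => dotv a x + b) = (fun x => (- 1) * 'D_a U x).
  by apply/funext => x; rewrite Lx_affine//= mulN1r.
rewrite L2normZ// normrN normr1 mul1e !L2normE; congr sqrte.
rewrite fubini_tonelli1//; last 2 first.
- exact: measurable_sqr.
- by move=> z; rewrite lee_fin sqr_ge0.
apply: eq_integral => x _; rewrite /fubini_F/=.
by rewrite (integral_cst_prob (probability_setT kappa)).
Qed.

(** Rescaling [a] and [b] by the inverse norm of the lift makes its norm 1. The lift is at least as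
    long as [f], so the norm of the drift is at most that obtained by dividing by the norm of
    [f]. *)
Lemma affine_test_function (f : X -> R) (r : R) : affine_fun f -> L02 nu f ->
  L2norm nu f != 0%E -> (L2norm nu (Lx U f) / L2norm nu f)%E = r%:E ->
  exists (a : X) (b : R),
  [/\ L02 mu (lifted_affine gamma a b), L2norm mu (lifted_affine gamma a b) = 1%E,
    lifted_drift U alpha gamma a \in Lfun mu 2%:E &
    (L2norm mu (lifted_drift U alpha gamma a) <= ((gamma^-1 + alpha) * r)%:E)%E].
Proof.
move=> [a [b fE]] f0 fn0 ratio.
have {}fE : f = (fun x => dotv a x + b) by exact/funext.
subst f; have [F0 Ff] := lifted_affine_L02 f0.
set phi := L2norm nu _ in fn0 ratio Ff.
have [FL F00] := F0; have [mF Ffin] := (Lfun2P _ _).1 FL.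
have [_ ffin] := (Lfun2P _ _).1 f0.1.
have phifin : phi \is a fin_num by rewrite ge0_fin_numE// L2norm_ge0.
have phiE := fineK phifin.
have phi0 : 0 < fine phi by rewrite lt_def -eqe phiE fn0 -lee_fin phiE L2norm_ge0.
set N := L2norm mu _ in Ff Ffin.
have Nfin : N \is a fin_num by rewrite ge0_fin_numE// L2norm_ge0.
have NE := fineK Nfin.
have phiN : fine phi <= fine N by rewrite -lee_fin phiE NE.
have N0 : 0 < fine N := lt_le_trans phi0 phiN.
(* The finite ratio rules out an infinite numerator, because +oo divided by a positive real is
   +oo. *)
have LE : L2norm nu (Lx U (fun x => dotv a x + b)) = (r * fine phi)%:E.
  move: ratio; rewrite -phiE inver gt_eqF//; have := L2norm_ge0 nu (Lx U (fun x => dotv a x + b)).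
  case: L2norm => [l| |] // _.
    by rewrite -EFinM => -[<-]; rewrite divfK// gt_eqF.
  by rewrite mulyr gtr0_sg ?invr_gt0// mul1e.
have r0 : 0 <= r.
  by have := L2norm_ge0 nu (Lx U (fun x => dotv a x + b)); rewrite LE lee_fin pmulr_lge0.
pose k := (fine N)^-1.
have k0 : 0 < k by rewrite invr_gt0.
have U1 : Ck 1 U.
  case: U_C2 => cU H; split => // v; have [h1 [h2 _]] := H v; by split.
have FE : lifted_affine gamma (k *: a) (k * b) = (fun z => k * lifted_affine gamma a b z).
  by apply/funext => z; rewrite /lifted_affine !dotvZl; ring.
have gE : lifted_drift U alpha gamma (k *: a) = (fun z => k * lifted_drift U alpha gamma a z).
  by apply/funext => z; rewrite /lifted_drift !derive_dotv_sum// dotvZl; ring.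
have mg : measurable_fun setT (lifted_drift U alpha gamma a).
  by apply: continuous_measurable_rV2; exact: continuous_lifted_drift.
have F1 : L2norm mu (lifted_affine gamma (k *: a) (k * b)) = 1%E.
  by rewrite FE L2normZ// -/N -NE -EFinM gtr0_norm// mulVf// gt_eqF.
have gn : L2norm mu (lifted_drift U alpha gamma (k *: a)) =
    (k * ((alpha + gamma^-1) * (r * fine phi)))%:E.
  by rewrite gE L2normZ// (lifted_drift_norm _ b) LE -!EFinM gtr0_norm.
exists (k *: a), (k * b); split=> //.
- split.
    apply/Lfun2P; split; last by rewrite F1 ltry.
    by rewrite FE; exact: measurable_funM.
  rewrite FE RintegralZl//; first by rewrite F00 mulr0.
  exact: (L2_integrable (probability_setT mu) mF (etrans (esym (L2norm_lty mu _)) Ffin)).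
- apply/Lfun2P; split; last by rewrite gn ltry.
  by rewrite gE; exact: measurable_funM.
- rewrite gn lee_fin.
  have -> : k * ((alpha + gamma^-1) * (r * fine phi)) = ((gamma^-1 + alpha) * r) * (k * fine phi)
    by ring.
  rewrite ler_piMr ?mulr_ge0 ?addr_ge0 ?invr_ge0 ?(ltW gamma_gt0)//.
  by rewrite /k mulrC ler_pdivrMr// mul1r.
Qed.

End affine_test.

Section relaxation_bounds.
Variables (R : realType) (n : nat).
Local Notation X := 'rV[R]_n.
Local Notation S := ('rV[R]_n * 'rV[R]_n)%type.
Variables (U : X -> R) (nu kappa : probability X R) (alpha gamma : R).
Hypotheses (n_gt0 : (0 < n)%N) (U_C2 : Ck 2 U)
  (U_infty : forall M : R, exists r : R, forall x, r < enorm x -> M < U x)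
  (kg : std_gaussian kappa) (alpha_ge0 : 0 <= alpha) (gamma_ge0 : 0 <= gamma).
Context (dO : measure_display) (O : measurableType dO) (P : probability O R).
Variables (B W : R -> O -> X) (Z : S -> R -> O -> S) (p : R -> R.-pker S ~> S).
Hypothesis lang : perturbed_langevin U alpha gamma (nu \x kappa)%E P B W Z p.
Local Notation mu := (nu \x kappa)%E.
Local Notation K := (1 - expR (-1) : R).

Let K_gt0 : 0 < K.
Proof. by rewrite subr_gt0 expR_lt1// oppr_lt0. Qed.

Let inv : invariant_measure mu p := langevin_invariant lang.
Let CK : chapman_kolmogorov p := langevin_markov lang.
Let P0 := kernel_start lang.

Lemma hypoelliptic_bounds : alpha = 0 ->
  [/\ (singular_gap mu (L2_generator mu p) <= (2 * gamma)%:E)%E,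
      (K%:E / gamma%:E <= trel_bar mu p)%E &
      (K%:E / (2 * gamma)%:E <= trel mu p)%E].
Proof.
move=> alpha0; have lang0 : perturbed_langevin U 0 gamma mu P B W Z p by rewrite -alpha0.
have test e : 0 < e -> exists f : S -> R, [/\ L02 mu f, L2norm mu f = 1%E,
    (exists2 g, L2_generator mu p f g & L2norm mu g <= (2 * gamma + e)%:E)%E,
    (forall s, 0 <= s -> (L2norm mu (fun z => transition_semigroup p s f z - f z)%R <=
      (s * (2 * gamma + e))%:E)%E) &
    forall t, 0 <= t -> {ae mu, forall z, exists2 phi : R -> R, continuous phi &
      forall s, 0 <= s <= t -> phi s = transition_semigroup p s f z}].
  move=> e0; have [f [g [M [[cf bf f0 f1 G] gn]]]] :=
    energy_generator n_gt0 U_C2 U_infty kg gamma_ge0 lang0 e0.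
  have mf : measurable_fun setT f := continuous_measurable_rV2 cf.
  exists f; split => //; first by exists g.
    move=> s s0; apply: le_trans (L2norm_generator_bound inv CK P0 s0 mf bf G) _.
    rewrite EFinM; apply: lee_pmul => //.
    exact: L2norm_ge0.
  move=> t t0; apply: nearW => z; exists (fun s => transition_semigroup p (Num.max 0 s) f z).
    apply: (continuous_semigroup lang); [exact: cf|exact: bf].
  by move=> s /andP[s0 _]; rewrite max_r.
split.
- apply/lee_addgt0Pr => e e0; have [f [f0 f1 [g G gn] _ _]] := test e e0.
  by rewrite -EFinD; exact: (singular_gap_le f0 f1 G gn).
(* The slack is doubled so that 2 K / (2 gamma + 2 e) reduces to K / (gamma + e). *)
- apply: lee_div_limit => // e e0; have e2 : 0 < 2 * e by rewrite mulr_gt0.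
  have [f [f0 f1 _ fc cont]] := test _ e2.
  have c0 : 0 < 2 * gamma + 2 * e by rewrite ltr_wpDl ?mulr_ge0.
  have := trel_bar_lower_bound c0 f0 f1 fc cont.
  by rewrite -mulrDr invfM mulrACA divff ?mul1r// pnatr_eq0.
- apply: lee_div_limit; rewrite ?mulr_ge0// => e e0.
  have [f [f0 f1 _ fc _]] := test _ e0.
  have c0 : 0 < 2 * gamma + e by rewrite ltr_wpDl ?mulr_ge0.
  exact: trel_lower_bound c0 f0 f1 fc.
Qed.

Variable m : R.
Hypotheses (m_gt0 : 0 < m) (mt_ge : (m%:E <= mtilde U nu)%E).

Lemma affine_bounds :
  [/\ (singular_gap mu (L2_generator mu p) <= (gamma%:E^-1 + alpha%:E) * mtilde U nu)%E,
      ((2 * K)%:E / (mtilde U nu * (gamma%:E^-1 + alpha%:E)) <= trel_bar mu p)%E &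
      (K%:E / (mtilde U nu * (gamma%:E^-1 + alpha%:E)) <= trel mu p)%E].
Proof.
(* Here the bound on the gap is +oo and the bounds on the times are 0, as 1 / oo = 0. This covers
   gamma = 0, where [gamma%:E^-1] is +oo and [mtilde] is positive, and [mtilde] = +oo. *)
have infty_case : (mtilde U nu * (gamma%:E^-1 + alpha%:E) = +oo)%E ->
  [/\ (singular_gap mu (L2_generator mu p) <= (gamma%:E^-1 + alpha%:E) * mtilde U nu)%E,
      ((2 * K)%:E / (mtilde U nu * (gamma%:E^-1 + alpha%:E)) <= trel_bar mu p)%E &
      (K%:E / (mtilde U nu * (gamma%:E^-1 + alpha%:E)) <= trel mu p)%E].
  move=> H; rewrite [X in (_ <= X)%E]muleC H invey !mule0.
  by split; [rewrite leey|exact: trel_bar_ge0|exact: trel_ge0].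
have mt0 : (0 < mtilde U nu)%E by apply: lt_le_trans mt_ge; rewrite lte_fin.
have [g0|gn0] := eqVneq gamma 0.
  by apply: infty_case; rewrite g0 inver eqxx addye// gt0_muley.
have gp : 0 < gamma by rewrite lt_def gn0.
have BE : (gamma%:E^-1 + alpha%:E = (gamma^-1 + alpha)%:E)%E by rewrite inver (negPf gn0).
set b := gamma^-1 + alpha in BE.
have b0 : 0 < b by rewrite ltr_wpDr ?invr_gt0.
case mtE : (mtilde U nu) => [r| |]; last 2 first.
- by rewrite -mtE; apply: infty_case; rewrite mtE BE gt0_mulye.
- by move: mt0; rewrite mtE.
rewrite BE; rewrite mtE lte_fin in mt0.
have test e : 0 < e -> exists F g : S -> R, [/\ L02 mu F, L2norm mu F = 1%E,
    L2_generator mu p F g /\ (L2norm mu g <= (r * b + e)%:E)%E,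
    (forall s, 0 <= s -> (L2norm mu (fun z => transition_semigroup p s F z - F z)%R <=
      (s * (r * b + e))%:E)%E) &
    forall t, 0 <= t -> {ae mu, forall z, exists2 phi : R -> R, continuous phi &
      forall s, 0 <= s <= t -> phi s = transition_semigroup p s F z}].
  move=> e0; have eb : 0 < e / b by rewrite divr_gt0.
  have mfin : mtilde U nu \is a fin_num by rewrite mtE.
  (* An affine function whose ratio [q] exceeds [mtilde] by less than e / b; after multiplication by
     [b] the excess is less than [e]. *)
  have [q [f [fa f0 fn0 qf]] fr] := lb_ereal_inf_adherent eb mfin.
  have q0 : (0 <= q)%E by rewrite qf mule_ge0 ?inve_ge0 ?L2norm_ge0.
  have {}fr : (q < r%:E + (e / b)%:E)%E by rewrite -mtE.
  have qfin : q \is a fin_num by rewrite ge0_fin_numE//; apply: lt_trans fr _; rewrite -EFinD ltry.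
  have qE : q = (fine q)%:E by rewrite fineK.
  have [a [b' [F0 F1 gL gn]]] := affine_test_function U_C2 kg alpha_ge0 gp fa f0 fn0 (etrans
    (esym qf) qE).
  have FL : lifted_affine gamma a b' \in Lfun mu 2%:E by case: F0.
  have gn2 : (L2norm mu (lifted_drift U alpha gamma a) <= (r * b + e)%:E)%E.
    apply: le_trans gn _; rewrite lee_fin -/b.
    have : fine q <= r + e / b.
      by rewrite -lee_fin -qE EFinD ltW.
    move=> /(ler_wpM2l (ltW b0)); rewrite mulrDr [b * (e / b)]mulrCA divff ?gt_eqF// mulr1.
    by rewrite [b * r]mulrC.
  have c0 : 0 <= r * b + e by rewrite addr_ge0 ?mulr_ge0 ?ltW.
  exists (lifted_affine gamma a b'), (lifted_drift U alpha gamma a); split => //.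
  - by split => //; exact: (lifted_affine_generator U_C2 gp lang FL gL).
  - by move=> s s0; exact: (lifted_affine_increment U_C2 gp lang b' gL s0 c0 gn2).
  - by move=> t t0; exact: (lifted_affine_continuity U_C2 gp lang b' gL t0).
have rb0 : 0 <= r * b by rewrite mulr_ge0 ?ltW.
split.
- apply/lee_addgt0Pr => e e0; have [F [g [F0 F1 [G gn] _ _]]] := test e e0.
  by rewrite muleC -EFinM -EFinD; exact: (singular_gap_le F0 F1 G gn).
- rewrite -EFinM; apply: lee_div_limit; rewrite ?mulr_gt0// => e e0.
  have [F [g [F0 F1 _ Fc cont]]] := test e e0.
  have c0 : 0 < r * b + e by rewrite ltr_wpDl.
  exact: trel_bar_lower_bound c0 F0 F1 Fc cont.
- rewrite -EFinM; apply: lee_div_limit => // e e0.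
  have [F [g [F0 F1 _ Fc _]]] := test e e0.
  have c0 : 0 < r * b + e by rewrite ltr_wpDl.
  exact: trel_lower_bound c0 F0 F1 Fc.
Qed.

End relaxation_bounds.

Theorem theorem25 (R : realType) (d : nat) (d_gt0 : (0 < d)%N)
  (U : 'rV[R]_d -> R) (U_C2 : Ck 2 U)
  (U_infty : forall M : R, exists r : R, forall x, r < enorm x -> M < U x)
  (U_int : (leb d).-integrable setT (fun x => (expR (- U x))%:E))
  (nu kappa : probability 'rV[R]_d R)
  (nu_gibbs : gibbs U nu) (kappa_gaussian : std_gaussian kappa)
  (m : R) (m_gt0 : 0 < m) (nu_poincare : poincare nu m)
  (alpha gamma : R) (alpha_ge0 : 0 <= alpha) (gamma_ge0 : 0 <= gamma)
  (dO : measure_display) (O : measurableType dO) (P : probability O R)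
  (B W : R -> O -> 'rV[R]_d)
  (Z : 'rV[R]_d * 'rV[R]_d -> R -> O -> 'rV[R]_d * 'rV[R]_d)
  (p : R -> R.-pker ('rV[R]_d * 'rV[R]_d) ~> ('rV[R]_d * 'rV[R]_d)%type)
  (langevin :
    perturbed_langevin U alpha gamma (nu \x kappa)%E P B W Z p) :
  (alpha = 0 ->
    [/\ (singular_gap (nu \x kappa) (L2_generator (nu \x kappa) p)
           <= (2 * gamma)%:E)%E,
        (trel_bar (nu \x kappa) p >= (1 - expR (-1))%:E / gamma%:E)%E &
        (trel (nu \x kappa) p >= (1 - expR (-1))%:E / (2 * gamma)%:E)%E]) /\
  [/\ (singular_gap (nu \x kappa) (L2_generator (nu \x kappa) p)
         <= (gamma%:E^-1 + alpha%:E) * mtilde U nu)%E,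
      (trel_bar (nu \x kappa) p >=
         (2 * (1 - expR (-1)))%:E / (mtilde U nu * (gamma%:E^-1 + alpha%:E)))%E &
      (trel (nu \x kappa) p >=
         (1 - expR (-1))%:E / (mtilde U nu * (gamma%:E^-1 + alpha%:E)))%E].
Proof.
split; first exact: (hypoelliptic_bounds d_gt0 U_C2 U_infty kappa_gaussian gamma_ge0 langevin).
apply: (affine_bounds U_C2 kappa_gaussian alpha_ge0 gamma_ge0 langevin m_gt0).
exact: (mtilde_ge U_C2 U_int nu_gibbs m_gt0 nu_poincare).
Qed.
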